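(* Let $q\in[1,2]$. (a) For $p\in(0,1)$, the set of points $a\in(0,1)$ at which $|\mathcal W_{a,p,q}|\ge2$ is countable (that is, finite or countably infinite). (b) If $q\in\{1,2\}$, the set of pairs $(a,p)\in(0,1)^2$ at which $|\mathcal V_{a,p,q}|\ge2$ may be covered by a countable family of rectifiable curves of $\mathbb R^2$.
   Context: Let $d\ge2$ and let $\mathbb L^d=(\mathbb Z^d,\mathbb E^d)$ be the hypercubic lattice, where $\mathbb E^d$ is the set of unordered pairs $\langle x,y\rangle$ with $\sum_i|x_i-y_i|=1$. A box-region is a pair $\Lambda=(V,E)$ where $V=\prod_{i=1}^d[a_i,b_i]$ is a box of $\mathbb Z^d$ and $E$ is the set of all edges of $\mathbb E^d$ with at least one endvertex in $V$; $V^+$ is the set of endvertices of edges in $E$. $\Lambda\uparrow\mathbb L^d$ means that $\Lambda$ runs along a sequence of box-regions whose vertex-sets increase to $\mathbb Z^d$. Let $\Psi=\{0,1\}^{\mathbb Z^d}$, $\Omega=\{0,1\}^{\mathbb E^d}$. For $\psi\in\Psi$, $\omega\in\Omega$ let $\mathbb Z^d_\psi=\{x:\psi_x=1\}$, $\mathbb E^d_\psi=\{\langle x,y\rangle\in\mathbb E^d:\psi_x=\psi_y=1\}$, $\eta(\omega)=\{e:\omega_e=1\}$. Let $\Theta$ be the set of $(\psi,\omega)\in\Psi\times\Omega$ with $\eta(\omega)\subseteq\mathbb E^d_\psi$. For $\lambda=(\kappa,\rho)\in\Theta$ let $\Theta^\lambda_\Lambda$ be the set of $(\psi,\omega)\in\Theta$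 with $\psi_x=\kappa_x$ for $x\notin V$ and $\omega_e=\rho_e$ for $e\notin E$. With $r=\sqrt{1-p}$, the diluted-random-cluster measure on $\Lambda$ with boundary condition $\lambda$ is the probability measure on $\Psi\times\Omega$ $$\phi^\lambda_{\Lambda,a,p,q}(\theta)=\frac1Z\,r^{|E_\psi|}q^{k(\theta,\Lambda)}\prod_{x\in V}\Big(\frac a{1-a}\Big)^{\psi_x}\prod_{e\in E_\psi}\Big(\frac p{1-p}\Big)^{\omega_e},\qquad\theta=(\psi,\omega)\in\Theta^\lambda_\Lambda,$$ and $0$ otherwise, where $E_\psi=\{\langle x,y\rangle\in E:\psi_x=\psi_y=1\}$, $k(\theta,\Lambda)$ is the number of connected components of $(\mathbb Z^d_\psi,\eta(\omega))$ that intersect $V^+$, and $Z$ is the normalizing constant. Its marginal on the vertex component $\Psi$ is $\Phi^\lambda_{\Lambda,a,p,q}$. $\mathcal W_{a,p,q}$ is the set of limit vertex-measures with parameters $a,p,q$: probability measures on $\Psi$ that, for some $\lambda\in\Theta$, are accumulation points (in the weak topology) of $\Phi^\lambda_{\Lambda,a,p,q}$ as $\Lambda\uparrow\mathbb L^d$. $\mathcal V_{a,p,q}$ is the set of weak-limit diluted-random-cluster measures with parameters $a,p,q$: probability measures on $\Psi\times\Omega$ that, for some $\lambda\in\Theta$, are accumulation points of $\phi^\lambda_{\Lambda,a,p,q}$ as $\Lambda\uparrow\mathbb L^d$. *)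

(* Defs.v *)
From HB Require Import structures.
From mathcomp Require Import all_boot all_order all_algebra finmap.
From mathcomp Require Import all_classical all_reals all_analysis.
From mathcomp Require Import zify.

Set Implicit Arguments.
Unset Strict Implicit.
Unset Printing Implicit Defensive.

Import Order.TTheory GRing.Theory Num.Theory.
Import numFieldNormedType.Exports.

Local Open Scope classical_set_scope.
Local Open Scope ring_scope.

(** * The hypercubic lattice and its box-regions *)

Notation zd d := {ffun 'I_d -> int}.

Definition l1_dist d (x y : zd d) : int := \sum_i `|x i - y i|.

Definition is_edge d (e : {fset zd d}) : bool :=
  `[< exists x y : zd d, l1_dist x y = 1 /\ e = [fset x; y]%fset >].

Notation edge d := {e : {fset zd d} | is_edge e}.

Record box d := Box {
  box_lo : zd d;
  box_hi : zd d;
  box_le : forall i, box_lo i <= box_hi i }.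

Definition box_vertices d (L : box d) : set (zd d) :=
  [set x | forall i, box_lo L i <= x i <= box_hi L i].

Definition box_edges d (L : box d) : set (edge d) :=
  [set e | exists2 x, x \in val e & box_vertices L x].

Definition box_closure d (L : box d) : set (zd d) :=
  [set x | exists2 e, box_edges L e & x \in val e].

Definition increases_to_lattice d (L : nat -> box d) : Prop :=
  (forall n, box_vertices (L n) `<=` box_vertices (L n.+1)) /\
  \bigcup_n box_vertices (L n) = setT.

(** * Configuration spaces *)

HB.structure Definition TopologicalMeasurable disp :=
  {T of Topological T & Measurable disp T}.

HB.instance Definition _ d1 d2 (T1 : TopologicalMeasurable.type d1)
  (T2 : TopologicalMeasurable.type d2) := Measurable.on (T1 * T2)%type.

(* Both spaces carry the product topology of discrete [bool] and its Borel
   sigma-algebra; as the index sets are countable, the latter is also the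
   sigma-algebra generated by the coordinate maps. *)

Definition vertex_config d : Type := {ptws zd d -> bool}.
HB.instance Definition _ d := Topological.on (vertex_config d).
HB.instance Definition _ d := Pointed.on (vertex_config d).
HB.instance Definition _ d := Measurable.copy (vertex_config d)
  (g_sigma_algebraType (@open (vertex_config d))).

Definition edge_config d : Type := {ptws edge d -> bool}.
HB.instance Definition _ d := Topological.on (edge_config d).
HB.instance Definition _ d := Pointed.on (edge_config d).
HB.instance Definition _ d := Measurable.copy (edge_config d)
  (g_sigma_algebraType (@open (edge_config d))).

Notation config d := (vertex_config d * edge_config d)%type.

Definition compatible d : set (config d) :=
  [set t : config d | forall (e : edge d) (x : zd d),
     t.2 e -> x \in val e -> t.1 x].

Definition compatible_in d (L : box d) (lam : config d) : set (config d) :=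
  [set t | [/\ compatible t,
    forall x, ~ box_vertices L x -> t.1 x = lam.1 x &
    forall e, ~ box_edges L e -> t.2 e = lam.2 e]].

Definition open_step d (t : config d) (x y : zd d) : bool :=
  `[< exists2 e : edge d, t.2 e & val e = [fset x; y]%fset >].

Definition component d (t : config d) (x : zd d) : set (zd d) :=
  [set y | exists2 s, path (open_step t) x s & last x s = y].

Definition components d (t : config d) : set (set (zd d)) :=
  [set component t x | x in [set x | t.1 x]].

Definition num_components d (L : box d) (t : config d) : nat :=
  #|` fset_set
        [set C | components t C /\ C `&` box_closure L !=set0] |.

Definition open_edges d (L : box d) (t : config d) : set (edge d) :=
  [set e | box_edges L e /\ forall x, x \in val e -> t.1 x].

(** * Diluted-random-cluster measures *)

Section diluted_random_cluster.
Context {R : realType} {d : nat}.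
Implicit Types (a p q : R) (L : box d) (lam t : config d).

Definition drc_weight a p q L t : R :=
  Num.sqrt (1 - p) ^+ #|` fset_set (open_edges L t)| *
  q ^+ num_components L t *
  \big[*%R/1]_(x \in box_vertices L) (a / (1 - a)) ^+ t.1 x *
  \big[*%R/1]_(e \in open_edges L t) (p / (1 - p)) ^+ t.2 e.

Definition drc_partition a p q L lam : R :=
  \sum_(t \in compatible_in L lam) drc_weight a p q L t.

(* All index sets above are finite, so the finitely-supported big operators
   are the honest sums and products; [drc_measure_exists] below shows that such
   a probability measure exists, and its values on measurable sets are fixed. *)
Definition is_drc_measure a p q L lam (P : probability (config d) R) : Prop :=
  forall A, measurable A ->
  P A = ((drc_partition a p q L lam)^-1 *
         \sum_(t \in A `&` compatible_in L lam) drc_weight a p q L t)%:E.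

Definition vertex_proj (t : config d) : vertex_config d := t.1.

HB.instance Definition _ :=
  isMeasurableFun.Build _ _ _ _ vertex_proj (@measurable_fst _ _ _ _).

Definition vertex_marginal (P : probability (config d) R) :
  probability (vertex_config d) R := distribution P vertex_proj.

End diluted_random_cluster.

(** * The measures are well defined *)

Lemma finite_between d (a b : zd d) :
  finite_set [set x : zd d | forall i, a i <= x i <= b i].
Proof.
pose N := (\max_i `|b i - a i|%N).+1.
pose f (k : {ffun 'I_d -> 'I_N}) : zd d := [ffun i => a i + (k i)%:Z].
apply: (@sub_finite_set _ _ (range f)); last exact/finite_image/finite_finset.
move=> x /= xab.
have lt i : (`|(x i - a i)%R|%N < N)%N.
  rewrite ltnS; apply: (@leq_trans `|b i - a i|%N).
    by have := xab i; lia.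
  exact: leq_bigmax.
exists [ffun i => Ordinal (lt i)] => //.
by apply/ffunP => i; rewrite !ffunE /=; have := xab i; lia.
Qed.

Lemma finite_box_vertices d (L : box d) : finite_set (box_vertices L).
Proof. exact: finite_between. Qed.

Lemma finite_box_edges d (L : box d) : finite_set (box_edges L).
Proof.
pose B : set (zd d) := [set x | forall i,
  ([ffun i => box_lo L i - 1] : zd d) i <= x i <=
  ([ffun i => box_hi L i + 1] : zd d) i].
have Bfin : finite_set B by exact: finite_between.
pose f (xy : zd d * zd d) := [fset xy.1; xy.2]%fset.
apply: (@sub_finite_set _ _ (val @^-1` [set f xy | xy in B `*` B])); last first.
  apply: finite_preimage; first by move=> ? ? _ _ /val_inj.
  by apply: finite_image; exact: finite_setX.
move=> [e /[dup] he /asboolP[x [y [xy exy]]]] [z /= ze zL].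
have near (u v : zd d) : l1_dist u v = 1 -> box_vertices L u -> B u /\ B v.
  move=> uv uL; split=> i; rewrite !ffunE; have := uL i; first by lia.
  have : `|u i - v i| <= 1.
    rewrite -uv /l1_dist (bigD1 i) //= lerDl; apply: sumr_ge0 => j _.
    exact: normr_ge0.
  by lia.
have [xB yB] : B x /\ B y.
  move: ze; rewrite exy !inE => /orP[]/eqP zE; subst z; first exact: near.
  suff [] : B y /\ B x by []; apply: near => //; rewrite -xy /l1_dist.
  by apply: eq_bigr => i _; rewrite distrC.
by exists (x, y) => //=.
Qed.

Lemma finite_compatible_in d (L : box d) (lam : config d) :
  finite_set (compatible_in L lam).
Proof.
pose V := fset_set (box_vertices L); pose E := fset_set (box_edges L).
pose f (AB : {fset zd d} * {fset edge d}) : config d :=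
  (fun x => if x \in V then x \in AB.1 else lam.1 x,
   fun e => if e \in E then e \in AB.2 else lam.2 e).
apply: (@sub_finite_set _ _
  (f @` ([set` fpowerset V] `*` [set` fpowerset E]))); last first.
  by apply: finite_image; apply: finite_setX; exact: finite_fset.
move=> t [_ t1 t2].
exists ([fset x in V | t.1 x]%fset, [fset e in E | t.2 e]%fset).
  by split; rewrite /= fpowersetE; apply/fsubsetP => ?; rewrite !inE => /andP[].
rewrite [RHS]surjective_pairing; congr pair; apply/funext => x /=.
- case: ifPn => xV; first by rewrite !inE xV.
  rewrite t1 // => xL; move: xV; rewrite in_fset_set ?mem_set //.
  exact: finite_box_vertices.
- case: ifPn => xV; first by rewrite !inE xV.
  rewrite t2 // => xL; move: xV; rewrite in_fset_set ?mem_set //.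
  exact: finite_box_edges.
Qed.

Lemma compatible_in_nonempty d (L : box d) (lam : config d) :
  compatible lam -> compatible_in L lam !=set0.
Proof.
move=> clam.
exists ((fun x => if x \in box_vertices L then false else lam.1 x),
        (fun e => if e \in box_edges L then false else lam.2 e)).
split=> [e x|x|e] /=; last 2 first.
- by case: ifPn => // /set_mem.
- by case: ifPn => // /set_mem.
case: ifPn => // eL le xe; case: ifPn => [xL|_]; last exact: clam le xe.
by exfalso; move/negP: eL; apply; apply/mem_set; exists x => //; apply/set_mem.
Qed.

Lemma drc_weight_gt0 (R : realType) d (a p q : R) (L : box d) t :
  0 < a < 1 -> 0 < p < 1 -> 0 < q -> 0 < drc_weight a p q L t.
Proof.
move=> /andP[a0 a1] /andP[p0 p1] q0; rewrite /drc_weight.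
have odds (x : R) : 0 < x -> x < 1 -> 0 < x / (1 - x).
  by move=> ? ?; rewrite divr_gt0 ?subr_gt0.
by rewrite !mulr_gt0 ?exprn_gt0 ?sqrtr_gt0 ?subr_gt0 //;
  apply: prodr_gt0 => i _; rewrite exprn_gt0 // odds.
Qed.

Lemma drc_measure_exists (R : realType) d (a p q : R) (L : box d)
    (lam : config d) :
  0 < a < 1 -> 0 < p < 1 -> 0 < q -> compatible lam ->
  exists P, is_drc_measure a p q L lam P.
Proof.
move=> ha hp hq clam.
have w0 t : 0 < drc_weight a p q L t by exact: drc_weight_gt0.
have Cfin := finite_compatible_in L lam.
pose s := enum_fset (fset_set (compatible_in L lam)).
pose m : (measure (config d) R)^nat := fun k =>
  mscale (NngNum (ltW (w0 (nth lam s k)))) (dirac (nth lam s k)).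
pose mu : measure (config d) R := msum m (size s).
have muE (A : set (config d)) : mu A =
    (\sum_(t \in A `&` compatible_in L lam) drc_weight a p q L t)%:E.
  rewrite setIC fsbig_mkcondr fsbig_finite //= /mu /msum /= -sumEFin.
  rewrite [RHS](big_nth lam) big_mkord; apply: eq_bigr => k _.
  rewrite /m /mscale /= diracE; case: ifPn => _; by rewrite ?mule1 ?mule0.
have Z0 : 0 < drc_partition a p q L lam.
  rewrite /drc_partition fsbig_finite //=.
  have [t tC] := compatible_in_nonempty L clam.
  rewrite (big_fsetD1 t) ?in_fset_set ?mem_set //=.
  by rewrite ltr_pwDl // sumr_ge0 // => u _; rewrite ltW.
have muT : mu setT = (drc_partition a p q L lam)%:E by rewrite muE setTI.
exists (mnormalize mu (dirac lam)) => A _.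
transitivity (@mnormalize _ _ _ mu (dirac lam) A); first by [].
by rewrite /mnormalize muT eqe (gt_eqF Z0) /= muE -EFinM mulrC.
Qed.

(** * Weak topology and limit measures *)

Section weak_limits.
Context {R : realType} {disp} {T : TopologicalMeasurable.type disp}.

Definition bounded_continuous : Type :=
  {f : T -> R | continuous f /\ bounded_fun f}.

Definition weak_space : Type :=
  initial_topology (fun (P : probability T R) =>
    (fun f => \int[P]_x sval f x) : {ptws bounded_continuous -> R}).

HB.instance Definition _ := Topological.on weak_space.

Definition weak_accumulation_point (P : nat -> probability T R)
  (mu : probability T R) : Prop :=
  @cluster weak_space (P @ \oo) mu.

(* Equality of the underlying set functions is too fine here, since they also
   take (meaningless) values on non-measurable sets. *)
Definition at_least_two (M : set (probability T R)) : Prop :=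
  exists mu nu, [/\ M mu, M nu & exists2 A, measurable A & mu A <> nu A].

End weak_limits.


Section limit_measures.
Context {R : realType}.
Variables (d : nat) (a p q : R).

Definition drc_sequence (L : nat -> box d) (lam : config d)
    (P : nat -> probability (config d) R) : Prop :=
  [/\ compatible lam, increases_to_lattice L &
      forall n, is_drc_measure a p q (L n) lam (P n)].

Definition limit_vertex_measures : set (probability (vertex_config d) R) :=
  [set mu | exists lam L P, drc_sequence L lam P /\
    weak_accumulation_point (fun n => vertex_marginal (P n)) mu].

Definition weak_limit_drc_measures : set (probability (config d) R) :=
  [set mu | exists lam L P, drc_sequence L lam P /\
    weak_accumulation_point P mu].

End limit_measures.
Arguments limit_vertex_measures {R} d a p q.
Arguments weak_limit_drc_measures {R} d a p q.

(** * Rectifiable curves *)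

Section rectifiable.
Context {R : realType}.

Definition euclidean_dist (u v : R * R) : R :=
  Num.sqrt ((u.1 - v.1) ^+ 2 + (u.2 - v.2) ^+ 2).

Definition polygonal_length (g : R -> R * R) (a : R) (s : seq R) : R :=
  \sum_(i < size s)
    euclidean_dist (g (nth a (a :: s) i)) (g (nth a (a :: s) i.+1)).

Definition curve_length (g : R -> R * R) (a b : R) : \bar R :=
  ereal_sup [set (polygonal_length g a s)%:E | s in itv_partition a b].

Definition rectifiable_curve (C : set (R * R)) : Prop :=
  exists (g : R -> R * R) (a b : R),
    [/\ a < b, {within `[a, b], continuous g},
        (curve_length g a b < +oo)%E & C = g @` `[a, b]].

Definition countably_rectifiable_cover (A : set (R * R)) : Prop :=
  exists F : set (set (R * R)),
    [/\ countable F, F `<=` rectifiable_curve & A `<=` \bigcup_(C in F) C].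

End rectifiable.

(* Main.v *)
Require Import Defs.
From mathcomp Require Import all_boot all_order all_algebra finmap.
From mathcomp Require Import all_classical all_reals all_analysis.
From mathcomp Require Import zify lra.

(* Given the set of occupied vertices, the edges follow a random-cluster
   measure, and making an edge e available multiplies its partition function
   by the mean of r (1 + p/(1-p) q^(-delta)), where delta is 1 if the endpoints
   of e are not yet connected and 0 otherwise.  For 1 <= q <= 2 this factor is
   at least 1 and increases with the configuration and with p.  Holley's
   inequality, applied first to edges and then to vertices, therefore makes the
   mean of an increasing function increase with a, p and the boundary
   condition.  So the means under the extremal boundary conditions 0 and 1 have
   monotone limits, and limit measures are unique as soon as these limits agree
   for the vertex density h and the edge density w.

   The partition functions with boundary conditions 0 and 1 differ by a factor
   exponential in the surface of the box.  Jensen's inequality bounds the growth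
   of the first from above and of the second from below, so that after division
   by the volume h^1(a, p) <= h^0(a', p) for a < a'.  In the same way
   w^1(a, p) <= w^0(a', p') for a < a' and p < p': between a and a' there is a
   point where the vertex densities almost agree, and there the contribution of
   |E_psi| to the energy is negligible.

   Hence, for a rational c, the set of a where h^0 < c < h^1 has at most one
   point, while the set of (a, p) where h^0 < c < h^1 or w^0 < c < w^1 contains
   no two points that are strictly ordered in both coordinates, and so lies on a
   Lipschitz graph over the direction a - p. *)

Set Implicit Arguments.
Unset Strict Implicit.
Unset Printing Implicit Defensive.

Import Order.TTheory GRing.Theory Num.Theory.
Import numFieldNormedType.Exports.

Local Open Scope classical_set_scope.
Local Open Scope ring_scope.

(** * Holley's inequality *)

(** Write c = q^(-delta). Since r^2 = 1 - p, the factor of an edge is r (1 - c) + c / r, which for r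
    <= 1 increases with c, and which is at least 1 and decreasing in r once c >= 1/2: this is where
    q <= 2 enters. The bound q >= 1 enters through the positive correlation of open edges. To keep
    every comparison down to one edge, a vertex is added in two stages: isolated, which costs a
    factor q in every configuration, and then with its edges made available one at a time.

    Means are finite sums over configurations with prescribed values off a box. The extremal limits
    are an infimum and a supremum over cubes, and their translation invariance is used as
    inequalities between nested boxes. Probability measures return only at the end: the events that
    finitely many coordinates equal 1 form a pi-system of increasing events, so bounds on increasing
    means determine a measure.

    The difficulty in the direction of p is that raising p lowers r, so |E_psi| has a negative
    coefficient in the energy. Its mean must be controlled from the other side, through the numbers
    of occupied vertices under both boundary conditions. *)

Lemma four_points (R : realType) (a0 a1 b0 b1 g0 g1 d0 d1 : R) :
  0 <= d0 -> 0 <= d1 -> 0 <= g0 -> 0 <= g1 ->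
  0 <= b0 -> 0 <= b1 -> 0 <= a0 -> 0 <= a1 ->
  a0 * b0 <= g0 * d0 -> a0 * b1 <= g0 * d1 ->
  a1 * b0 <= g0 * d1 -> a1 * b1 <= g1 * d1 ->
  (a0 + a1) * (b0 + b1) <= (g0 + g1) * (d0 + d1).
Proof.
move=> hd0 hd1 hg0 hg1 hb0 hb1 ha0 ha1 h00 h01 h10 h11.
have [z|nz] := eqVneq (g0 * d1) 0.
  have e1 : a0 * b1 = 0 by apply/le_anti; rewrite -{1}z h01 mulr_ge0.
  have e2 : a1 * b0 = 0 by apply/le_anti; rewrite -{1}z h10 mulr_ge0.
  have : 0 <= g1 * d0 by rewrite mulr_ge0.
  by lra.
have P0 : 0 < g0 * d1 by rewrite lt_def nz mulr_ge0.
(* [(P - a0 b1) (P - a1 b0) >= 0] for [P = g0 d1] gives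
   [a0 b1 + a1 b0 <= P + a0 b0 a1 b1 / P], and
   [a0 b0 a1 b1 <= g0 d0 g1 d1 = P g1 d0]. *)
have h : (a0 * b1 + a1 * b0) * (g0 * d1) <=
    (g0 * d1) * (g0 * d1) + (a0 * b1) * (a1 * b0).
  have : 0 <= (g0 * d1 - a0 * b1) * (g0 * d1 - a1 * b0).
    by rewrite mulr_ge0 ?subr_ge0.
  by rewrite mulrBl !mulrBr; lra.
have k : (a0 * b1) * (a1 * b0) <= (g1 * d0) * (g0 * d1).
  have -> : (a0 * b1) * (a1 * b0) = (a0 * b0) * (a1 * b1) by lra.
  have -> : (g1 * d0) * (g0 * d1) = (g0 * d0) * (g1 * d1) by lra.
  by apply: ler_pM => //; exact: mulr_ge0.
have : a0 * b1 + a1 * b0 <= g0 * d1 + g1 * d0.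
  by rewrite -(ler_pM2r P0) [leRHS]mulrDl; lra.
by lra.
Qed.

(** Ratio inequalities compose: x2/x1 <= y2/y1 and x3/x2 <= y3/y2 multiply to x3/x1 <= y3/y1. This
    is how an increment is built up one coordinate or one edge at a time. *)
Lemma cancel_middle (R : realType) (x1 x2 x3 y1 y2 y3 : R) :
  0 < x2 -> 0 < y2 -> 0 < y1 -> 0 < x3 ->
  x2 * y1 <= x1 * y2 -> x3 * y2 <= x2 * y3 -> x3 * y1 <= x1 * y3.
Proof.
move=> x20 y20 y10 x30 h1 h2.
rewrite -(ler_pM2r (mulr_gt0 x20 y20)).
have -> : x3 * y1 * (x2 * y2) = (x2 * y1) * (x3 * y2) by lra.
have -> : x1 * y3 * (x2 * y2) = (x1 * y2) * (x2 * y3) by lra.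
by apply: ler_pM => //; rewrite mulr_ge0 // ltW.
Qed.

Section four_functions.
Context {R : realType} {K : eqType}.
Implicit Types (c : K -> bool) (s : seq K) (g f : (K -> bool) -> R).

Definition upd c (x : K) (b : bool) : K -> bool :=
  fun y => if y == x then b else c y.

(* The sum of [g] over the configurations that agree with [c] off [s]. *)
Fixpoint psum s g c : R :=
  if s is x :: s' then psum s' g (upd c x false) + psum s' g (upd c x true)
  else g c.

Definition agree s c c' := forall y, y \notin s -> c y = c' y.
Definition cmeet c c' : K -> bool := fun y => c y && c' y.
Definition cjoin c c' : K -> bool := fun y => c y || c' y.
Definition cle c c' := forall y, c y -> c' y.

Lemma upd_same c x : upd c x (c x) = c.
Proof. by apply/funext => y; rewrite /upd; case: eqP => // ->. Qed.

Lemma updE c x b : upd c x b x = b.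
Proof. by rewrite /upd eqxx. Qed.

Lemma upd_upd c x b b' : upd (upd c x b) x b' = upd c x b'.
Proof. by apply/funext => y; rewrite /upd; case: eqP. Qed.

Lemma updC c x y b b' : x != y -> upd (upd c x b) y b' = upd (upd c y b') x b.
Proof.
move=> xy; apply/funext => z; rewrite /upd.
by case: eqP => [->|//]; rewrite eq_sym (negbTE xy).
Qed.

Lemma agree_upd s c c' x : agree (x :: s) c c' ->
  agree s (upd c x (c' x)) c'.
Proof.
move=> cc' y ys; rewrite /upd; case: eqP => [->//|/eqP yx].
by apply: cc'; rewrite inE negb_or yx.
Qed.

Lemma agree_cons s c c' x b : agree s (upd c x b) c' -> agree (x :: s) c c'.
Proof.
move=> h y; rewrite inE negb_or => /andP[yx ys].
by rewrite -h // /upd (negbTE yx).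
Qed.

Lemma eq_psum s g g' c :
  (forall c', agree s c c' -> g c' = g' c') -> psum s g c = psum s g' c.
Proof.
elim: s c => [|x s IH] c h /=; first exact: h.
by congr (_ + _); apply: IH => c' /agree_cons; exact: h.
Qed.

Lemma le_psum s g g' c :
  (forall c', agree s c c' -> g c' <= g' c') -> psum s g c <= psum s g' c.
Proof.
elim: s c => [|x s IH] c h /=; first exact: h.
by apply: lerD; apply: IH => c' /agree_cons; exact: h.
Qed.

Lemma psumZ s (k : R) g c : psum s (fun c' => k * g c') c = k * psum s g c.
Proof. by elim: s c => [//|x s IH] c /=; rewrite !IH mulrDr. Qed.

Lemma psum_ge0 s g c : (forall c', agree s c c' -> 0 <= g c') ->
  0 <= psum s g c.
Proof.
elim: s c => [|x s IH] c h /=; first exact: h.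
by apply: addr_ge0; apply: IH => c' /agree_cons; exact: h.
Qed.

Lemma psum_gt0 s g c c1 : (forall c', agree s c c' -> 0 <= g c') ->
  agree s c c1 -> 0 < g c1 -> 0 < psum s g c.
Proof.
elim: s c => [|x s IH] c h cc1 g1 /=.
  by have -> : c = c1 by apply/funext => y; exact: cc1.
have [c1x|c1x] := boolP (c1 x).
- apply: ltr_wpDl; first by apply: psum_ge0 => c' /agree_cons; exact: h.
  apply: IH => // [c' /agree_cons|]; first exact: h.
  by rewrite -c1x; exact: agree_upd.
- apply: ltr_wpDr; first by apply: psum_ge0 => c' /agree_cons; exact: h.
  apply: IH => // [c' /agree_cons|]; first exact: h.
  by rewrite -(negbTE c1x); exact: agree_upd.
Qed.

(** Configurations are paired by their value at [x], the one vanishing at [x] representing the pair.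
    This isolates the effect of a single edge. *)
Lemma psum_split s x g c : uniq s -> x \in s ->
  psum s g c =
  psum s (fun c' => (~~ c' x)%:R * (g c' + g (upd c' x true))) c.
Proof.
elim: s c => [//|y s IH] c /= /andP[ys us].
rewrite inE => /orP[/eqP xy|xs]; last by rewrite -!IH.
subst y.
have upd_off b c' : agree s (upd c x b) c' -> c' x = b.
  by move=> h; rewrite -h // updE.
have push c0 : psum s g (upd c0 x true) =
    psum s (fun c' => g (upd c' x true)) (upd c0 x false).
  elim: s {IH us upd_off} ys c0 => [|y s IH] /=.
    by move=> _ c0; rewrite upd_upd.
  rewrite inE negb_or => /andP[xy /IH h] c0.
  by rewrite !(@updC _ x y) //; congr (_ + _); rewrite h.
rewrite [X in _ = _ + X](_ : _ = 0) ?addr0; last first.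
  rewrite (@eq_psum _ _ (fun _ => 0 * 0)) ?psumZ ?mul0r// => c' /upd_off ->.
  by rewrite /= !mul0r.
rewrite push.
transitivity (psum s (fun c' => g c' + g (upd c' x true)) (upd c x false)).
  elim: (s) (upd c x false) => [//|z s' IH'] c1 /=.
  by rewrite -!IH' addrACA.
by apply: eq_psum => c' /upd_off ->; rewrite mul1r.
Qed.

(** The four functions theorem of Ahlswede and Daykin, by induction on the coordinates;
    [four_points] is the case of one coordinate. *)
Lemma four_functions s (al be ga de : (K -> bool) -> R) c c' :
  (forall c1, 0 <= al c1) -> (forall c1, 0 <= be c1) ->
  (forall c1, 0 <= ga c1) -> (forall c1, 0 <= de c1) ->
  (forall c1 c2, agree s c c1 -> agree s c' c2 ->
    al c1 * be c2 <= ga (cmeet c1 c2) * de (cjoin c1 c2)) ->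
  psum s al c * psum s be c' <=
  psum s ga (cmeet c c') * psum s de (cjoin c c').
Proof.
move=> al0 be0 ga0 de0.
elim: s c c' => [|x s IH] c c' h /=; first exact: h.
have step b b' : psum s al (upd c x b) * psum s be (upd c' x b') <=
    psum s ga (upd (cmeet c c') x (b && b')) *
    psum s de (upd (cjoin c c') x (b || b')).
  have -> : upd (cmeet c c') x (b && b') = cmeet (upd c x b) (upd c' x b').
    by apply/funext => y; rewrite /cmeet /upd; case: eqP.
  have -> : upd (cjoin c c') x (b || b') = cjoin (upd c x b) (upd c' x b').
    by apply/funext => y; rewrite /cjoin /upd; case: eqP.
  by apply: IH => c1 c2 /agree_cons h1 /agree_cons h2; exact: h.
have nng g c0 : (forall c1, 0 <= g c1) -> 0 <= psum s g c0.
  by move=> g0; exact: psum_ge0.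
move: (step false false) (step false true) (step true false) (step true true).
move: (nng _ (upd c x false) al0) (nng _ (upd c x true) al0).
move: (nng _ (upd c' x false) be0) (nng _ (upd c' x true) be0).
move: (nng _ (upd (cmeet c c') x false) ga0) (nng _ (upd (cmeet c c') x true) ga0).
move: (nng _ (upd (cjoin c c') x false) de0) (nng _ (upd (cjoin c c') x true) de0).
rewrite /=.
move: (psum s al _) (psum s al _) (psum s be _) (psum s be _).
move: (psum s ga _) (psum s ga _) (psum s de _) (psum s de _).
move=> d1 d0 g1 g0 b1 b0 a1 a0 Hd0 Hd1 Hg0 Hg1 Hb0 Hb1 Ha0 Ha1.
exact: four_points.
Qed.

(** The four functions are mu1 f1, mu2, mu1 and mu2 f2, since f1 at [c1] is at most f2 at the join.
    Two functions are allowed because, at the level of vertices, the compared quantities are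
    conditional means taken under different parameters. *)
Lemma holley s (mu1 mu2 f1 f2 : (K -> bool) -> R) c c' :
  (forall c1, 0 <= mu1 c1) -> (forall c1, 0 <= mu2 c1) ->
  (forall c1, 0 <= f1 c1) -> (forall c1, 0 <= f2 c1) ->
  cle c c' ->
  (forall c1 c2, agree s c c1 -> agree s c' c2 ->
    mu1 c1 * mu2 c2 <= mu1 (cmeet c1 c2) * mu2 (cjoin c1 c2)) ->
  (forall c1 c2, agree s c c1 -> agree s c' c2 -> cle c1 c2 ->
    f1 c1 <= f2 c2) ->
  psum s (fun c1 => mu1 c1 * f1 c1) c * psum s mu2 c' <=
  psum s mu1 c * psum s (fun c1 => mu2 c1 * f2 c1) c'.
Proof.
move=> mu10 mu20 f10 f20 cc' lat f12.
have meetE : cmeet c c' = c.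
  by apply/funext => y; rewrite /cmeet; case E : (c y) => //=; exact: cc'.
have joinE : cjoin c c' = c'.
  by apply/funext => y; rewrite /cjoin; case E : (c y) => //=; rewrite cc'.
rewrite -[X in psum s mu1 X]meetE -[X in _ <= _ * psum _ _ X]joinE.
apply: four_functions => // [c1|c1|c1 c2 h1 h2]; [exact: mulr_ge0..|].
rewrite mulrAC [leRHS]mulrA; apply: ler_pM => //; first exact: mulr_ge0.
  exact: lat.
apply: f12 => // [y ys|y]; rewrite /cjoin; last by move=> ->.
rewrite -h1// -h2//; case E : (c y) => //=; exact: cc'.
Qed.

(** Reduces the lattice condition to one coordinate at a time: c1 is reached from the meet, and the
    join from c2, by switching on the same coordinates, and along the way the first configuration
    stays below the second. *)
Lemma increments_lattice s (g1 g2 : (K -> bool) -> R) c c' :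
  cle c c' ->
  (forall c1, agree s c c1 -> 0 < g1 c1) ->
  (forall c1, agree s c' c1 -> 0 < g2 c1) ->
  (forall c1 c2 x, agree s c c1 -> agree s c' c2 -> cle c1 c2 -> x \in s ->
    c2 x = false ->
    g1 (upd c1 x true) * g2 c2 <= g1 c1 * g2 (upd c2 x true)) ->
  forall c1 c2, agree s c c1 -> agree s c' c2 ->
  g1 c1 * g2 c2 <= g1 (cmeet c1 c2) * g2 (cjoin c1 c2).
Proof.
move=> cc' g10 g20 inc c1 c2 h1 h2.
(* [C u] and [T u] are the meet and [c2] after the coordinates of [c1] listed in [u] have been
   switched on. Off [s] nothing is missing, because there [c1] is below [c2]. *)
pose C (u : seq K) := fun y => c1 y && (c2 y || (y \in u)).
pose T (u : seq K) := fun y => c2 y || (c1 y && (y \in u)).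
suff H : forall u : seq K, {subset u <= s} -> g1 (C u) * g2 c2 <= g1 (C [::]) * g2 (T u).
  have := H s (fun _ => id).
  have -> : C s = c1.
    apply/funext => y; rewrite /C; case E : (c1 y) => //=.
    have [//|ys] := boolP (y \in s); first by rewrite orbT.
    by rewrite orbF -h2// cc'// h1.
  have -> : C [::] = cmeet c1 c2.
    by apply/funext => y; rewrite /C /cmeet in_nil orbF.
  suff -> : T s = cjoin c1 c2 by [].
  apply/funext => y; rewrite /T /cjoin orbC.
  have [ys|ys] := boolP (y \in s); first by rewrite andbT.
  rewrite andbF /=; case E : (c1 y) => //=.
  by rewrite -h2// cc'// h1.
have aC u : {subset u <= s} -> agree s c (C u).
  move=> us y ys; rewrite h1// /C; case E : (c1 y) => //=.
  by rewrite -h2// cc'// h1.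
have aT u : {subset u <= s} -> agree s c' (T u).
  move=> us y ys; rewrite /T (contraNF (us y) ys) andbF orbF.
  by rewrite h2.
elim=> [|x u IH] us.
  suff -> : T [::] = c2 by [].
  by apply/funext => y; rewrite /T in_nil andbF orbF.
have xs : x \in s by apply: us; rewrite mem_head.
have us' : {subset u <= s} by move=> y yu; apply: us; rewrite inE yu orbT.
have {}IH := IH us'.
have [triv|] := boolP (c1 x && ~~ c2 x && (x \notin u)); last first.
  move=> ntriv.
  have -> : C (x :: u) = C u.
    apply/funext => y; rewrite /C inE; case: eqP => // ->.
    by move: ntriv; case: (c1 x); case: (c2 x); case: (x \in u).
  suff -> : T (x :: u) = T u by [].
  apply/funext => y; rewrite /T inE; case: eqP => // ->.
  by move: ntriv; case: (c1 x); case: (c2 x); case: (x \in u).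
move/andP : triv => [/andP[c1x /negbTE c2x] /negbTE xu].
have Cx : C (x :: u) = upd (C u) x true.
  apply/funext => y; rewrite /C /upd inE; case: eqP => // ->.
  by rewrite c1x orbT.
have Tx : T (x :: u) = upd (T u) x true.
  apply/funext => y; rewrite /T /upd inE; case: eqP => // ->.
  by rewrite c1x orbT.
have CT : cle (C u) (T u).
  by move=> y; rewrite /C /T; case: (c1 y); case: (c2 y).
have Tux : T u x = false by rewrite /T c2x xu andbF.
have := inc _ _ x (aC _ us') (aT _ us') CT xs Tux.
rewrite -Cx -Tx.
move: (g10 _ (aC _ us')) (g20 _ (aT _ us')) (g20 _ h2) (g10 _ (aC _ us)) IH.
exact: cancel_middle.
Qed.

End four_functions.

(** * Connected components *)

Lemma card_fset_setD1 (T : choiceType) (A : set T) (x : T) :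
  finite_set A -> A x ->
  #|` fset_set A| = (#|` fset_set (A `\ x)|).+1.
Proof.
move=> fA Ax; rewrite fset_setD1 // (cardfsD1 x) in_fset_set // mem_set //.
Qed.

Section connectivity.
Context {d : nat}.
Implicit Types (t : config d) (x y z : zd d) (e : edge d) (L : box d).

Lemma open_step_sym t x y : open_step t x y = open_step t y x.
Proof.
by apply/asboolP/asboolP => -[e te ve]; exists e => //; rewrite ve fsetUC.
Qed.

Lemma component_refl t x : component t x x.
Proof. by exists [::]. Qed.

Lemma component_trans t x y z :
  component t x y -> component t y z -> component t x z.
Proof.
move=> [s1 p1 <-] [s2 p2 <-]; exists (s1 ++ s2); last by rewrite last_cat.
by rewrite cat_path p1.
Qed.

Lemma component_step t x y : open_step t x y -> component t x y.
Proof. by move=> h; exists [:: y] => //=; rewrite h. Qed.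

Lemma component_sym t x y : component t x y -> component t y x.
Proof.
move=> [s p <-] {y}; elim: s x p => [|z s IH] x /=.
  by move=> _; exact: component_refl.
move=> /andP[xz /IH h]; apply: component_trans h _.
by apply: component_step; rewrite open_step_sym.
Qed.

Lemma component_eq t x y : component t x y -> component t x = component t y.
Proof.
move=> xy; apply/seteqP; split => z.
- exact/component_trans/component_sym.
- exact: component_trans.
Qed.

Lemma component_mono t t' x y : (forall e, t.2 e -> t'.2 e) ->
  component t x y -> component t' x y.
Proof.
move=> tt' [s p <-]; exists s => //; apply: sub_path p => u v /asboolP[e te ve].
by apply/asboolP; exists e => //; exact: tt'.
Qed.

Lemma component_edges t t' : t.2 = t'.2 -> component t = component t'.
Proof.
move=> tt'; apply/funext => x; apply/seteqP; split => y;
  by apply: component_mono => e; rewrite tt'.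
Qed.

Lemma component_on t x y : compatible t -> component t x y -> t.1 x -> t.1 y.
Proof.
move=> ct [s p <-]; elim: s x p => [//|z s IH] x /= /andP[/asboolP[e te ve]].
move=> /IH h _; apply: h; apply: (ct e) => //.
by rewrite ve !inE eqxx orbT.
Qed.

Lemma finite_box_closure L : finite_set (box_closure L).
Proof.
have -> : box_closure L = \bigcup_(e in box_edges L) [set` val e].
  by apply/seteqP; split => x [e Le xe]; exists e.
apply: bigcup_finite; first exact: finite_box_edges.
by move=> e _; exact: finite_fset.
Qed.

Definition on_closure L t : set (zd d) := [set x | box_closure L x /\ t.1 x].

Lemma finite_on_closure L t : finite_set (on_closure L t).
Proof. by apply: sub_finite_set (finite_box_closure L) => x []. Qed.

(** In a compatible configuration an open path never leaves the occupied vertices, so the counted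
    components are the images of a finite set of vertices of the box closure. *)
Lemma num_componentsE L t : compatible t ->
  num_components L t = #|` fset_set (component t @` on_closure L t)|.
Proof.
move=> ct; rewrite /num_components; congr (#|` fset_set _|).
apply/seteqP; split => [C [[x xt <-] [y [xy Ly]]]|C [x [Lx xt] <-]].
  exists y; first by split => //; exact: component_on xy xt.
  exact/esym/component_eq.
by split; [exists x|exists x; split => //; exact: component_refl].
Qed.

Definition add_edge t e : config d := (t.1, upd t.2 e true).
Definition add_vertex t x : config d := (upd t.1 x true, t.2).

Definition joined t e : bool :=
  `[< forall x y, x \in val e -> y \in val e -> component t x y >].

Definition edge_on t e := forall x, x \in val e -> t.1 x.

Lemma joined_mono t t' e : (forall e, t.2 e -> t'.2 e) ->
  joined t e -> joined t' e.
Proof.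
move=> tt' /asboolP h; apply/asboolP => x y xe ye.
by apply: component_mono tt' _; exact: h.
Qed.

Lemma add_edge_compatible t e : compatible t -> edge_on t e ->
  compatible (add_edge t e).
Proof.
by move=> ct te e' x; rewrite /add_edge /upd /=; case: eqP => [->|_];
  [move=> _; exact: te|exact: ct].
Qed.

Lemma component_add_edge t e x y u v : val e = [fset x; y]%fset ->
  component (add_edge t e) u v -> [\/ component t u v,
    component t u x /\ component t y v | component t u y /\ component t x v].
Proof.
move=> ve [s p <-] {v}; elim: s u p => [|z s IH] u /=.
  by move=> _; constructor 1; exact: component_refl.
move=> /andP[/asboolP[e' te' ve'] /IH h].
have [uz|[[-> zy]|[-> zx]]] :
    component t u z \/ (u = x /\ z = y) \/ (u = y /\ z = x).
  move: te'; rewrite /add_edge /upd /=; case: eqP => [ee'|_] te'; last first.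
    by left; apply: component_step; apply/asboolP; exists e'.
  move: ve'; rewrite ee' ve => xyuz.
  have : u \in [fset x; y]%fset by rewrite xyuz !inE eqxx.
  have : z \in [fset x; y]%fset by rewrite xyuz !inE eqxx orbT.
  have : x \in [fset u; z]%fset by rewrite -xyuz !inE eqxx.
  have : y \in [fset u; z]%fset by rewrite -xyuz !inE eqxx orbT.
  rewrite !inE => /orP[]/eqP-> /orP[]/eqP-> /orP[]/eqP? /orP[]/eqP?; subst;
    by [left; exact: component_refl|right; left|right; right].
- case: h => [h|[h1 h2]|[h1 h2]].
  + by constructor 1; exact: component_trans uz h.
  + by constructor 2; split => //; exact: component_trans uz h1.
  + by constructor 3; split => //; exact: component_trans uz h1.
- subst z; case: h => [h|[h1 h2]|[h1 h2]].
  + by constructor 2; split => //; exact: component_refl.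
  + by constructor 2; split => //; exact: component_refl.
  + by constructor 1.
- subst z; case: h => [h|[h1 h2]|[h1 h2]].
  + by constructor 3; split => //; exact: component_refl.
  + by constructor 1.
  + by constructor 3; split => //; exact: component_refl.
Qed.

(** If the ends of [e] are not joined, removing their two components before, and the merged one
    after, leaves the same family of sets. *)
Lemma num_components_add_edge L t e : compatible t -> box_edges L e ->
  edge_on t e ->
  num_components L t = (num_components L (add_edge t e) + ~~ joined t e)%N.
Proof.
move=> ct Le te; rewrite !num_componentsE //; last exact: add_edge_compatible.
have [x [y [_ ve]]] := asboolP _ (valP e).
have xe : x \in val e by rewrite ve !inE eqxx.
have ye : y \in val e by rewrite ve !inE eqxx orbT.
set t' := add_edge t e; rewrite [on_closure L t'](_ : _ = on_closure L t) //.
have t't u v : component t u v -> component t' u v.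
  by apply: component_mono => e' te'; rewrite /t' /add_edge /upd /=; case: eqP.
have xy' : component t' x y.
  apply: component_step; apply/asboolP; exists e => //.
  by rewrite /t' /add_edge /= updE.
have [/asboolP j|/asboolP nj] := boolP (joined t e).
  rewrite addn0; congr (#|` fset_set _|).
  suff -> : component t' = component t by [].
  apply/funext => u; apply/seteqP; split => [v|v]; last exact: t't.
  move=> /(component_add_edge ve)[//|[h1 h2]|[h1 h2]].
    exact: component_trans h1 (component_trans (j _ _ xe ye) h2).
  exact: component_trans h1 (component_trans (j _ _ ye xe) h2).
have nxy : ~ component t x y.
  move=> xy; apply: nj => u v; rewrite ve !inE.
  by move=> /orP[]/eqP-> /orP[]/eqP->//;
    [exact: component_refl|exact: component_sym|exact: component_refl].
set U := on_closure L t.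
have fU : finite_set U by exact: finite_on_closure.
have Ux : U x by split; [exists e|exact: te].
have Uy : U y by split; [exists e|exact: te].
have fA t1 : finite_set (component t1 @` U) by exact: finite_image.
rewrite (@card_fset_setD1 _ _ (component t x)) //.
rewrite (@card_fset_setD1 _ _ (component t y)); last 2 first.
- by apply: finite_setD.
- split; first by exists y.
  by move=> /= yx; apply: nxy; rewrite -yx; exact: component_refl.
rewrite (@card_fset_setD1 _ (component t' @` U) (component t' x)) //.
rewrite addn1; do 2 congr _.+1; congr (#|` fset_set _|).
have same u : ~ component t u x -> ~ component t u y ->
    component t' u = component t u.
  move=> ux uy; apply/seteqP; split => [v|v]; last exact: t't.
  by move=> /(component_add_edge ve)[//|[h1 h2]|[h1 h2]].
apply/seteqP; split => C.
- move=> [[[u Uu <-] ux] uy].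
  have ux' : ~ component t u x by move=> /component_eq.
  have uy' : ~ component t u y by move=> /component_eq.
  split; first by exists u => //; exact: same.
  move=> /= E; have : component t' x u by rewrite -E; exact: component_refl.
  move=> /(component_add_edge ve)[/component_sym//|[_ /component_sym//]|].
  by move=> [_ /component_sym].
- move=> [[u Uu <-] /= ux].
  have ux' : ~ component t u x by move=> /t't /component_eq.
  have uy' : ~ component t u y.
    move=> /t't h; apply: ux; apply: component_eq.
    exact: component_trans h (component_sym xy').
  rewrite same //; split; [split|]; first by exists u.
  + by move=> /= E; apply: ux'; rewrite E; exact: component_refl.
  + by move=> /= E; apply: uy'; rewrite E; exact: component_refl.
Qed.

(** Supermodularity of the number of components: ends already joined in [t1] are joined in [t2], so
    opening [e] merges components in [t2] only if it does in [t1]. *)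
Lemma num_components_le L t1 t2 e : compatible t1 -> compatible t2 ->
  (forall e, t1.2 e -> t2.2 e) -> edge_on t1 e -> edge_on t2 e ->
  box_edges L e ->
  (num_components L (add_edge t1 e) + num_components L t2 <=
   num_components L t1 + num_components L (add_edge t2 e))%N.
Proof.
move=> c1 c2 t12 e1 e2 Le.
rewrite (num_components_add_edge c1 Le e1) (num_components_add_edge c2 Le e2).
have := @joined_mono t1 t2 e t12.
by case: (joined t1 e) => [->//|_]; case: (joined t2 e); lia.
Qed.

End connectivity.

(** * Adding an isolated vertex *)

Section add_isolated_vertex.
Context {d : nat} (hd : (0 < d)%N).

Definition unit_vec (i : 'I_d) : zd d := [ffun j => (i == j)%:Z].

Lemma l1_dist_unit (x : zd d) (i : 'I_d) : l1_dist x (x + unit_vec i) = 1.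
Proof.
rewrite /l1_dist (bigD1 i) //= big1 ?addr0 => [|j ji].
  by rewrite !ffunE eqxx /= opprD addrA subrr sub0r normrN.
by rewrite !ffunE eq_sym (negbTE ji) addr0 subrr.
Qed.

Lemma is_edge_unit (x : zd d) (i : 'I_d) :
  is_edge [fset x; (x + unit_vec i)%R]%fset.
Proof.
by apply/asboolP; exists x, (x + unit_vec i); split => //; exact: l1_dist_unit.
Qed.

Definition edge_at (x : zd d) (i : 'I_d) : edge d :=
  exist _ [fset x; (x + unit_vec i)%R]%fset (is_edge_unit x i).

Lemma box_vertices_closure (L : box d) : box_vertices L `<=` box_closure L.
Proof.
move=> x Lx; exists (edge_at x (Ordinal hd)); last by rewrite /= !inE eqxx.
by exists x => //; rewrite /= !inE eqxx.
Qed.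

(** Compatibility closes every edge at a vacant vertex, so the new vertex is a component of its own
    and the others are untouched. *)
Lemma num_components_add_vertex (L : box d) (t : config d) (x : zd d) :
  compatible t -> box_vertices L x -> t.1 x = false ->
  num_components L (add_vertex t x) = (num_components L t).+1.
Proof.
move=> ct Lx tx; have ct' : compatible (add_vertex t x).
  move=> e y te ye; rewrite /add_vertex /upd /=; case: eqP => // _.
  exact: ct te ye.
rewrite !num_componentsE // (@component_edges _ (add_vertex t x) t) //.
rewrite (@card_fset_setD1 _ _ (component t x)); last 2 first.
- exact/finite_image/finite_on_closure.
- exists x => //; split; first exact: box_vertices_closure.
  by rewrite /add_vertex /= updE.
congr (#|` fset_set _|.+1); apply/seteqP; split => C.
- move=> [[u [Lu]]]; rewrite /add_vertex /upd /=; case: eqP => [->|_] tu <-//.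
  by move=> _; exists u.
- move=> [u [Lu tu] <-]; split.
    by exists u => //; split => //; rewrite /add_vertex /upd /=; case: eqP.
  move=> /= E; have := component_refl t x; rewrite -E => ux.
  by move: (component_on ct ux tu); rewrite tx.
Qed.

End add_isolated_vertex.

(** * Random-cluster weights on the occupied vertices *)

(** The function r (1 - c) + c / r increases in c because 1/r >= r, and decreases in r because its
    derivative 1 - c - c / r^2 is at most 0 for c >= 1/2 and r <= 1. In the application c is 1 or
    1/q. *)
Lemma edge_factor_mono (R : realType) (r1 r2 c1 c2 : R) :
  0 < r2 -> r2 <= r1 -> r1 <= 1 -> 1 / 2 <= c1 -> c1 <= c2 -> c2 <= 1 ->
  r1 * (1 - c1) + c1 / r1 <= r2 * (1 - c2) + c2 / r2.
Proof.
move=> r20 r21 r11 c1h c12 c21.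
have r10 : 0 < r1 by exact: lt_le_trans r21.
have i1 : 1 <= r1^-1 by rewrite invf_ge1.
have i12 : r1^-1 <= r2^-1 by rewrite lef_pV2 ?posrE.
have s2 : r2 * r2^-1 = 1 by rewrite divff // gt_eqF.
have s1 : r1 * r1^-1 = 1 by rewrite divff // gt_eqF.
have gap : r1 - r2 <= r2^-1 - r1^-1.
  have -> : r2^-1 - r1^-1 = (r1 - r2) * (r1^-1 * r2^-1).
    by rewrite mulrBl mulrA s1 mul1r [r1^-1 * _]mulrC mulrA s2 mul1r.
  by rewrite ler_peMr ?subr_ge0 // mulr_ege1 // (le_trans i1).
(* The right-hand side minus the left-hand side is exactly the sum of the three nonnegative terms
   [A], [B] and [C]: the first changes c, the other two change r at c = c1. *)
have A : 0 <= (c2 - c1) * (r2^-1 - r2) by rewrite mulr_ge0 ?subr_ge0 //; lra.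
have B : 0 <= c1 * ((r2^-1 - r1^-1) - (r1 - r2)) by rewrite mulr_ge0 //; lra.
have C : 0 <= (c1 - (1 - c1)) * (r1 - r2) by rewrite mulr_ge0 //; lra.
by lra.
Qed.

Lemma count_upd (K : eqType) (s : seq K) (c : K -> bool) (x : K) :
  uniq s -> x \in s -> c x = false ->
  count (upd c x true) s = (count c s).+1.
Proof.
move=> us xs cx.
have E b : count (upd c x b) s = (b + count (upd c x false) (rem x s))%N.
  rewrite (permP (perm_to_rem xs)) /= updE; congr addn.
  apply: eq_in_count => y ys; rewrite /upd; case: eqP => // yx.
  by move: ys; rewrite yx (rem_filter _ us) mem_filter /= eqxx.
by rewrite -{2}[c](upd_same c x) cx !E.
Qed.

Section box_sequences.
Context {d : nat}.
Implicit Types (L : box d).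

Definition evec L : seq (edge d) := enum_fset (fset_set (box_edges L)).
Definition vvec L : seq (zd d) := enum_fset (fset_set (box_vertices L)).

Lemma mem_evec L e : (e \in evec L) = `[< box_edges L e >].
Proof.
rewrite /evec in_fset_set; last exact: finite_box_edges.
by apply/idP/asboolP => [/set_mem//|/mem_set].
Qed.

Lemma mem_vvec L x : (x \in vvec L) = `[< box_vertices L x >].
Proof.
rewrite /vvec in_fset_set; last exact: finite_box_vertices.
by apply/idP/asboolP => [/set_mem//|/mem_set].
Qed.

Lemma uniq_evec L : uniq (evec L). Proof. exact: fset_uniq. Qed.
Lemma uniq_vvec L : uniq (vvec L). Proof. exact: fset_uniq. Qed.

Definition available (psi : zd d -> bool) (e : edge d) : bool :=
  `[< forall x, x \in val e -> psi x >].

Lemma available_mono psi1 psi2 : cle psi1 psi2 ->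
  cle (available psi1) (available psi2).
Proof. by move=> h e /asboolP he; apply/asboolP => x /he; exact: h. Qed.

Lemma compatibleP (psi : zd d -> bool) (om : edge d -> bool) :
  compatible ((psi, om) : config d) <-> cle om (available psi).
Proof.
split=> [h e oe|h e x oe xe]; first by apply/asboolP => x; exact: h.
by have /asboolP := h e oe; exact.
Qed.

End box_sequences.

Section random_cluster.
Context {R : realType} {d : nat} (L : box d) (q : R) (hq : 1 <= q <= 2).
Implicit Types (p : R) (psi : zd d -> bool) (A om rho : edge d -> bool).

Let q0 : 0 < q. Proof. by move: hq => /andP[h _]; exact: lt_le_trans h. Qed.

Definition odds (p : R) : R := p / (1 - p).
Definition root1 (p : R) : R := Num.sqrt (1 - p).

Lemma odds_gt0 p : 0 < p < 1 -> 0 < odds p.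
Proof. by move=> /andP[p0 p1]; rewrite divr_gt0 // subr_gt0. Qed.

Lemma root1_gt0 p : 0 < p < 1 -> 0 < root1 p.
Proof. by move=> /andP[p0 p1]; rewrite sqrtr_gt0 subr_gt0. Qed.

Lemma le_odds p1 p2 : 0 < p1 < 1 -> 0 < p2 < 1 -> p1 <= p2 ->
  odds p1 <= odds p2.
Proof.
move=> /andP[p10 p11] /andP[p20 p21] p12.
rewrite /odds ler_pdivrMr ?subr_gt0 // mulrAC ler_pdivlMr ?subr_gt0 //.
by rewrite !mulrBr; lra.
Qed.

Lemma lt_odds p1 p2 : 0 < p1 < 1 -> 0 < p2 < 1 -> p1 < p2 ->
  odds p1 < odds p2.
Proof.
move=> /andP[p10 p11] /andP[p20 p21] p12.
rewrite /odds ltr_pdivrMr ?subr_gt0 // mulrAC ltr_pdivlMr ?subr_gt0 //.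
by rewrite !mulrBr; lra.
Qed.

Lemma root1_odds p : 0 < p < 1 -> root1 p * odds p = (root1 p)^-1 - root1 p.
Proof.
move=> hp; have r0 := root1_gt0 hp.
have rr : root1 p * root1 p = 1 - p.
  by rewrite -expr2 sqr_sqrtr // subr_ge0; move: hp; lra.
have -> : odds p = (1 - root1 p * root1 p) / (root1 p * root1 p).
  by rewrite rr opprB addrC subrK.
rewrite mulrA mulrBr mulr1 invfM mulrA mulrBl divff ?gt_eqF //.
by rewrite mulrBl mul1r !mulrA mulfK ?gt_eqF // mulfK ?gt_eqF.
Qed.

(** The set [A] of usable edges is kept apart from [available psi], so that edges can be released
    one by one while the occupied vertices stay fixed. *)
Definition rcw p psi A om : R :=
  (`[< cle om A >])%:R * q ^+ num_components L ((psi, om) : config d) *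
  odds p ^+ count om (evec L).

Lemma rcw_ge0 p psi A om : 0 < p < 1 -> 0 <= rcw p psi A om.
Proof.
move=> hp; rewrite /rcw mulr_ge0 ?exprn_ge0 ?(ltW (odds_gt0 _)) //.
by rewrite mulr_ge0 ?exprn_ge0 // ltW.
Qed.

(** Opening an edge multiplies the weight by the odds, which grow with p, and by q to minus the
    number of merged components, which grows with the configuration by supermodularity and q >=
    1. *)
Lemma rc_holley p1 p2 psi1 psi2 A1 A2 rho1 rho2
    (f1 f2 : (edge d -> bool) -> R) :
  0 < p1 < 1 -> 0 < p2 < 1 -> p1 <= p2 ->
  cle psi1 psi2 -> cle A1 A2 -> cle A1 (available psi1) ->
  cle A2 (available psi2) -> cle rho1 rho2 ->
  (forall om, 0 <= f1 om) -> (forall om, 0 <= f2 om) ->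
  (forall o1 o2, agree (evec L) rho1 o1 -> agree (evec L) rho2 o2 ->
    cle o1 o2 -> f1 o1 <= f2 o2) ->
  psum (evec L) (fun om => rcw p1 psi1 A1 om * f1 om) rho1 *
  psum (evec L) (rcw p2 psi2 A2) rho2 <=
  psum (evec L) (rcw p1 psi1 A1) rho1 *
  psum (evec L) (fun om => rcw p2 psi2 A2 om * f2 om) rho2.
Proof.
move=> hp1 hp2 p12 psi12 A12 A1psi A2psi rho12 f10 f20 f12.
apply: holley => // [om|om|o1 o2 h1 h2]; [exact: rcw_ge0..|].
pose g p psi (om : edge d -> bool) : R :=
  q ^+ num_components L ((psi, om) : config d) * odds p ^+ count om (evec L).
have rcwE p psi A om : rcw p psi A om = (`[< cle om A >])%:R * g p psi om.
  by rewrite /rcw /g mulrA.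
have g0 p psi om : 0 < p < 1 -> 0 < g p psi om.
  by move=> hp; rewrite mulr_gt0 ?exprn_gt0 ?odds_gt0.
rewrite !rcwE.
have rhs0 (b1 b2 : bool) o o' :
    0 <= b1%:R * g p1 psi1 o * (b2%:R * g p2 psi2 o').
  by apply: mulr_ge0; apply: mulr_ge0; rewrite ?ler0n //; apply/ltW/g0.
have [/asboolP o1A|_] := boolP `[< cle o1 A1 >]; last first.
  by rewrite [leLHS](_ : _ = 0) // !mul0r.
have [/asboolP o2A|_] := boolP `[< cle o2 A2 >]; last first.
  by rewrite [leLHS](_ : _ = 0) // mul0r mulr0.
rewrite !asboolT; first last.
- by move=> e /andP[/o1A].
- by move=> e /orP[/o1A/A12|/o2A].
rewrite !mulr1n !mul1r.
(* Once [o1] lies in [A1] and [o2] in [A2], the indicators are 1 and the remaining weights are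
   positive. The meet and [o1] differ only on [A1], where edges have occupied ends in both
   configurations, so only these edges are switched. *)
pose s := [seq e <- evec L | A1 e].
have base : agree s (cmeet o1 o2) o1.
  move=> e; rewrite mem_filter negb_and /cmeet => /orP[|es].
    by case E : (o1 e) => //=; rewrite o1A.
  by case E : (o1 e) => //=; rewrite -h2// rho12// h1.
apply: (@increments_lattice _ _ s (g p1 psi1) (g p2 psi2) (cmeet o1 o2) o2) =>
  //.
- by move=> e /andP[].
- by move=> *; exact: g0.
- by move=> *; exact: g0.
move=> c1 c2 e k1 k2 c12; rewrite mem_filter => /andP[A1e es] c2e.
have c1A : cle c1 A1.
  move=> e'; have [|es'] := boolP (e' \in s).
    by rewrite mem_filter => /andP[].
  by rewrite -k1 // => /andP[/o1A].
have c2A : cle c2 A2.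
  move=> e'; have [|es'] := boolP (e' \in s).
    by rewrite mem_filter => /andP[/A12].
  by rewrite -k2 // => /o2A.
have c1e : c1 e = false by apply: contraFF c2e; exact: c12.
have Le : box_edges L e by move: es; rewrite mem_evec => /asboolP.
have := @num_components_le _ L (psi1, c1) (psi2, c2) e.
rewrite /add_edge /= => /(_ _ _ c12 _ _ Le) kk.
rewrite /g !(count_upd (uniq_evec L) es) //.
have o1_ge0 := ltW (odds_gt0 hp1); have o2_ge0 := ltW (odds_gt0 hp2).
have q_ge0 := ltW q0.
rewrite !exprS mulrACA [leRHS]mulrACA; apply: ler_pM.
- exact: mulr_ge0 (exprn_ge0 _ q_ge0) (exprn_ge0 _ q_ge0).
- exact: mulr_ge0 (mulr_ge0 o1_ge0 (exprn_ge0 _ o1_ge0)) (exprn_ge0 _ o2_ge0).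
- rewrite -!exprD; apply: ler_weXn2l; first by case/andP: hq.
  apply: kk.
  + by apply/compatibleP => e' /c1A /A1psi.
  + by apply/compatibleP => e' /c2A /A2psi.
  + by have /asboolP := A1psi _ A1e.
  + by have /asboolP := A2psi _ (A12 _ A1e).
- rewrite [leRHS]mulrCA -mulrA ler_wpM2r ?le_odds //.
  exact: mulr_ge0 (exprn_ge0 _ o1_ge0) (exprn_ge0 _ o2_ge0).
Qed.

Definition rcZ p psi A rho : R :=
  root1 p ^+ count A (evec L) * psum (evec L) (rcw p psi A) rho.

Lemma psum_rcw_gt0 p psi A rho : 0 < p < 1 ->
  (forall e, e \notin evec L -> rho e -> A e) ->
  0 < psum (evec L) (rcw p psi A) rho.
Proof.
move=> hp rA.
apply: (@psum_gt0 _ _ _ _ _ (fun e => (e \notin evec L) && rho e)).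
- by move=> *; exact: rcw_ge0.
- by move=> e es; rewrite es.
- rewrite /rcw asboolT ?mulr1n ?mul1r; last by move=> e /andP[]; exact: rA.
  by rewrite mulr_gt0 ?exprn_gt0 ?odds_gt0.
Qed.

Lemma rcZ_gt0 p psi A rho : 0 < p < 1 ->
  (forall e, e \notin evec L -> rho e -> A e) -> 0 < rcZ p psi A rho.
Proof.
by move=> hp rA; rewrite mulr_gt0 ?exprn_gt0 ?root1_gt0 ?psum_rcw_gt0.
Qed.

(* [q] to the change in the number of components when [e] is opened. *)
Definition merge_factor psi om e : R :=
  if joined ((psi, om) : config d) e then 1 else q^-1.

Definition open_factor p psi om e : R :=
  root1 p * (1 + odds p * merge_factor psi om e).

Lemma merge_factor_bounds psi om e : 1 / 2 <= merge_factor psi om e <= 1.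
Proof.
case/andP: hq => q1 q2; rewrite /merge_factor; case: ifP => _; first by lra.
by rewrite div1r lef_pV2 ?posrE // q2 invf_le1.
Qed.

Lemma open_factorE p psi om e : 0 < p < 1 ->
  open_factor p psi om e =
  root1 p * (1 - merge_factor psi om e) + merge_factor psi om e / root1 p.
Proof.
by move=> hp; rewrite /open_factor mulrDr mulrA root1_odds //; lra.
Qed.

Lemma root1_le1 p : 0 < p < 1 -> root1 p <= 1.
Proof.
by move=> hp; rewrite -[leRHS]sqrtr1 ler_wsqrtr //; move: hp; lra.
Qed.

Lemma open_factor_ge1 p psi om e : 0 < p < 1 -> 1 <= open_factor p psi om e.
Proof.
move=> hp; rewrite open_factorE //.
have /andP[m1 m2] := merge_factor_bounds psi om e.
have := @edge_factor_mono R 1 (root1 p) (merge_factor psi om e)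
  (merge_factor psi om e) (root1_gt0 hp) (root1_le1 hp) (lexx _) m1 (lexx _) m2.
by rewrite invr1; lra.
Qed.

Lemma open_factor_mono p1 p2 psi1 psi2 o1 o2 e : 0 < p1 < 1 -> 0 < p2 < 1 ->
  p1 <= p2 -> cle o1 o2 -> open_factor p1 psi1 o1 e <= open_factor p2 psi2 o2 e.
Proof.
move=> hp1 hp2 p12 o12; rewrite !open_factorE //.
have /andP[m1 _] := merge_factor_bounds psi1 o1 e.
have /andP[_ m2] := merge_factor_bounds psi2 o2 e.
apply: edge_factor_mono; rewrite ?root1_gt0 ?root1_le1 //.
  by rewrite ler_wsqrtr // lerD2l lerN2.
rewrite /merge_factor.
have := @joined_mono _ (psi1, o1) (psi2, o2) e o12.
case/andP: hq => q1 q2.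
case: (joined _ _) => [->//|_]; case: (joined _ _) => //.
by rewrite invf_le1.
Qed.

(** Configurations are paired by the state of [e]. With [e] closed the old weight is kept, with [e]
    open it gains the odds and, if two components merge, a factor 1/q. *)
Lemma rcZ_add_edge p psi A rho e : 0 < p < 1 -> e \in evec L -> A e = false ->
  cle (upd A e true) (available psi) ->
  rcZ p psi (upd A e true) rho = root1 p ^+ count A (evec L) *
    psum (evec L) (fun om => rcw p psi A om * open_factor p psi om e) rho.
Proof.
move=> hp es Ae Apsi; rewrite /rcZ (count_upd (uniq_evec L) es Ae) exprSr -mulrA.
congr (_ * _); rewrite -psumZ (psum_split _ _ (uniq_evec L) es).
apply: eq_psum => om _.
have [oe|/negbTE oe] := boolP (om e).
  rewrite !mulr0n mul0r {1}/rcw asboolF ?mulr0n ?mul0r// => /(_ _ oe).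
  by rewrite Ae.
rewrite mulr1n mul1r.
have [oA|noA] := pselect (cle om A); last first.
  have n1 : ~ cle om (upd A e true).
    move=> h; apply: noA => e' oe'; move: (h e' oe'); rewrite /upd.
    by have [ee'|//] := eqVneq e' e; move: oe'; rewrite ee' oe.
  have n2 : ~ cle (upd om e true) (upd A e true).
    move=> h; apply: noA => e' oe'; move: (h e'); rewrite /upd.
    have [ee'|_ /(_ oe')//] := eqVneq e' e.
    by move: oe'; rewrite ee' oe.
  rewrite /rcw !asboolF // !mulr0n. by rewrite !(mul0r, mulr0) addr0.
have oA1 : cle om (upd A e true).
  by move=> e' /oA; rewrite /upd; case: eqP.
have oA2 : cle (upd om e true) (upd A e true).
  by move=> e'; rewrite /upd; case: eqP => // _; exact: oA.
rewrite /rcw !asboolT // (count_upd (uniq_evec L) es oe) !mulr1n !mul1r exprS.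
have Le : box_edges L e by move: es; rewrite mem_evec => /asboolP.
have c : compatible ((psi, om) : config d).
  by apply/compatibleP => e' /oA1 /Apsi.
have on : edge_on ((psi, om) : config d) e.
  by have /asboolP := Apsi e (updE A e true).
rewrite (num_components_add_edge c Le on) /open_factor /merge_factor /add_edge /=.
rewrite exprD.
have : q * q^-1 = 1 by rewrite divff // gt_eqF.
move: (_ ^+ num_components _ _) (_ ^+ count _ _) => u v.
move: (root1 p) (odds p) (q^-1) (joined _ _) => r o i j qi.
case: j => /=; first by rewrite expr0; lra.
rewrite expr1.
transitivity (r * (u * q * v + (q * i) * (o * u * v))); last by lra.
by rewrite qi; lra.
Qed.

(** After division both increments are means of [open_factor], which increases with the
    configuration and with p, so the comparison is an instance of [rc_holley]. *)
Lemma rcZ_step p1 p2 psi1 psi2 A1 A2 rho1 rho2 e :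
  0 < p1 < 1 -> 0 < p2 < 1 -> p1 <= p2 -> cle psi1 psi2 -> cle A1 A2 ->
  cle rho1 rho2 -> e \in evec L -> A1 e = false -> A2 e = false ->
  cle (upd A1 e true) (available psi1) -> cle (upd A2 e true) (available psi2) ->
  rcZ p1 psi1 (upd A1 e true) rho1 * rcZ p2 psi2 A2 rho2 <=
  rcZ p1 psi1 A1 rho1 * rcZ p2 psi2 (upd A2 e true) rho2.
Proof.
move=> hp1 hp2 p12 psi12 A12 rho12 es A1e A2e A1psi A2psi.
rewrite !rcZ_add_edge // /rcZ mulrACA [leRHS]mulrACA ler_wpM2l //.
  by rewrite mulr_ge0 ?exprn_ge0 // ltW ?root1_gt0.
have sub A psi : cle (upd A e true) (available psi) -> cle A (available psi).
  by move=> h e' Ae'; apply: h; rewrite /upd; case: eqP.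
apply: rc_holley => //; [exact: sub|exact: sub|move=> om|move=> om|].
- by apply: le_trans (open_factor_ge1 _ _ _ hp1).
- by apply: le_trans (open_factor_ge1 _ _ _ hp2).
- by move=> o1 o2 _ _; exact: open_factor_mono.
Qed.

(** Serves the edges that become available above the larger vertex configuration only: there nothing
    on the other side can be compared, and the factor being at least 1 is what helps. *)
Lemma rcZ_le_add_edge p psi A rho e :
  0 < p < 1 -> e \in evec L -> A e = false ->
  cle (upd A e true) (available psi) ->
  rcZ p psi A rho <= rcZ p psi (upd A e true) rho.
Proof.
move=> hp es Ae Apsi; rewrite rcZ_add_edge // /rcZ ler_wpM2l //.
  by rewrite exprn_ge0 // ltW ?root1_gt0.
by apply: le_psum => om _; rewrite ler_peMr ?rcw_ge0 ?open_factor_ge1.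
Qed.

End random_cluster.

(** * Stochastic monotonicity *)

Section vertex_increments.
Context {R : realType} {d : nat} (hd : (0 < d)%N) (L : box d).
Context (q : R) (hq : 1 <= q <= 2).
Implicit Types (p : R) (psi : zd d -> bool) (rho : edge d -> bool) (x : zd d).
Implicit Types (s : seq (edge d)) (e : edge d).

(* Availability when [x] has been added to [psi] but only its edges in [s] may
   be used. *)
Definition star_available psi x (s : seq (edge d)) : edge d -> bool :=
  fun e => available psi e || (e \in s) && available (upd psi x true) e.

Lemma available_off psi x e : x \in val e -> psi x = false ->
  available psi e = false.
Proof.
by move=> xe px; apply/negbTE/negP => /asboolP/(_ _ xe); rewrite px.
Qed.

Lemma cle_upd (K : eqType) (c : K -> bool) (k : K) : cle c (upd c k true).
Proof. by move=> y; rewrite /upd; case: eqP. Qed.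

Lemma star_available_le psi x s :
  cle (star_available psi x s) (available (upd psi x true)).
Proof.
move=> e /orP[|/andP[//]]; apply: available_mono; exact: cle_upd.
Qed.

Lemma star_available_off psi x s e : x \in val e -> psi x = false ->
  e \notin s -> star_available psi x s e = false.
Proof.
by move=> xe px es; rewrite /star_available (available_off xe) // (negbTE es).
Qed.

Lemma star_available_cons psi x s e : x \in val e -> psi x = false ->
  star_available psi x (e :: s) =
  if available (upd psi x true) e then upd (star_available psi x s) e true
  else star_available psi x s.
Proof.
move=> xe px; case: ifPn => [ae|/negbTE ae]; apply/funext => e';
  rewrite /star_available /upd inE; case: eqP => //= ->.
- by rewrite -/(upd psi x true) ae orbT.
- by rewrite -/(upd psi x true) ae !andbF.
Qed.

(* The star of [x] is made available one edge at a time: each edge multiplies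
   the partition function by the mean of [open_factor]. *)
Lemma star_chain p1 p2 psi1 psi2 rho1 rho2 x s :
  0 < p1 < 1 -> 0 < p2 < 1 -> p1 <= p2 -> cle psi1 psi2 -> cle rho1 rho2 ->
  (forall e, e \notin evec L -> rho1 e -> available psi1 e) ->
  (forall e, e \notin evec L -> rho2 e -> available psi2 e) ->
  psi2 x = false -> uniq s ->
  (forall e, e \in s -> e \in evec L /\ x \in val e) ->
  rcZ L q p1 (upd psi1 x true) (star_available psi1 x s) rho1 *
  rcZ L q p2 (upd psi2 x true) (star_available psi2 x [::]) rho2 <=
  rcZ L q p1 (upd psi1 x true) (star_available psi1 x [::]) rho1 *
  rcZ L q p2 (upd psi2 x true) (star_available psi2 x s) rho2.
Proof.
move=> hp1 hp2 p12 psi12 rho12 r1 r2 px2.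
have px1 : psi1 x = false by apply: contraFF px2; exact: psi12.
have psix12 : cle (upd psi1 x true) (upd psi2 x true).
  by move=> y; rewrite /upd; case: eqP => // _; exact: psi12.
have pos1 s' : 0 < rcZ L q p1 (upd psi1 x true) (star_available psi1 x s') rho1.
  by apply: rcZ_gt0 => // e es re; rewrite /star_available r1.
have pos2 s' : 0 < rcZ L q p2 (upd psi2 x true) (star_available psi2 x s') rho2.
  by apply: rcZ_gt0 => // e es re; rewrite /star_available r2.
elim: s => [//|e s IH] /= /andP[es us] star.
have {}IH := IH us (fun e' h => star e' (mem_behead (s := e :: s) h)).
have [eL xe] := star e (mem_head _ _).
have off1 := star_available_off xe px1 es.
have off2 := star_available_off xe px2 es.
have A12 : cle (star_available psi1 x s) (star_available psi2 x s).
  move=> e' /orP[/(available_mono psi12) h|/andP[e's h]]; apply/orP; [by left|].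
  by right; rewrite e's; exact: available_mono h.
have := star_available_cons s xe px1; have := star_available_cons s xe px2.
have le1 : available (upd psi1 x true) e ->
    cle (upd (star_available psi1 x s) e true) (available (upd psi1 x true)).
  move=> h e'; rewrite /upd; case: eqP => [->//|_]; exact: star_available_le.
have le2 : available (upd psi2 x true) e ->
    cle (upd (star_available psi2 x s) e true) (available (upd psi2 x true)).
  move=> h e'; rewrite /upd; case: eqP => [->//|_]; exact: star_available_le.
(* The new edge may be available in both configurations, in the larger one only, or in neither; the
   smaller one only is excluded by monotonicity. *)
case: ifPn => [a2|/negbTE a2] ->; case: ifPn => [a1|/negbTE a1] ->.
- have p3 := pos1 (e :: s); rewrite star_available_cons // a1 in p3.
  apply: (cancel_middle (pos1 s) (pos2 s) (pos2 [::]) p3 IH).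
  exact: (rcZ_step hq hp1 hp2 p12 psix12 A12 rho12 eL off1 off2 (le1 a1) (le2 a2)).
- apply: le_trans IH _; apply: ler_wpM2l; first exact/ltW/pos1.
  exact: (rcZ_le_add_edge hq rho2 hp2 eL off2 (le2 a2)).
- by move: a2; rewrite (available_mono psix12 a1).
- exact: IH.
Qed.

Lemma rcZ_add_vertex p psi rho x : 0 < p < 1 -> box_vertices L x ->
  psi x = false ->
  rcZ L q p (upd psi x true) (available psi) rho =
  q * rcZ L q p psi (available psi) rho.
Proof.
move=> hp Lx px; rewrite /rcZ mulrCA; congr (_ * _); rewrite -psumZ.
apply: eq_psum => om _; rewrite /rcw.
have [/asboolP oA|_] := boolP `[< cle om (available psi) >]; last first.
  by rewrite mulr0n !mul0r mulr0.
rewrite mulr1n !mul1r mulrA -exprS; congr (q ^+ _ * _).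
exact: (@num_components_add_vertex _ hd L (psi, om) x ((compatibleP _ _).2 oA)).
Qed.

(** Adding [x] as an isolated vertex costs the same factor q on both sides; the ratio of what its
    star then contributes is compared by [star_chain]. *)
Lemma rcZ_vertex_increment p1 p2 psi1 psi2 rho1 rho2 x :
  0 < p1 < 1 -> 0 < p2 < 1 -> p1 <= p2 -> cle psi1 psi2 -> cle rho1 rho2 ->
  (forall e, e \notin evec L -> rho1 e -> available psi1 e) ->
  (forall e, e \notin evec L -> rho2 e -> available psi2 e) ->
  psi2 x = false -> box_vertices L x ->
  rcZ L q p1 (upd psi1 x true) (available (upd psi1 x true)) rho1 *
  rcZ L q p2 psi2 (available psi2) rho2 <=
  rcZ L q p1 psi1 (available psi1) rho1 *
  rcZ L q p2 (upd psi2 x true) (available (upd psi2 x true)) rho2.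
Proof.
move=> hp1 hp2 p12 psi12 rho12 r1 r2 px2 Lx.
have px1 : psi1 x = false by apply: contraFF px2; exact: psi12.
pose s := [seq e <- evec L | x \in val e].
have full psi : psi x = false ->
    star_available psi x s = available (upd psi x true).
  move=> px; apply/funext => e; rewrite /star_available mem_filter.
  have [xe|xe] /= := boolP (x \in val e).
    rewrite (available_off xe px) /= mem_evec asboolT //.
    by exists x.
  rewrite orbF; apply/asboolP/asboolP => h y ye.
    by rewrite /upd; case: eqP => // _; exact: h.
  by have := h y ye; rewrite /upd; case: eqP => // yx; move: xe; rewrite -yx ye.
have empty psi : star_available psi x [::] = available psi.
  by apply/funext => e; rewrite /star_available orbF.
have := @star_chain p1 p2 psi1 psi2 rho1 rho2 x s hp1 hp2 p12 psi12 rho12 r1 r2.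
rewrite !full // !empty !rcZ_add_vertex // => /(_ px2).
move=> /(_ (filter_uniq _ (uniq_evec L))) H.
have q0 : 0 < q by case/andP: hq => h _; exact: lt_le_trans h.
rewrite -(ler_pM2l q0) mulrCA [leRHS]mulrA; apply: H => e.
by rewrite mem_filter => /andP[].
Qed.

End vertex_increments.

(** * Iterated sums over configurations and expectations *)

Section configuration_sums.
Context {R : realType} {K : choiceType}.
Implicit Types (c : K -> bool) (s : seq K) (g : (K -> bool) -> R).

Fixpoint configs s c : seq (K -> bool) :=
  if s is x :: s' then configs s' (upd c x false) ++ configs s' (upd c x true)
  else [:: c].

Lemma psumE s g c : psum s g c = \sum_(c' <- configs s c) g c'.
Proof.
elim: s c => [|x s IH] c /=; first by rewrite big_seq1.
by rewrite big_cat /= !IH.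
Qed.

Lemma mem_configs s c c' : c' \in configs s c <-> agree s c c'.
Proof.
elim: s c => [|x s IH] c /=.
  rewrite inE; split=> [/eqP -> //|h].
  by apply/eqP/funext => y; rewrite h.
rewrite mem_cat; split=> [/orP[]/IH/agree_cons//|h].
have := agree_upd h; case: (c' x) => /IH ->//; by rewrite orbT.
Qed.

Lemma uniq_configs s c : uniq s -> uniq (configs s c).
Proof.
elim: s c => [//|x s IH] c /= /andP[xs us].
rewrite cat_uniq !IH // andbT /=; apply/hasPn => c' /mem_configs h1.
apply/negP => /mem_configs h2.
by have := h1 x xs; rewrite -(h2 x xs) !updE.
Qed.

Lemma prod_expr_count (u : R) c s : \prod_(x <- s) u ^+ c x = u ^+ count c s.
Proof.
elim: s => [|x s IH]; first by rewrite big_nil.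
by rewrite big_cons IH /= exprD.
Qed.

Lemma card_fset_set_count (A : set K) s : uniq s ->
  (forall x, A x -> x \in s) ->
  #|` fset_set A| = count (fun x => `[< A x >]) s.
Proof.
move=> us As; rewrite -size_filter; apply: perm_size.
have fA : finite_set A.
  by apply: (sub_finite_set _ (finite_fset [fset x in s]%fset)) => x /As;
    rewrite /= inE.
apply: uniq_perm; [exact: fset_uniq|exact: filter_uniq|move=> x].
rewrite in_fset_set // mem_filter.
by apply/idP/andP => [/set_mem Ax|[/asboolP/mem_set]//]; split;
  [exact/asboolP|exact: As].
Qed.

End configuration_sums.

Section expectations.
Context {R : realType} {d : nat} (hd : (0 < d)%N) (q : R) (hq : 1 <= q <= 2).
Implicit Types (a p : R) (L : box d) (lam t : config d) (f : config d -> R).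

(** Turns the sum over the box into an iterated one, vertices outside and edges inside, so that
    Holley's inequality can be applied at each level separately. *)
Lemma drc_sum_psum L lam f :
  \sum_(t \in compatible_in L lam) f t =
  psum (vvec L) (fun psi => psum (evec L) (fun om =>
    (`[< cle om (available psi) >])%:R * f (psi, om)) lam.2) lam.1.
Proof.
rewrite fsbig_finite /=; last exact: finite_compatible_in.
under eq_psum do rewrite psumE.
rewrite psumE.
transitivity (\sum_(t <- [seq ((psi, om) : config d) |
    psi <- configs (vvec L) lam.1, om <- configs (evec L) lam.2])
    (`[< compatible t >])%:R * f t); last first.
  rewrite big_allpairs; apply: eq_bigr => psi _; apply: eq_bigr => om _.
  by congr ((nat_of_bool _)%:R * _); apply/asboolP/asboolP => /compatibleP.
rewrite [RHS](eq_bigr (fun t => if `[< compatible t >] then f t else 0)); last first.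
  by move=> t _; case: `[< _ >]; rewrite ?mulr1n ?mulr0n ?mul1r ?mul0r.
rewrite -[RHS]big_mkcond -[RHS]big_filter; apply: perm_big; apply: uniq_perm.
- exact: fset_uniq.
- apply: filter_uniq; apply: allpairs_uniq; last by case=> ? ? [].
  + exact/uniq_configs/uniq_vvec.
  + exact/uniq_configs/uniq_evec.
- move=> t; rewrite in_fset_set; last exact: finite_compatible_in.
  rewrite mem_filter; apply/idP/andP => [/set_mem[ct t1 t2]|[/asboolP ct]].
    split; first exact/asboolP.
    apply/allpairsP; exists t; split; last by case: (t).
    + apply/mem_configs => x; rewrite mem_vvec => /asboolPn h.
      by rewrite t1.
    + apply/mem_configs => e; rewrite mem_evec => /asboolPn h.
      by rewrite t2.
  move=> /allpairsP[[psi om] /= [/mem_configs h1 /mem_configs h2 tE]].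
  apply/mem_set; rewrite tE; rewrite tE in ct; split => // [x Lx|e Le] /=.
    by rewrite -h1 // mem_vvec; apply/asboolPn.
  by rewrite -h2 // mem_evec; apply/asboolPn.
Qed.

Lemma drc_weightE a p L t : compatible t ->
  drc_weight a p q L t = odds a ^+ count (t.1 : zd d -> bool) (vvec L) *
    (root1 p ^+ count (available t.1) (evec L) *
     rcw L q p t.1 (available t.1) t.2).
Proof.
move=> ct; have tE : t = (t.1, t.2) by case: (t).
have oA : cle (t.2 : edge d -> bool) (available t.1).
  by apply/compatibleP; rewrite -tE.
rewrite /drc_weight /rcw asboolT // mulr1n mul1r -tE.
rewrite fsbig_finite; last exact: finite_box_vertices.
rewrite fsbig_finite; last first.
  by apply: sub_finite_set (finite_box_edges L) => e [].
rewrite !prod_expr_count /=.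
have cE : count (t.2 : edge d -> bool) (enum_fset (fset_set (open_edges L t))) =
    count (t.2 : edge d -> bool) (evec L).
  rewrite -!size_filter; apply: perm_size; apply: uniq_perm.
  - exact/filter_uniq/fset_uniq.
  - exact/filter_uniq/uniq_evec.
  move=> e; rewrite !mem_filter mem_evec; case E : (t.2 e) => //=.
  rewrite in_fset_set; last by apply: sub_finite_set (finite_box_edges L) => e' [].
  apply/idP/asboolP => [/set_mem[]//|Le]; apply/mem_set; split => //.
  by have /asboolP := oA e E.
rewrite cE (card_fset_set_count (uniq_evec L)); last first.
  by move=> e [Le _]; rewrite mem_evec asboolT.
rewrite [count (fun x => _) _](_ : _ = count (available t.1) (evec L)); last first.
  apply: eq_in_count => e; rewrite mem_evec => /asboolP Le.
  by apply/asboolP/asboolP => [[]//|h]; split.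
rewrite -/(root1 p) -/(odds p) -/(odds a).
by rewrite -!mulrA [RHS]mulrCA; congr (_ * _); rewrite mulrCA.
Qed.

Definition drc_sum a p L lam f : R :=
  \sum_(t \in compatible_in L lam) drc_weight a p q L t * f t.

(** The expectation as a finite algebraic sum; [drc_measure_mean] relates it to the probability
    measure. *)
Definition drc_mean a p L lam f : R :=
  (drc_partition a p q L lam)^-1 * drc_sum a p L lam f.

Lemma drc_sumE a p L lam f : drc_sum a p L lam f =
  psum (vvec L) (fun psi => odds a ^+ count psi (vvec L) *
    (root1 p ^+ count (available psi) (evec L) *
     psum (evec L) (fun om => rcw L q p psi (available psi) om * f (psi, om))
       lam.2)) lam.1.
Proof.
rewrite /drc_sum drc_sum_psum; apply: eq_psum => psi _.
rewrite -!psumZ; apply: eq_psum => om _.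
have [/asboolP oA|/asboolPn noA] := boolP `[< cle om (available psi) >].
  by rewrite mulr1n mul1r drc_weightE ?mulrA //; exact/compatibleP.
by rewrite /rcw asboolF // !mulr0n !mul0r !mulr0.
Qed.

Lemma drc_partitionE a p L lam : drc_partition a p q L lam =
  psum (vvec L) (fun psi => odds a ^+ count psi (vvec L) *
    rcZ L q p psi (available psi) lam.2) lam.1.
Proof.
have -> : drc_partition a p q L lam = drc_sum a p L lam (fun=> 1).
  by apply: eq_fsbigr => t _; rewrite mulr1.
rewrite drc_sumE; apply: eq_psum => psi _; congr (_ * (_ * _)).
by apply: eq_psum => om _; rewrite mulr1.
Qed.

Definition cfg_le t t' :=
  (forall x, t.1 x -> t'.1 x) /\ (forall e, t.2 e -> t'.2 e).

Definition increasing f := forall t t', cfg_le t t' -> f t <= f t'.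

(** An edge outside the box has both ends outside it, where [psi] still equals the boundary
    condition. *)
Lemma boundary_available L lam psi : compatible lam -> agree (vvec L) lam.1 psi ->
  forall e, e \notin evec L -> lam.2 e -> available psi e.
Proof.
move=> cl lpsi e eL le; apply/asboolP => x xe; rewrite -lpsi.
  exact: cl le xe.
apply/negP; rewrite mem_vvec => /asboolP Lx; move/negP: eL; apply.
by rewrite mem_evec; apply/asboolP; exists x.
Qed.

Lemma drc_partition_gt0 a p L lam : 0 < a < 1 -> 0 < p < 1 -> compatible lam ->
  0 < drc_partition a p q L lam.
Proof.
move=> ha hp cl; rewrite drc_partitionE.
apply: (@psum_gt0 _ _ _ _ _ lam.1) => // [psi lpsi|]; rewrite ?ltW //;
  apply: mulr_gt0; rewrite ?exprn_gt0 ?odds_gt0 //;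
  by apply: (rcZ_gt0 hq) => //; exact: boundary_available.
Qed.

Theorem drc_mean_mono a1 a2 p1 p2 L lam1 lam2 f :
  0 < a1 < 1 -> 0 < a2 < 1 -> 0 < p1 < 1 -> 0 < p2 < 1 ->
  a1 <= a2 -> p1 <= p2 -> compatible lam1 -> compatible lam2 ->
  cfg_le lam1 lam2 -> increasing f -> (forall t, 0 <= f t) ->
  drc_mean a1 p1 L lam1 f <= drc_mean a2 p2 L lam2 f.
Proof.
move=> ha1 ha2 hp1 hp2 a12 p12 cl1 cl2 [lV lE] fi f0.
have Z1 := drc_partition_gt0 L ha1 hp1 cl1.
have Z2 := drc_partition_gt0 L ha2 hp2 cl2.
rewrite /drc_mean mulrC ler_pdivrMr // -mulrA ler_pdivlMl //.
rewrite mulrC [leRHS]mulrC.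
pose mu a p lam psi := odds a ^+ count psi (vvec L) *
    rcZ L q p psi (available psi) lam.2.
(* [mu] is the weight of the vertex configuration and [F] the conditional mean of [f] given it. The
   lattice condition for [mu] comes from [rcZ_vertex_increment], the monotonicity of [F] from
   [rc_holley] on the edges. *)
pose F p (lam : config d) psi :=
  psum (evec L) (fun om => rcw L q p psi (available psi) om * f (psi, om)) lam.2 /
  psum (evec L) (rcw L q p psi (available psi)) lam.2.
have pos p lam psi : 0 < p < 1 -> compatible lam ->
    agree (vvec L) lam.1 psi ->
    0 < psum (evec L) (rcw L q p psi (available psi)) lam.2.
  by move=> hp cl h; apply: psum_rcw_gt0 => //; exact: boundary_available.
have muF a p lam : 0 < p < 1 -> compatible lam -> drc_sum a p L lam f =
    psum (vvec L) (fun psi => mu a p lam psi * F p lam psi) lam.1.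
  move=> hp cl; rewrite drc_sumE; apply: eq_psum => psi h.
  rewrite /mu /F /rcZ -!mulrA; congr (_ * (_ * _)).
  by rewrite mulrCA divff ?mulr1 // gt_eqF ?pos.
have mu_ge0 a p lam psi : 0 < a < 1 -> 0 < p < 1 -> 0 <= mu a p lam psi.
  move=> ha hp; rewrite /mu /rcZ; apply: mulr_ge0.
    by apply: exprn_ge0; exact/ltW/odds_gt0.
  apply: mulr_ge0; first by apply: exprn_ge0; exact/ltW/root1_gt0.
  by apply: psum_ge0 => om _; exact: rcw_ge0.
have F_ge0 p lam psi : 0 < p < 1 -> 0 <= F p lam psi.
  move=> hp; apply: divr_ge0; apply: psum_ge0 => om _; last exact: rcw_ge0.
  by apply: mulr_ge0 => //; exact: rcw_ge0.
rewrite !muF // !drc_partitionE.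
apply: holley => // [psi|psi|psi|psi|psi1 psi2 h1 h2|psi1 psi2 h1 h2 psi12].
- exact: mu_ge0.
- exact: mu_ge0.
- exact: F_ge0.
- exact: F_ge0.
- apply: (@increments_lattice _ _ _ (mu a1 p1 lam1) (mu a2 p2 lam2) _ _ lV)
    h1 h2 => [psi h|psi h|].
  + apply: mulr_gt0; first by apply: exprn_gt0; exact: odds_gt0.
    by apply: rcZ_gt0 => //; exact: boundary_available.
  + apply: mulr_gt0; first by apply: exprn_gt0; exact: odds_gt0.
    by apply: rcZ_gt0 => //; exact: boundary_available.
  move=> {}psi1 {}psi2 x h1 h2 psi12 xL px2.
  have px1 : psi1 x = false by apply: contraFF px2; exact: psi12.
  have Lx : box_vertices L x by move: xL; rewrite mem_vvec => /asboolP.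
  rewrite /mu !(count_upd (uniq_vvec L) xL) // !exprS mulrACA [leRHS]mulrACA.
  have o1 := ltW (odds_gt0 ha1); have o2 := ltW (odds_gt0 ha2).
  apply: ler_pM.
  + exact: mulr_ge0 (mulr_ge0 o1 (exprn_ge0 _ o1)) (exprn_ge0 _ o2).
  + apply: mulr_ge0; apply: mulr_ge0; try (apply: exprn_ge0; exact/ltW/root1_gt0);
      by apply: psum_ge0 => om _; exact: rcw_ge0.
  + rewrite -mulrA mulrCA; apply: ler_wpM2l; first exact: exprn_ge0.
    by apply: ler_wpM2r; [exact: exprn_ge0|exact: le_odds].
  + apply: rcZ_vertex_increment => //; exact: boundary_available.
- have P1 := pos p1 lam1 psi1 hp1 cl1 h1; have P2 := pos p2 lam2 psi2 hp2 cl2 h2.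
  rewrite /F ler_pdivrMr // mulrAC ler_pdivlMr //.
  rewrite [leRHS]mulrC; apply: rc_holley => //.
  + exact: available_mono.
  + by move=> o1 o2 _ _ o12; apply: fi; split.
Qed.

End expectations.

(** * Domain Markov property *)

Section domain_markov.
Context {R : realType} {d : nat} (hd : (0 < d)%N) (q : R) (hq : 1 <= q <= 2).
Implicit Types (a p : R) (L : box d) (lam s t : config d) (f g : config d -> R).

(** Free of subtraction: the difference of the two counts on [u'] equals their difference on [u],
    the rest of [u'] contributing equally. *)
Lemma count_agree (K : eqType) (u u' : seq K) (c c' : K -> bool) :
  uniq u -> uniq u' -> {subset u <= u'} ->
  (forall x, x \in u' -> x \notin u -> c x = c' x) ->
  (count c u' + count c' u = count c' u' + count c u)%N.
Proof.
move=> uu uu' sub cc'.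
have E (b : K -> bool) :
    count b u' = (count b u + count b [seq x <- u' | x \notin u])%N.
  rewrite -count_cat; apply/permP; rewrite perm_sym.
  apply: perm_trans (permEl (perm_filterC (mem u) u')).
  rewrite perm_cat2r; apply: uniq_perm; rewrite ?filter_uniq // => x.
  by rewrite mem_filter /=; case xu : (x \in u) => //=; rewrite sub.
rewrite !E addnAC [RHS]addnAC [(count c u + _)%N]addnC; congr (_ + _)%N.
apply: eq_in_count => x; rewrite mem_filter => /andP[? ?]; exact: cc'.
Qed.

Definition agree_off L s t :=
  (forall x, ~ box_vertices L x -> s.1 x = t.1 x) /\
  (forall e, ~ box_edges L e -> s.2 e = t.2 e).

Definition close_edges t (u : seq (edge d)) : config d :=
  (t.1, fun e => t.2 e && (e \notin u)).

Definition vacate t (u : seq (zd d)) : config d :=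
  (fun x => t.1 x && (x \notin u), t.2).

Lemma box_edges_sub L L' : box_vertices L `<=` box_vertices L' ->
  box_edges L `<=` box_edges L'.
Proof. by move=> LL' e [x xe Lx]; exists x => //; exact: LL'. Qed.

(** Both configurations are taken to a common one by closing the edges of [L] and then vacating its
    vertices. Each such move changes the counts for [L] and for [L'] by the same amount. *)
Lemma num_components_box_diff L L' s t :
  box_vertices L `<=` box_vertices L' -> compatible s -> compatible t ->
  agree_off L s t ->
  (num_components L' s + num_components L t =
   num_components L' t + num_components L s)%N.
Proof.
move=> LL'; pose k' := num_components L'; pose k := num_components L.
pose same s t := (k' s + k t = k' t + k s)%N.
have same_trans t2 t1 t3 : same t1 t2 -> same t2 t3 -> same t1 t3.
  by rewrite /same; lia.
have same_sym t1 t2 : same t1 t2 -> same t2 t1 by rewrite /same; lia.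
suff base t1 : compatible t1 ->
    same t1 (vacate (close_edges t1 (evec L)) (vvec L)).
  move=> cs ct [V E]; apply: same_trans (base _ cs) _; apply: same_sym.
  suff -> : vacate (close_edges s (evec L)) (vvec L) =
    vacate (close_edges t (evec L)) (vvec L) by exact: base.
  congr pair; [apply/funext => x /=|apply/funext => e /=].
    case: (boolP (x \in vvec L)); rewrite ?andbF // mem_vvec => /asboolPn.
    by move=> /V ->.
  case: (boolP (e \in evec L)); rewrite ?andbF // mem_evec => /asboolPn.
  by move=> /E ->.
move=> ct1.
have cE u : compatible (close_edges t1 u).
  by move=> e x /andP[te _] xe; exact: ct1 te xe.
have SE u : {subset u <= evec L} -> same t1 (close_edges t1 u).
  elim: u => [|e u IH] sub.
    rewrite (_ : close_edges _ _ = t1) //; case: (t1) => ? ?; congr pair.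
    by apply/funext => e; rewrite /= andbT.
  have /same_trans := IH (fun e' h => sub e' (mem_behead (s := e :: u) h)).
  apply; have [te|/negbTE te] := boolP (t1.2 e); last first.
    rewrite (_ : close_edges t1 u = close_edges t1 (e :: u)) //.
    congr pair; apply/funext => e'; rewrite inE.
    by case: eqP => // ->; rewrite te.
  have [eu|eu] := boolP (e \in u).
    rewrite (_ : close_edges t1 u = close_edges t1 (e :: u)) //.
    congr pair; apply/funext => e'; rewrite inE.
    by case: eqP => // ->; rewrite eu.
  have -> : close_edges t1 u = add_edge (close_edges t1 (e :: u)) e.
    congr pair; apply/funext => e'; rewrite /upd /= inE.
    by case: eqP => // ->; rewrite te.
  have Le : box_edges L e.
    by have := sub e (mem_head _ _); rewrite mem_evec => /asboolP.
  have on : edge_on (close_edges t1 (e :: u)) e by move=> x; exact: ct1.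
  rewrite /same /k /k' (num_components_add_edge (cE (e :: u)) Le on).
  rewrite (num_components_add_edge (cE (e :: u)) (box_edges_sub LL' Le) on).
  by lia.
apply: (same_trans _ _ _ (SE (evec L) (fun _ => id))).
(* With all edges of [L] closed, its occupied vertices are isolated, so vacating one lowers both
   counts by exactly 1. *)
set t2 := close_edges t1 (evec L).
have cV u : {subset u <= vvec L} -> compatible (vacate t2 u).
  move=> sub e x te xe /=; apply/andP; split; first exact: (cE (evec L) e x).
  apply/negP => /sub; rewrite mem_vvec => /asboolP Lx.
  move: te => /= /andP[_]; rewrite mem_evec => /asboolPn; apply.
  by exists x.
suff SV u : {subset u <= vvec L} -> same t2 (vacate t2 u) by exact: SV.
elim: u => [|x u IH] sub.
  rewrite (_ : vacate _ _ = t2) //; case: (t2) => ? ?; congr pair.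
  by apply/funext => e; rewrite /= andbT.
have /same_trans := IH (fun e' h => sub e' (mem_behead (s := x :: u) h)).
apply; have [tx|/negbTE tx] := boolP (t1.1 x); last first.
  rewrite (_ : vacate t2 u = vacate t2 (x :: u)) //.
  congr pair; apply/funext => y; rewrite /= inE.
  by case: eqP => // ->; rewrite tx.
have [xu|xu] := boolP (x \in u).
  rewrite (_ : vacate t2 u = vacate t2 (x :: u)) //.
  congr pair; apply/funext => y; rewrite /= inE.
  by case: eqP => // ->; rewrite xu.
have -> : vacate t2 u = add_vertex (vacate t2 (x :: u)) x.
  congr pair; apply/funext => y; rewrite /upd /= inE.
  by case: eqP => // ->; rewrite tx.
have Lx : box_vertices L x.
  by have := sub x (mem_head _ _); rewrite mem_vvec => /asboolP.
have off : (vacate t2 (x :: u)).1 x = false by rewrite /= inE eqxx andbF.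
rewrite /same /k /k' (num_components_add_vertex hd (cV _ sub) Lx off).
rewrite (num_components_add_vertex hd (cV _ sub) (LL' _ Lx) off).
by lia.
Qed.

(** Passing from [s] to [t] changes every exponent of the weight by the same amount in both boxes,
    so the ratio of the two weights does not depend on the box. *)
Lemma drc_weight_box_exchange a p L L' s t :
  box_vertices L `<=` box_vertices L' -> compatible s -> compatible t ->
  agree_off L s t ->
  drc_weight a p q L' s * drc_weight a p q L t =
  drc_weight a p q L' t * drc_weight a p q L s.
Proof.
move=> LL' cs ct st; have := num_components_box_diff LL' cs ct st.
have oA u : compatible u -> cle (u.2 : edge d -> bool) (available u.1).
  by move=> cu; apply/compatibleP; case: (u) cu.
rewrite !drc_weightE // /rcw !asboolT; try exact: oA.
rewrite !mulr1n !mul1r.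
have uE (u : config d) : ((u.1, u.2) : config d) = u by case: u.
rewrite !uE => kE; case: st => stV stE.
have sV : {subset vvec L <= vvec L'}.
  by move=> x; rewrite !mem_vvec => /asboolP Lx; apply/asboolP; exact: LL'.
have sE : {subset evec L <= evec L'}.
  move=> e; rewrite !mem_evec => /asboolP Le; apply/asboolP.
  exact: box_edges_sub Le.
have NV := @count_agree _ _ _ (s.1 : zd d -> bool) t.1 (uniq_vvec L)
  (uniq_vvec L') sV.
have NA := @count_agree _ _ _ (available s.1) (available t.1) (uniq_evec L)
  (uniq_evec L') sE.
have NE := @count_agree _ _ _ (s.2 : edge d -> bool) t.2 (uniq_evec L)
  (uniq_evec L') sE.
have {}NV : (count (s.1 : zd d -> bool) (vvec L') + count (t.1 : zd d -> bool) (vvec L) =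
    count (t.1 : zd d -> bool) (vvec L') + count (s.1 : zd d -> bool) (vvec L))%N.
  by apply: NV => x _; rewrite mem_vvec => /asboolPn /stV.
have {}NE : (count (s.2 : edge d -> bool) (evec L') + count (t.2 : edge d -> bool) (evec L) =
    count (t.2 : edge d -> bool) (evec L') + count (s.2 : edge d -> bool) (evec L))%N.
  by apply: NE => e _; rewrite mem_evec => /asboolPn /stE.
have {}NA : (count (available s.1) (evec L') + count (available t.1) (evec L) =
    count (available t.1) (evec L') + count (available s.1) (evec L))%N.
  apply: NA => e _; rewrite mem_evec => /asboolPn Le.
  apply/asboolP/asboolP => h x xe; first rewrite -stV; [exact: h| |].
    by move=> Lx; apply: Le; exists x.
  rewrite stV; first exact: h.
  by move=> Lx; apply: Le; exists x.
have comb (u : R) m n m' n' : (m + n = m' + n')%N ->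
    u ^+ m * u ^+ n = u ^+ m' * u ^+ n' by rewrite -!exprD => ->.
have P8 (x y z w x' y' z' w' : R) :
    x * (y * (z * w)) * (x' * (y' * (z' * w'))) =
    (x * x') * ((y * y') * ((z * z') * (w * w'))).
  by do 2 (rewrite mulrACA; congr (_ * _)); rewrite mulrACA.
by rewrite !P8 (comb _ _ _ _ _ NV) (comb _ _ _ _ _ NA) (comb _ _ _ _ _ NE)
  (comb _ _ _ _ _ kE).
Qed.

Definition cfgs L lam : seq (config d) :=
  enum_fset (fset_set (compatible_in L lam)).

Lemma mem_cfgs L lam t : (t \in cfgs L lam) = `[< compatible_in L lam t >].
Proof.
rewrite in_fset_set; last exact: finite_compatible_in.
by apply/idP/asboolP => [/set_mem//|/mem_set].
Qed.

Lemma uniq_cfgs L lam : uniq (cfgs L lam). Proof. exact: fset_uniq. Qed.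

Lemma sum_cfgs L lam f :
  \sum_(t \in compatible_in L lam) f t = \sum_(t <- cfgs L lam) f t.
Proof. by rewrite fsbig_finite //; exact: finite_compatible_in. Qed.

Lemma drc_meanE a p L lam f : drc_mean q a p L lam f =
  (\sum_(t <- cfgs L lam) drc_weight a p q L t)^-1 *
  \sum_(t <- cfgs L lam) drc_weight a p q L t * f t.
Proof. by rewrite /drc_mean /drc_sum /drc_partition !sum_cfgs. Qed.

Lemma sum_cfgs_gt0 a p L lam : 0 < a < 1 -> 0 < p < 1 -> compatible lam ->
  0 < \sum_(t <- cfgs L lam) drc_weight a p q L t.
Proof.
move=> ha hp cl; rewrite -sum_cfgs; exact: (drc_partition_gt0 hq L ha hp cl).
Qed.

Lemma weight_ge0 a p L t : 0 < a < 1 -> 0 < p < 1 ->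
  0 <= drc_weight a p q L t.
Proof.
move=> ha hp; apply/ltW/drc_weight_gt0 => //.
by case/andP: hq => h _; exact: lt_le_trans h.
Qed.

Lemma le_drc_mean a p L lam f g : 0 < a < 1 -> 0 < p < 1 -> compatible lam ->
  (forall t, compatible_in L lam t -> f t <= g t) ->
  drc_mean q a p L lam f <= drc_mean q a p L lam g.
Proof.
move=> ha hp cl fg; rewrite !drc_meanE ler_wpM2l ?invr_ge0 //.
  exact/ltW/sum_cfgs_gt0.
rewrite big_seq [leRHS]big_seq; apply: ler_sum => t.
rewrite mem_cfgs => /asboolP /fg; apply: ler_wpM2l; exact: weight_ge0.
Qed.

Lemma eq_drc_mean a p L lam f g :
  (forall t, compatible_in L lam t -> f t = g t) ->
  drc_mean q a p L lam f = drc_mean q a p L lam g.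
Proof.
move=> fg; rewrite !drc_meanE; congr (_ * _).
by apply: eq_big_seq => t; rewrite mem_cfgs => /asboolP /fg ->.
Qed.

Lemma drc_meanD a p L lam f g : drc_mean q a p L lam (fun t => f t + g t) =
  drc_mean q a p L lam f + drc_mean q a p L lam g.
Proof.
rewrite !drc_meanE -mulrDr -big_split /=; congr (_ * _).
by apply: eq_bigr => t _; rewrite mulrDr.
Qed.

Lemma drc_meanZ a p L lam (k : R) f : drc_mean q a p L lam (fun t => k * f t) =
  k * drc_mean q a p L lam f.
Proof.
rewrite !drc_meanE mulrCA; congr (_ * _); rewrite mulr_sumr.
by apply: eq_bigr => t _; rewrite mulrCA.
Qed.

Lemma drc_mean_cst a p L lam (k : R) : 0 < a < 1 -> 0 < p < 1 ->
  compatible lam -> drc_mean q a p L lam (fun=> k) = k.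
Proof.
move=> ha hp cl; rewrite drc_meanE -mulr_suml mulrA mulVf ?mul1r //.
by rewrite gt_eqF // sum_cfgs_gt0.
Qed.

Lemma drc_mean_sum (I : Type) (r : seq I) a p L lam (F : I -> config d -> R) :
  drc_mean q a p L lam (fun t => \sum_(i <- r) F i t) =
  \sum_(i <- r) drc_mean q a p L lam (F i).
Proof.
elim: r => [|i r IH].
  rewrite big_nil -[RHS](mul0r (drc_mean q a p L lam (fun=> 0))) -drc_meanZ.
  by apply: eq_drc_mean => t _; rewrite big_nil mul0r.
rewrite big_cons -IH -drc_meanD; apply: eq_drc_mean => t _.
by rewrite big_cons.
Qed.

Lemma agree_off_sym L s t : agree_off L s t -> agree_off L t s.
Proof. by move=> [h k]; split=> [x /h ->|e /k ->]. Qed.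

Lemma agree_off_cfgs L s t : agree_off L s t -> cfgs L s = cfgs L t.
Proof.
move=> [h k]; rewrite /cfgs (_ : compatible_in L s = compatible_in L t) //.
by apply/seteqP; split => u [cu u1 u2]; split => // x Lx;
  rewrite ?u1 ?u2 ?h ?k.
Qed.

(* The pairs [(t, s)] that agree off the small box are summed in both orders;
   [drc_weight_box_exchange] makes the summand symmetric. *)
Theorem drc_mean_markov a p L L' lam f : 0 < a < 1 -> 0 < p < 1 ->
  compatible lam -> box_vertices L `<=` box_vertices L' ->
  drc_mean q a p L' lam f =
  drc_mean q a p L' lam (fun t => drc_mean q a p L t f).
Proof.
move=> ha hp cl LL'; rewrite !drc_meanE; congr (_ * _).
pose w' := drc_weight a p q L'; pose w := drc_weight a p q L.
pose Z t := \sum_(s <- cfgs L t) w s.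
have inner t (F : config d -> R) : t \in cfgs L' lam ->
    \sum_(s <- cfgs L t) F s =
    \sum_(s <- cfgs L' lam | `[< agree_off L s t >]) F s.
  rewrite mem_cfgs => /asboolP[ct t1 t2].
  rewrite -[RHS]big_filter; apply: perm_big; apply: uniq_perm.
  - exact: uniq_cfgs.
  - exact/filter_uniq/uniq_cfgs.
  move=> s; rewrite mem_filter !mem_cfgs.
  apply/asboolP/andP => [[cs s1 s2]|[/asboolP[s1 s2] /asboolP[cs _ _]]] //.
  split; apply/asboolP; split => // [x Lx|e Le].
    by rewrite s1 ?t1 // => /LL'.
  by rewrite s2 ?t2 // => /(box_edges_sub LL').
transitivity (\sum_(t <- cfgs L' lam) \sum_(s <- cfgs L' lam)
    if `[< agree_off L s t >] then w' t * w s * (f s / Z t) else 0); last first.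
  apply: eq_big_seq => t tC.
  have -> : drc_mean q a p L t f =
      (Z t)^-1 * \sum_(s <- cfgs L t) (w s * f s) by exact: drc_meanE.
  rewrite inner // mulrA mulr_sumr [RHS]big_mkcond; apply: eq_bigr => s _.
  case: ifP => // _.
  rewrite -/(w' t); move: (w' t) (w s) (f s) (Z t)^-1 => x y z u.
  by rewrite -!mulrA; congr (_ * _); rewrite [RHS]mulrCA; congr (_ * _);
    rewrite mulrC.
rewrite exchange_big /=; apply: eq_big_seq => s sC.
have Cs : compatible s by move: sC; rewrite mem_cfgs => /asboolP[].
transitivity (\sum_(t <- cfgs L s) w t * (w' s * (f s / Z s))).
  rewrite -mulr_suml -/(Z s) mulrCA; congr (_ * _).
  by rewrite mulrCA divff ?mulr1 // gt_eqF // sum_cfgs_gt0.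
rewrite inner // [LHS]big_mkcond; apply: eq_big_seq => t tC.
have Ct : compatible t by move: tC; rewrite mem_cfgs => /asboolP[].
have -> : `[< agree_off L s t >] = `[< agree_off L t s >].
  by apply/asboolP/asboolP; exact: agree_off_sym.
case: asboolP => // ts.
have -> : Z t = Z s by rewrite /Z (agree_off_cfgs ts).
by rewrite mulrA [w t * _]mulrC /w /w' (drc_weight_box_exchange a p LL' Cs Ct) //;
  exact: agree_off_sym.
Qed.

Definition ones : config d := (fun=> true, fun=> true).
Definition zeros : config d := (fun=> false, fun=> false).

Lemma compatible_ones : compatible ones. Proof. by []. Qed.
Lemma compatible_zeros : compatible zeros. Proof. by []. Qed.

Lemma cfg_le_zeros t : cfg_le zeros t. Proof. by []. Qed.

(** Given the configuration off the small box, its boundary condition lies below [ones], so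
    monotonicity bounds each conditional mean. *)
Theorem drc_mean_ones_sub a p L L' f : 0 < a < 1 -> 0 < p < 1 ->
  box_vertices L `<=` box_vertices L' -> increasing f -> (forall t, 0 <= f t) ->
  drc_mean q a p L' ones f <= drc_mean q a p L ones f.
Proof.
move=> ha hp LL' fi f0; rewrite (drc_mean_markov _ ha hp _ LL') //.
rewrite -[leRHS](drc_mean_cst L' _ ha hp compatible_ones).
apply: le_drc_mean => // t [ct _ _].
exact: drc_mean_mono.
Qed.

Theorem drc_mean_zeros_sub a p L L' f : 0 < a < 1 -> 0 < p < 1 ->
  box_vertices L `<=` box_vertices L' -> increasing f -> (forall t, 0 <= f t) ->
  drc_mean q a p L zeros f <= drc_mean q a p L' zeros f.
Proof.
move=> ha hp LL' fi f0; rewrite [leRHS](drc_mean_markov _ ha hp _ LL') //.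
rewrite -[leLHS](drc_mean_cst L' _ ha hp compatible_zeros).
apply: le_drc_mean => // t [ct _ _].
exact: drc_mean_mono.
Qed.

End domain_markov.

(** * Translations *)

Lemma card_fset_set_inj (T U : choiceType) (g : T -> U) (A : set T) :
  injective g -> finite_set A -> #|` fset_set (g @` A)| = #|` fset_set A|.
Proof. by move=> gi fA; rewrite fset_set_image // card_imfset. Qed.

Section translations.
Context {d : nat}.
Implicit Types (L : box d) (t : config d) (x y z : zd d) (e : edge d).

Lemma l1_dist_shift z x y : l1_dist (x + z) (y + z) = l1_dist x y.
Proof.
rewrite /l1_dist; apply: eq_bigr => i _; rewrite !ffunE; congr `|_|.
by rewrite opprD addrACA subrr addr0.
Qed.

Lemma is_edge_shift z e : is_edge [fset (x + z)%R | x in val e]%fset.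
Proof.
have [x [y [xy ve]]] := asboolP _ (valP e).
apply/asboolP; exists (x + z), (y + z); split; first by rewrite l1_dist_shift.
apply/fsetP => w; rewrite ve; apply/imfsetP/idP => /=.
  by move=> [u]; rewrite !inE => /orP[]/eqP-> ->; rewrite eqxx ?orbT.
by rewrite !inE => /orP[]/eqP->; [exists x|exists y]; rewrite ?inE ?eqxx ?orbT.
Qed.

Definition shift_edge z e : edge d := 
  exist _ [fset (x + z)%R | x in val e]%fset (is_edge_shift z e).

Lemma mem_shift_edge z e x : (x \in val (shift_edge z e)) = (x - z \in val e).
Proof.
apply/imfsetP/idP => /= [[u ue ->]|h]; first by rewrite addrK.
by exists (x - z) => //; rewrite subrK.
Qed.

Lemma shift_edge_add z z' e : shift_edge z (shift_edge z' e) = shift_edge (z' + z) e.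
Proof.
apply/val_inj/fsetP => x; rewrite !mem_shift_edge.
by rewrite opprD addrA [x - z' - z]addrAC.
Qed.

Lemma shift_edge0 e : shift_edge 0 e = e.
Proof. by apply/val_inj/fsetP => x; rewrite mem_shift_edge subr0. Qed.

Lemma shift_edgeK z : cancel (shift_edge z) (shift_edge (- z)).
Proof. by move=> e; rewrite shift_edge_add subrr shift_edge0. Qed.

Lemma shift_edgeNK z : cancel (shift_edge (- z)) (shift_edge z).
Proof. by move=> e; rewrite shift_edge_add addNr shift_edge0. Qed.

Lemma shift_edge_at z x i : shift_edge z (edge_at x i) = edge_at (x + z) i.
Proof.
by apply/val_inj/fsetP => w; rewrite mem_shift_edge !inE !subr_eq addrAC.
Qed.

(** The configuration as seen from [z]: a function of the origin applied to [shift z t] reads [t] at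
    [z]. *)
Definition shift z t : config d :=
  (fun x => t.1 (x + z), fun e => t.2 (shift_edge z e)).

Lemma shift_box_le z L (i : 'I_d) : (box_lo L + z) i <= (box_hi L + z) i.
Proof. by rewrite !ffunE lerD2r; exact: box_le. Qed.

Definition shift_box z L : box d := Box (shift_box_le z L).

Lemma box_vertices_shift z L x :
  box_vertices (shift_box z L) x <-> box_vertices L (x - z).
Proof.
by split=> h i; have := h i; rewrite /= !ffunE lerBrDr lerBlDr.
Qed.

Lemma box_edges_shift z L e :
  box_edges (shift_box z L) e <-> box_edges L (shift_edge (- z) e).
Proof.
split=> [[x xe /box_vertices_shift Lx]|[x]].
  by exists (x - z) => //; rewrite mem_shift_edge opprK subrK.
rewrite mem_shift_edge opprK => xe Lx; exists (x + z) => //.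
by apply/box_vertices_shift; rewrite addrK.
Qed.

Lemma vvec_shift z L :
  perm_eq [seq x + z | x <- vvec L] (vvec (shift_box z L)).
Proof.
apply: uniq_perm; rewrite ?uniq_vvec ?(map_inj_uniq (addIr z)) ?uniq_vvec //.
move=> x; rewrite mem_vvec; apply/mapP/asboolP => [[y]|h].
  by rewrite mem_vvec => /asboolP Ly ->; apply/box_vertices_shift; rewrite addrK.
exists (x - z); last by rewrite subrK.
by rewrite mem_vvec; apply/asboolP/box_vertices_shift.
Qed.

Lemma evec_shift z L :
  perm_eq [seq shift_edge z e | e <- evec L] (evec (shift_box z L)).
Proof.
apply: uniq_perm; rewrite ?uniq_evec ?(map_inj_uniq (can_inj (shift_edgeK z)))
  ?uniq_evec // => e; rewrite mem_evec; apply/mapP/asboolP => [[e']|h].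
  rewrite mem_evec => /asboolP Le ->; apply/box_edges_shift.
  by rewrite shift_edgeK.
exists (shift_edge (- z) e); last by rewrite shift_edgeNK.
by rewrite mem_evec; apply/asboolP/box_edges_shift.
Qed.

Lemma box_closure_shift z L x :
  box_closure (shift_box z L) x <-> box_closure L (x - z).
Proof.
split=> [[e /box_edges_shift Le xe]|[e Le xe]].
  by exists (shift_edge (- z) e) => //; rewrite mem_shift_edge opprK subrK.
exists (shift_edge z e); last by rewrite mem_shift_edge.
by apply/box_edges_shift; rewrite shift_edgeK.
Qed.

Lemma shift_compatible z t : compatible t -> compatible (shift z t).
Proof. by move=> ct e x te xe; apply: (ct _ _ te); rewrite mem_shift_edge addrK. Qed.

Lemma open_step_shift z t x y :
  open_step (shift z t) x y = open_step t (x + z) (y + z).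
Proof.
apply/asboolP/asboolP => -[e te ve].
  exists (shift_edge z e) => //; apply/fsetP => w.
  by rewrite mem_shift_edge ve !inE !subr_eq.
exists (shift_edge (- z) e); first by rewrite /= shift_edgeNK.
apply/fsetP => w.
by rewrite mem_shift_edge ve !inE opprK !(inj_eq (addIr z)).
Qed.

Lemma component_shift z t x y :
  component (shift z t) x y <-> component t (x + z) (y + z).
Proof.
split=> [[s p <-]|[s p ys]].
  exists [seq u + z | u <- s]; last exact: (last_map (fun u => u + z)).
  rewrite (@path_map _ _ (fun u => u + z)) /=; apply: sub_path p => u v.
  by rewrite open_step_shift.
exists [seq u - z | u <- s]; last first.
  by have := last_map (fun u => u - z) s (x + z); rewrite /= addrK ys addrK.
have := @path_map _ _ (fun u => u - z) (open_step (shift z t)) (x + z) s.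
rewrite /= addrK => ->; apply: sub_path p => u v /=.
by rewrite open_step_shift !subrK.
Qed.

Lemma num_components_shift z L t : compatible t ->
  num_components L (shift z t) = num_components (shift_box z L) t.
Proof.
move=> ct; rewrite !num_componentsE //; last exact: shift_compatible.
pose g (C : set (zd d)) := [set x + z | x in C].
have gi : injective g.
  have sub C D : g C = g D -> C `<=` D.
    move=> E x Cx; have : g C (x + z) by exists x.
    by rewrite E => -[y Dy /addIr <-].
  by move=> C D E; apply/seteqP; split; apply: sub.
rewrite -(card_fset_set_inj gi); last exact/finite_image/finite_on_closure.
have gE x : g (component (shift z t) x) = component t (x + z).
  apply/seteqP; split => [y [u /component_shift xu <-//]|y xy].
  by exists (y - z); rewrite ?subrK //; apply/component_shift; rewrite subrK.
congr (#|` fset_set _|); apply/seteqP; split => C.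
- move=> [D [x [Lx tx] <-] <-]; rewrite gE; exists (x + z) => //; split => //.
  by apply/box_closure_shift; rewrite addrK.
- move=> [x [/box_closure_shift Lx tx] <-].
  exists (component (shift z t) (x - z)); last by rewrite gE subrK.
  by exists (x - z) => //; split => //=; rewrite subrK.
Qed.

Lemma available_shift z t e :
  available (shift z t).1 e = available t.1 (shift_edge z e).
Proof.
apply/asboolP/asboolP => h x; last first.
  by move=> xe; apply: h; rewrite mem_shift_edge addrK.
by rewrite mem_shift_edge => /h /=; rewrite subrK.
Qed.

Context {R : realType} (hd : (0 < d)%N) (q : R) (hq : 1 <= q <= 2).

Lemma drc_weight_shift (a p : R) z L t : compatible t ->
  drc_weight a p q L (shift z t) = drc_weight a p q (shift_box z L) t.
Proof.
move=> ct; have cs : compatible (shift z t) by exact: shift_compatible.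
have oA u : compatible u -> cle (u.2 : edge d -> bool) (available u.1).
  by move=> cu; apply/compatibleP; case: (u) cu.
rewrite !drc_weightE // /rcw !asboolT; [|exact: oA..].
have uE (u : config d) : ((u.1, u.2) : config d) = u by case: u.
rewrite !uE num_components_shift // -!(permP (vvec_shift z L)).
rewrite -!(permP (evec_shift z L)) !count_map.
congr (_ * (_ ^+ _ * _)); apply: eq_count => e /=.
by rewrite available_shift.
Qed.

Lemma cfgs_shift z L lam :
  perm_eq [seq shift z t | t <- cfgs (shift_box z L) lam]
          (cfgs L (shift z lam)).
Proof.
have K u : shift z (shift (- z) u) = u.
  case: u => psi om; congr pair; [apply/funext => x|apply/funext => e] => /=.
    by rewrite addrK.
  by rewrite shift_edgeK.
have K' u : shift (- z) (shift z u) = u.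
  case: u => psi om; congr pair; [apply/funext => x|apply/funext => e] => /=.
    by rewrite subrK.
  by rewrite shift_edgeNK.
apply: uniq_perm; rewrite ?uniq_cfgs ?(map_inj_uniq (can_inj K')) ?uniq_cfgs //.
move=> t; rewrite mem_cfgs; apply/mapP/asboolP => [[u]|[ct t1 t2]].
  rewrite mem_cfgs => /asboolP[cu u1 u2] ->; split; first exact: shift_compatible.
    move=> x Lx /=; apply: u1 => /box_vertices_shift; by rewrite addrK.
  move=> e Le /=; apply: u2 => /box_edges_shift; by rewrite shift_edgeK.
exists (shift (- z) t); last by rewrite K.
rewrite mem_cfgs; apply/asboolP; split; first exact: shift_compatible.
  move=> x Lx /=; rewrite t1 /= ?subrK // => h; apply: Lx.
  exact/box_vertices_shift.
move=> e Le /=; rewrite t2 /= ?shift_edgeNK // => h; apply: Le.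
exact/box_edges_shift.
Qed.

Theorem drc_mean_shift (a p : R) z L lam f : compatible lam ->
  drc_mean q a p (shift_box z L) lam (fun t => f (shift z t)) =
  drc_mean q a p L (shift z lam) f.
Proof.
move=> cl; rewrite !drc_meanE.
have E (F : config d -> R) :
    \sum_(t <- cfgs L (shift z lam)) drc_weight a p q L t * F t =
    \sum_(t <- cfgs (shift_box z L) lam)
      drc_weight a p q (shift_box z L) t * F (shift z t).
  rewrite -(perm_big _ (cfgs_shift z L lam)) big_map /=.
  apply: eq_big_seq => t; rewrite mem_cfgs => /asboolP[ct _ _].
  by rewrite drc_weight_shift.
rewrite E; congr (_^-1 * _).
have := E (fun=> 1); rewrite (eq_bigr (drc_weight a p q L)); last first.
  by move=> t _; rewrite mulr1.
by move=> ->; apply: eq_bigr => t _; rewrite mulr1.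
Qed.

End translations.

(** * Boundary effects *)

Lemma mul5_regroup (R : comPzRingType) (a1 a2 a3 a4 a5 : R) :
  a1 * (a2 * (a3 * (a4 * a5))) = (a1 * a5) * (a2 * a4 * a3).
Proof.
rewrite -[RHS]mulrA; congr (_ * _).
by rewrite [RHS]mulrC -!mulrA; congr (_ * _); rewrite mulrCA.
Qed.

Lemma count_andN_bounds (T : Type) (a b : pred T) (s : seq T) :
  (count (fun x => a x && ~~ b x) s <= count a s <=
   count (fun x => a x && ~~ b x) s + count b s)%N.
Proof.
by elim: s => [//|x s IH] /=; case: (a x); case: (b x) => /=; lia.
Qed.

Section boundary.
Context {d : nat} (hd : (0 < d)%N).
Implicit Types (L : box d) (s t : config d) (x y : zd d) (e : edge d).

Definition is_boundary L e : bool :=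
  `[< exists2 x, x \in val e & ~ box_vertices L x >].

Definition bvec L : seq (edge d) := [seq e <- evec L | is_boundary L e].

Lemma size_bvec L : size (bvec L) = count (is_boundary L) (evec L).
Proof. exact: size_filter. Qed.

(* The configuration seen inside the box, surrounded by the zero
   configuration. *)
Definition inner L t : config d :=
  (fun x => t.1 x && (x \in vvec L),
   fun e => [&& t.2 e, e \in evec L & ~~ is_boundary L e]).

Lemma inner_vertices L e : ~~ is_boundary L e -> forall x, x \in val e ->
  box_vertices L x.
Proof.
move=> /asboolPn h x xe; have [//|nL] := pselect (box_vertices L x).
by case: h; exists x.
Qed.

Lemma inner_compatible L t : compatible t -> compatible (inner L t).
Proof.
move=> ct e x /and3P[te _ nb] xe /=; apply/andP; split; first exact: ct te xe.
by rewrite mem_vvec; apply/asboolP; exact: inner_vertices xe.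
Qed.

Lemma num_components_close_edges L t u : compatible t ->
  (forall e, t.2 e -> e \in u -> e \in evec L) ->
  (num_components L t <= num_components L (close_edges t u) <=
   num_components L t + size u)%N.
Proof.
move=> ct; elim: u => [|e u IH] sub.
  rewrite (_ : close_edges _ _ = t) /= ?addn0 ?leqnn //.
  by case: (t) => ? ?; congr pair; apply/funext => e; rewrite /= andbT.
have {}IH := IH (fun e' te' h => sub e' te' (mem_behead (s := e :: u) h)).
have sE : size (e :: u) = (size u).+1 by [].
have [te|/negbTE te] := boolP (t.2 e); last first.
  rewrite (_ : close_edges t (e :: u) = close_edges t u).
    by rewrite sE; lia.
  congr pair; apply/funext => e'; rewrite inE.
  by case: eqP => // ->; rewrite te.
have [eu|eu] := boolP (e \in u).
  rewrite (_ : close_edges t (e :: u) = close_edges t u).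
    by rewrite sE; lia.
  congr pair; apply/funext => e'; rewrite inE.
  by case: eqP => // ->; rewrite eu.
have ce : compatible (close_edges t (e :: u)).
  by move=> e' x /andP[te' _] xe; exact: ct te' xe.
have Le : box_edges L e.
  by have := sub e te (mem_head _ _); rewrite mem_evec => /asboolP.
have on : edge_on (close_edges t (e :: u)) e by move=> x; exact: ct.
have := num_components_add_edge ce Le on.
rewrite (_ : add_edge (close_edges t (e :: u)) e = close_edges t u).
  have := leq_b1 (~~ joined (close_edges t (e :: u)) e).
  by rewrite sE; lia.
congr pair; apply/funext => e'; rewrite /upd /= inE.
by case: eqP => // ->; rewrite te.
Qed.

Lemma leq_card_fset_set (T : choiceType) (A B : set T) :
  finite_set B -> A `<=` B -> (#|` fset_set A| <= #|` fset_set B|)%N.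
Proof.
move=> fB AB; have fA := sub_finite_set AB fB.
by apply: fsubset_leq_card; rewrite -fset_set_sub.
Qed.

Lemma edge_two_points e x y z : x \in val e -> y \in val e -> z \in val e ->
  x != y -> x != z -> y = z.
Proof.
have [u [v [_ ->]]] := asboolP _ (valP e).
rewrite !inE => /orP[]/eqP-> /orP[]/eqP-> /orP[]/eqP->//; by rewrite eqxx.
Qed.

Lemma card_outer_closure L :
  (#|` fset_set (box_closure L `\` box_vertices L)| <= size (bvec L))%N.
Proof.
(* [g] sends a boundary edge to its only end outside the box and is onto the outer vertices. The
   default 0 concerns edges without such an end, none of which lies in [bvec]. *)
pose g e := xget 0 [set y | y \in val e /\ ~ box_vertices L y].
rewrite -(size_map g); apply: uniq_leq_size; first exact: fset_uniq.
move=> y; rewrite in_fset_set; last first.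
  by apply: finite_setD; exact: finite_box_closure.
move=> /set_mem[[e [x xe Lx] ye] Ly].
apply/mapP; exists e.
  by rewrite mem_filter mem_evec; apply/andP; split; apply/asboolP;
    [exists y|exists x].
have [|ge Lg] := @xgetI _ 0 [set y | y \in val e /\ ~ box_vertices L y] y.
  by [].
apply: (@edge_two_points e x y _ xe ye ge).
  by apply: contra_notN Ly => /eqP <-.
by apply: contra_notN Lg => /eqP <-.
Qed.

(** With all boundary edges closed, a component that starts in the box stays there and is unchanged
    by [inner]. The other components start at outer vertices, of which there are at most as many as
    boundary edges. *)
Lemma num_components_inner L t : compatible t ->
  (forall e, t.2 e -> e \in evec L -> ~~ is_boundary L e) ->
  (num_components L (inner L t) <= num_components L t <=
   num_components L (inner L t) + size (bvec L))%N.
Proof.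
move=> ct nb; have ci := @inner_compatible L t ct.
have stay u v : box_vertices L u -> component t u v ->
    box_vertices L v /\ component (inner L t) u v.
  move=> Lu [s p <-]; elim: s u Lu p => [|w s IH] u Lu /=.
    by move=> _; split => //; exact: component_refl.
  move=> /andP[/asboolP[e te ve] /IH h].
  have eL : e \in evec L.
    by rewrite mem_evec; apply/asboolP; exists u => //; rewrite ve !inE eqxx.
  have Lw : box_vertices L w.
    by apply: (inner_vertices (nb e te eL)); rewrite ve !inE eqxx orbT.
  have [Lv wv] := h Lw; split => //; apply: component_trans wv.
  apply: component_step; apply/asboolP; exists e => //=.
  by rewrite te eL nb.
have sub e : (inner L t).2 e -> t.2 e by case/and3P.
have same u : box_vertices L u -> component (inner L t) u = component t u.
  move=> Lu; apply/seteqP; split => v; last by move=> /(stay _ _ Lu)[].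
  exact: component_mono.
rewrite !num_componentsE //.
set A0 := component (inner L t) @` _; set A1 := component t @` _.
have fA1 : finite_set A1 by exact/finite_image/finite_on_closure.
have fA0 : finite_set A0 by exact/finite_image/finite_on_closure.
apply/andP; split.
  apply: leq_card_fset_set => // C [x [Lx /= /andP[tx]]].
  rewrite mem_vvec => /asboolP Vx <-; exists x => //; exact/esym/same.
pose B := box_closure L `\` box_vertices L.
have fB : finite_set B by apply: finite_setD; exact: finite_box_closure.
apply: (@leq_trans #|` fset_set (A0 `|` component t @` B)|).
  apply: leq_card_fset_set.
    by rewrite finite_setU; split => //; exact: finite_image.
  move=> C [x [Lx tx] <-]; have [Vx|nVx] := pselect (box_vertices L x).
    left; exists x; last exact: same.
    by split => //=; rewrite tx mem_vvec; exact/asboolP.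
  by right; exists x.
rewrite fset_setU //; last exact: finite_image.
apply: leq_trans (leq_card_fsetU _ _).1 _; rewrite leq_add2l.
rewrite fset_set_image //.
apply: leq_trans (leq_imfset_card _ _ _) _.
exact: card_outer_closure.
Qed.

Lemma inner_close_edges L t :
  inner L (close_edges t (bvec L)) = inner L t.
Proof.
congr pair; apply/funext => e /=; rewrite mem_filter.
by case: (t.2 e); case: (e \in evec L); case: (is_boundary L e).
Qed.

(** Both counts are compared with the configuration in which just the boundary edges are closed: its
    count exceeds each of them by at most the boundary size, so the two errors do not add up. *)
Lemma num_components_inner_bound L t : compatible t ->
  (num_components L t <= num_components L (inner L t) + size (bvec L))%N /\
  (num_components L (inner L t) <= num_components L t + size (bvec L))%N.
Proof.
move=> ct.
have cc : compatible (close_edges t (bvec L)).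
  by move=> e x /andP[te _] xe; exact: ct te xe.
have := @num_components_close_edges L t (bvec L) ct.
have := @num_components_inner L _ cc; rewrite inner_close_edges.
move=> h1 h2.
have /andP[a1 a2] : (num_components L t <=
    num_components L (close_edges t (bvec L)) <=
    num_components L t + size (bvec L))%N.
  by apply: h2 => e _; rewrite mem_filter => /andP[].
have /andP[b1 b2] : (num_components L (inner L t) <=
    num_components L (close_edges t (bvec L)) <=
    num_components L (inner L t) + size (bvec L))%N.
  apply: h1 => e /andP[_]; rewrite mem_filter negb_and => /orP[//|/negP h] eL.
  by case: h.
by split; lia.
Qed.

Lemma count_available_inner L t : compatible t ->
  (count (available (inner L t).1) (evec L) <= count (available t.1) (evec L) <=
   count (available (inner L t).1) (evec L) + size (bvec L))%N.
Proof.
move=> ct; rewrite size_bvec.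
have avE e : e \in evec L -> available (inner L t).1 e =
    available t.1 e && ~~ is_boundary L e.
  move=> _; apply/asboolP/andP => [h|[/asboolP h nb] x xe].
    split; first by apply/asboolP => x /h /andP[].
    apply/asboolPn => -[x xe Lx]; have /andP[_] := h x xe.
    by rewrite mem_vvec => /asboolP.
  by rewrite /= h // mem_vvec; apply/asboolP; exact: inner_vertices xe.
by rewrite (eq_in_count avE); exact: count_andN_bounds.
Qed.

Lemma count_open_inner L t :
  (count ((inner L t).2 : edge d -> bool) (evec L) <=
   count (t.2 : edge d -> bool) (evec L) <=
   count ((inner L t).2 : edge d -> bool) (evec L) + size (bvec L))%N.
Proof.
rewrite size_bvec.
have opE e : e \in evec L -> (inner L t).2 e = t.2 e && ~~ is_boundary L e.
  by move=> /= ->.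
by rewrite (eq_in_count opE); exact: count_andN_bounds.
Qed.

Lemma count_vertices_inner L t :
  count ((inner L t).1 : zd d -> bool) (vvec L) =
  count (t.1 : zd d -> bool) (vvec L).
Proof. by apply: eq_in_count => x xL /=; rewrite xL andbT. Qed.

Context {R : realType} (q : R) (hq : 1 <= q <= 2).

Let q1 : 1 <= q. Proof. by case/andP: hq. Qed.
Let q0 : 0 < q. Proof. exact: lt_le_trans q1. Qed.

(** The base [c] dominates both [u] and 1, which covers odds below and above 1; this is the origin
    of [1 + odds p] in the boundary constants. *)
Lemma exprD_le (u c : R) (m n k : nat) : 0 <= u -> u <= c -> 1 <= c ->
  (n <= m <= n + k)%N -> u ^+ m <= u ^+ n * c ^+ k.
Proof.
move=> u0 uc c1 /andP[nm mnk]; rewrite -(subnKC nm) exprD.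
apply: ler_wpM2l; first exact: exprn_ge0.
apply: (@le_trans _ _ (c ^+ (m - n))).
  by apply: lerXn2r; rewrite ?nnegrE // (le_trans u0).
by apply: ler_weXn2l => //; lia.
Qed.

Lemma drc_weight_unfold (a p : R) L t : compatible t ->
  drc_weight a p q L t =
  odds a ^+ count (t.1 : zd d -> bool) (vvec L) *
  (root1 p ^+ count (available t.1) (evec L) *
   (q ^+ num_components L t *
    odds p ^+ count (t.2 : edge d -> bool) (evec L))).
Proof.
move=> ct; rewrite drc_weightE // /rcw asboolT ?mulr1n ?mul1r.
  by rewrite (_ : ((t.1, t.2) : config d) = t) //; case: (t).
by apply/compatibleP; case: (t) ct.
Qed.

Lemma drc_weight_inner_le (a p : R) L t : 0 < a < 1 -> 0 < p < 1 ->
  compatible t ->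
  drc_weight a p q L t <=
  drc_weight a p q L (inner L t) * (q * (1 + odds p)) ^+ size (bvec L).
Proof.
move=> ha hp ct.
have [k1 _] := num_components_inner_bound L ct.
have A := count_available_inner L ct; have O := count_open_inner L t.
rewrite !drc_weight_unfold //; last exact: inner_compatible.
have o0 := odds_gt0 ha; have p0 := odds_gt0 hp; have r0 := root1_gt0 hp.
rewrite count_vertices_inner -!mulrA; apply: ler_wpM2l.
  exact/exprn_ge0/ltW.
apply: ler_pM.
- exact/exprn_ge0/ltW.
- by apply: mulr_ge0; exact/exprn_ge0/ltW.
- apply: ler_wiXn2l; [exact: ltW|exact: root1_le1|by case/andP: A].
rewrite (exprMn _ q) [X in _ <= _ * X]mulrCA [leRHS]mulrA.
apply: ler_pM.
- exact/exprn_ge0/ltW.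
- exact/exprn_ge0/ltW.
- by rewrite -exprD; apply: ler_weXn2l.
- by apply: exprD_le => //; [exact: ltW|rewrite lerDr|rewrite lerDl ltW].
Qed.

Lemma drc_weight_inner_ge (a p : R) L t : 0 < a < 1 -> 0 < p < 1 ->
  compatible t -> (forall e, t.2 e -> e \in evec L -> ~~ is_boundary L e) ->
  drc_weight a p q L (inner L t) <=
  drc_weight a p q L t * (q / root1 p) ^+ size (bvec L).
Proof.
move=> ha hp ct nb.
have [_ k1] := num_components_inner_bound L ct.
have /andP[A1 A2] := count_available_inner L ct.
rewrite !drc_weight_unfold //; last exact: inner_compatible.
have o0 := odds_gt0 ha; have p0 := odds_gt0 hp; have r0 := root1_gt0 hp.
have -> : count ((inner L t).2 : edge d -> bool) (evec L) =
    count (t.2 : edge d -> bool) (evec L).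
  by apply: eq_in_count => e eL /=; case E : (t.2 e) => //=; rewrite eL nb.
rewrite count_vertices_inner -!mulrA; apply: ler_wpM2l.
  exact/exprn_ge0/ltW.
rewrite (exprMn _ q).
set r := root1 p; set n := size (bvec L).
have rr : r ^+ count (available (inner L t).1) (evec L) <=
    r ^+ count (available t.1) (evec L) * r^-1 ^+ n.
  rewrite exprVn ler_pdivlMr ?exprn_gt0 // -exprD.
  by apply: ler_wiXn2l; [exact: ltW|exact: root1_le1|].
have qq : q ^+ num_components L (inner L t) <= q ^+ num_components L t * q ^+ n.
  by rewrite -exprD; apply: ler_weXn2l.
set u := r ^+ count (available t.1) _ in rr *.
set v := q ^+ num_components L t in qq *.
set w := odds p ^+ _.
rewrite mul5_regroup; apply: ler_pM => //.
- exact/exprn_ge0/ltW.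
- by apply: mulr_ge0; exact/exprn_ge0/ltW.
- by apply: ler_wpM2r => //; exact/exprn_ge0/ltW.
Qed.

Lemma size_configs (K : choiceType) (u : seq K) c :
  size (configs u c) = (2 ^ size u)%N.
Proof. by elim: u c => [//|x u IH] c /=; rewrite size_cat !IH expnS; lia. Qed.

Lemma ler_sum_sub (T : eqType) (s1 s2 : seq T) (F : T -> R) :
  uniq s1 -> uniq s2 -> {subset s1 <= s2} -> (forall k, k \in s2 -> 0 <= F k) ->
  \sum_(k <- s1) F k <= \sum_(k <- s2) F k.
Proof.
move=> u1 u2 sub F0; rewrite [leRHS](bigID (mem s1)) /=.
have -> : \sum_(k <- s2 | k \in s1) F k = \sum_(k <- s1) F k.
  rewrite -big_filter; apply: perm_big; apply: uniq_perm => //.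
    exact: filter_uniq.
  by move=> k; rewrite mem_filter; case E : (k \in s1) => //=; rewrite sub.
rewrite lerDl big_seq_cond; apply: sumr_ge0 => k /andP[/F0//].
Qed.

Lemma inner_cfgs L t : t \in cfgs L ones -> inner L t \in cfgs L zeros.
Proof.
rewrite !mem_cfgs => /asboolP[ct _ _]; apply/asboolP; split.
- exact: inner_compatible.
- by move=> x Lx /=; rewrite mem_vvec asboolF ?andbF.
- by move=> e Le /=; rewrite mem_evec asboolF //= andbF.
Qed.

(** A configuration surrounded by ones is recovered from its [inner] part and the states of the
    boundary edges, so each inner part occurs at most 2^b times, b being the number of boundary
    edges. The other factors of the constant bound the change of weight. *)
Lemma partition_ones_le (a p : R) L : 0 < a < 1 -> 0 < p < 1 ->
  drc_partition a p q L ones <=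
  drc_partition a p q L zeros * (2 * q * (1 + odds p)) ^+ size (bvec L).
Proof.
move=> ha hp; rewrite /drc_partition !sum_cfgs.
set n := size _; set K := q * (1 + odds p).
have K0 : 0 < K by rewrite mulr_gt0 // addr_gt0 ?odds_gt0.
pose F t := drc_weight a p q L t * K ^+ n.
apply: (@le_trans _ _ (\sum_(t <- cfgs L ones) F (inner L t))).
  rewrite big_seq [leRHS]big_seq; apply: ler_sum => t.
  by rewrite mem_cfgs => /asboolP[ct _ _]; exact: drc_weight_inner_le.
pose j t : config d * (edge d -> bool) :=
  (inner L t, fun e => t.2 e && (e \in bvec L)).
pose G (u : config d * (edge d -> bool)) := F u.1.
rewrite (_ : \sum_(t <- _) _ = \sum_(u <- map j (cfgs L ones)) G u); last first.
  by rewrite big_map.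
apply: (@le_trans _ _ (\sum_(u <- [seq (s, o) | s <- cfgs L zeros,
    o <- configs (bvec L) (fun=> false)]) G u)).
  apply: ler_sum_sub.
  - rewrite map_inj_in_uniq ?uniq_cfgs // => t t'.
    rewrite !mem_cfgs => /asboolP[_ t1 t2] /asboolP[_ t1' t2'] [E1 E2 E3].
    rewrite [t]surjective_pairing [t']surjective_pairing; congr pair.
      apply/funext => x; have [xL|xL] := boolP (x \in vvec L).
        by have := congr1 (@^~ x) E1; rewrite /= xL !andbT.
      by rewrite t1 ?t1' // => Lx; move: xL; rewrite mem_vvec asboolT.
    apply/funext => e; have [eL|eL] := boolP (e \in evec L); last first.
      by rewrite t2 ?t2' // => Le; move: eL; rewrite mem_evec asboolT.
    have [be|be] := boolP (is_boundary L e).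
      by have := congr1 (@^~ e) E3; rewrite /= mem_filter be eL !andbT.
    by have := congr1 (@^~ e) E2; rewrite /= be eL !andbT.
  - apply: allpairs_uniq; rewrite ?uniq_cfgs //; last by case=> ? ? [].
    by apply: uniq_configs; apply: filter_uniq; exact: uniq_evec.
  - move=> u /mapP[t tC ->]; apply/allpairsP.
    exists (j t) => /=; split => //; first exact: inner_cfgs.
    by apply/mem_configs => e /negbTE eb /=; rewrite eb andbF.
  - move=> u _; rewrite /G /F mulr_ge0 ?exprn_ge0 ?ltW //.
    exact: drc_weight_gt0.
rewrite big_allpairs /= mulr_suml; apply: ler_sum => s _.
rewrite /G /F /= big_const_seq count_predT size_configs iter_addr_0.
rewrite -mulrnAr ler_wpM2l //; first by apply/ltW/drc_weight_gt0.
by rewrite -/n -(mulrA 2) -/K (exprMn _ 2) -natrX mulr_natl.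
Qed.

(** Replacing the zeros outside by ones is injective, with [inner] as inverse. Boundary edges remain
    closed, as their outer ends were vacant, so only the counts of components and of available edges
    change. *)
Lemma partition_zeros_le (a p : R) L : 0 < a < 1 -> 0 < p < 1 ->
  drc_partition a p q L zeros <=
  drc_partition a p q L ones * (q / root1 p) ^+ size (bvec L).
Proof.
move=> ha hp; rewrite /drc_partition !sum_cfgs mulr_suml.
pose j s : config d :=
  (fun x => s.1 x || (x \notin vvec L), fun e => s.2 e || (e \notin evec L)).
have jC s : s \in cfgs L zeros -> [/\ j s \in cfgs L ones, inner L (j s) = s &
    forall e, (j s).2 e -> e \in evec L -> ~~ is_boundary L e].
  rewrite !mem_cfgs => /asboolP[cs s1 s2].
  have nb e : s.2 e -> ~~ is_boundary L e.
    move=> se; apply/asboolPn => -[x xe Lx].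
    by have := cs e x se xe; rewrite s1.
  have cj : compatible (j s).
    move=> e x /orP[se|eL] xe /=; first by rewrite (cs e x).
    apply/orP; right; apply: contra eL; rewrite mem_vvec mem_evec.
    by move=> /asboolP Lx; apply/asboolP; exists x.
  split.
  - apply/asboolP; split => // [x Lx|e Le] /=.
      by rewrite mem_vvec asboolF ?orbT.
    by rewrite mem_evec asboolF ?orbT.
  - rewrite [RHS]surjective_pairing; congr pair.
      apply/funext => x /=; have [xL|xL] := boolP (x \in vvec L).
        by rewrite andbT orbF.
      by rewrite andbF s1 // => Lx; move: xL; rewrite mem_vvec asboolT.
    apply/funext => e /=; have [eL|eL] := boolP (e \in evec L).
      by rewrite orbF /=; case E : (s.2 e) => //=; rewrite nb.
    by rewrite andbF s2 // => Le; move: eL; rewrite mem_evec asboolT.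
  - by move=> e /= /orP[/nb//|/negbTE ->].
apply: (@le_trans _ _ (\sum_(s <- cfgs L zeros)
    drc_weight a p q L (j s) * (q / root1 p) ^+ size (bvec L))).
  rewrite big_seq [leRHS]big_seq; apply: ler_sum => s sC.
  have [jsC js nb] := jC s sC.
  rewrite -{1}js; apply: drc_weight_inner_ge => //.
  by move: jsC; rewrite mem_cfgs => /asboolP[].
rewrite -(big_map j xpredT (fun t => drc_weight a p q L t * _)).
apply: ler_sum_sub; rewrite ?uniq_cfgs //.
- rewrite map_inj_in_uniq ?uniq_cfgs // => s s' /jC[_ E _] /jC[_ E' _] ss'.
  by rewrite -E -E' ss'.
- by move=> t /mapP[s /jC[sC _ _] ->].
- move=> t _; apply: mulr_ge0; first by apply/ltW/drc_weight_gt0.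
  by apply/exprn_ge0/divr_ge0; [exact: ltW|exact/ltW/root1_gt0].
Qed.

End boundary.

(** * Geometry of cubes *)

Section lattice_geometry.
Context {d : nat}.
Implicit Types (L : box d) (t : config d) (x y z : zd d) (e : edge d).

Definition neighbour x (ib : 'I_d * bool) : zd d :=
  if ib.2 then x + unit_vec ib.1 else x - unit_vec ib.1.

Lemma l1_dist1 x y : l1_dist x y = 1 -> exists ib, y = neighbour x ib.
Proof.
rewrite /l1_dist => h.
have [i xyi] : exists i, x i != y i.
  apply: contrapT => /forallNP no.
  move: h; rewrite big1 // => i _; have /negP := no i.
  by rewrite negbK => /eqP ->; rewrite subrr normr0.
move: h; rewrite (bigD1 i) //=; set S := \sum_(_ < _ | _) _ => h.
have S0 : 0 <= S by apply: sumr_ge0 => j _.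
have ni : `|x i - y i| = 1 by move: xyi => /eqP; lia.
have {}S0 : S = 0 by lia.
have off j : j != i -> y j = x j.
  move=> ji; have : `|x j - y j| = 0.
    by apply: (psumr_eq0P _ S0) => // k _; exact: normr_ge0.
  by lia.
exists (i, x i < y i); rewrite /neighbour /=; apply/ffunP => j.
case: ifPn => xy; rewrite !ffunE; have [<-|ij] := eqVneq i j => /=.
- by move: ni xy; move: (x i) (y i) => u v; lia.
- by rewrite addr0 off // eq_sym.
- by move: ni xy; rewrite -leNgt; move: (x i) (y i) => u v; lia.
- by rewrite oppr0 addr0 off // eq_sym.
Qed.

Lemma edge_neighbour e x : x \in val e ->
  exists ib, val e = [fset x; neighbour x ib]%fset.
Proof.
have [u [v [uv ve]]] := asboolP _ (valP e).
rewrite ve !inE => /orP[]/eqP ->.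
  by have [ib ->] := l1_dist1 uv; exists ib.
have [|ib ->] := @l1_dist1 v u; last by exists ib; rewrite fsetUC.
by rewrite -uv /l1_dist; apply: eq_bigr => i _; rewrite distrC.
Qed.

Lemma size_edge e : (size (enum_fset (val e)) <= 2)%N.
Proof.
have [u [v [_ ->]]] := asboolP _ (valP e).
by rewrite -[size _]/(#|` [fset u; v]%fset|) cardfs2; case: eqP.
Qed.

Lemma mem_neighbours (ib : 'I_d * bool) :
  ib \in [seq (i, b) | i <- enum 'I_d, b <- [:: true; false]].
Proof.
apply/allpairsP; exists ib; case: ib => i b; split; rewrite ?mem_enum //.
by case: b; rewrite !inE.
Qed.

Lemma size_neighbours :
  size [seq (i, b) | i <- enum 'I_d, b <- [:: true; false]] = d.*2.
Proof. by rewrite size_allpairs size_enum_ord muln2. Qed.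

Lemma degree_le L x :
  (count (fun e : edge d => x \in val e) (evec L) <= d.*2)%N.
Proof.
rewrite -size_filter -(size_map (fun e : edge d => val e)) -size_neighbours.
rewrite -(size_map (fun ib => [fset x; neighbour x ib]%fset)).
apply: uniq_leq_size.
  by rewrite (map_inj_uniq val_inj) filter_uniq // uniq_evec.
move=> E /mapP[e]; rewrite mem_filter => /andP[xe _] ->.
have [ib ->] := edge_neighbour xe.
by apply/mapP; exists ib => //; exact: mem_neighbours.
Qed.

(** Each lattice edge is [edge_at x i] for exactly one pair, so this lists d edges per vertex and
    makes the edge count a sum of translates of one local function. *)
Definition positive_edges L : seq (edge d) :=
  [seq edge_at x i | x <- vvec L, i <- enum 'I_d].

Lemma unit_vec_inj : injective (@unit_vec d).
Proof.
move=> i j /ffunP/(_ i); rewrite !ffunE eqxx.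
by case: (eqVneq j i) => // ->.
Qed.

Lemma edge_at_inj x y (i j : 'I_d) : edge_at x i = edge_at y j ->
  x = y /\ i = j.
Proof.
move=> /(congr1 val) /= E.
have yx : y \in [fset x; (x + unit_vec i)%R]%fset by rewrite E !inE eqxx.
have xy : x \in [fset y; (y + unit_vec j)%R]%fset by rewrite -E !inE eqxx.
have xyE : x = y.
  move: yx xy; rewrite !inE => /orP[/eqP->//|/eqP yE] /orP[/eqP//|/eqP xE].
  have /ffunP/(_ i) := xE; rewrite yE !ffunE eqxx /=.
  by case: (j == i) => /=; lia.
split=> //; subst y.
have : (x + unit_vec i)%R \in [fset x; (x + unit_vec j)%R]%fset.
  by rewrite -E !inE eqxx orbT.
rewrite !inE => /orP[/eqP/ffunP/(_ i)|/eqP/addrI/unit_vec_inj//].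
by rewrite !ffunE eqxx /=; lia.
Qed.

Lemma uniq_positive_edges L : uniq (positive_edges L).
Proof.
apply: allpairs_uniq; rewrite ?uniq_vvec ?enum_uniq //.
by move=> [x i] [y j] _ _ /= /edge_at_inj [-> ->].
Qed.

Lemma positive_edges_sub L : {subset positive_edges L <= evec L}.
Proof.
move=> e /allpairsP[[x i] /= [xL _ ->]]; rewrite mem_evec; apply/asboolP.
exists x; first by rewrite /= !inE eqxx.
by move: xL; rewrite mem_vvec => /asboolP.
Qed.

Lemma interior_positive_edge L e : e \in evec L -> ~~ is_boundary L e ->
  e \in positive_edges L.
Proof.
move=> eL nb; have [u [v [uv ve]]] := asboolP _ (valP e).
have inL x : x \in val e -> x \in vvec L.
  by move=> xe; rewrite mem_vvec; apply/asboolP; exact: inner_vertices xe.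
have [[i b] vE] := l1_dist1 uv; apply/allpairsP.
case: b vE; rewrite /neighbour /= => vE.
  exists (u, i); split; rewrite ?mem_enum //=.
    by apply: inL; rewrite ve !inE eqxx.
  by apply/val_inj; rewrite /= ve vE.
exists (v, i); split; rewrite ?mem_enum //=.
  by apply: inL; rewrite ve !inE eqxx orbT.
by apply/val_inj; rewrite /= ve vE subrK fsetUC.
Qed.

Lemma count_sub_seq (K : eqType) (s1 s2 : seq K) (c : pred K) : uniq s1 ->
  (forall k, k \in s1 -> c k -> k \in s2) -> (count c s1 <= count c s2)%N.
Proof.
move=> u1 sub; rewrite -!size_filter; apply: uniq_leq_size.
  exact: filter_uniq.
by move=> x; rewrite !mem_filter => /andP[cx xs]; rewrite cx sub.
Qed.

Lemma cube_le n (i : 'I_d) :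
  ([ffun => - n%:Z] : zd d) i <= ([ffun => n%:Z] : zd d) i.
Proof. by rewrite !ffunE; lia. Qed.

Definition cube (n : nat) : box d := Box (cube_le n).

Lemma cubeP n x : box_vertices (cube n) x <-> forall i, - n%:Z <= x i <= n%:Z.
Proof. by split=> h i; have := h i; rewrite /= !ffunE. Qed.

Lemma cube_mono m n : (m <= n)%N -> box_vertices (cube m) `<=` box_vertices (cube n).
Proof. by move=> mn x /cubeP h; apply/cubeP => i; have := h i; lia. Qed.

Lemma in_cube x : exists n, box_vertices (cube n) x.
Proof.
exists (\max_i `|x i|)%N; apply/cubeP => i.
have := @leq_bigmax _ (fun i => `|x i|%N) i.
by rewrite -lez_nat abszE ler_norml.
Qed.

Lemma cube_shift m n x : box_vertices (cube m) x ->
  box_vertices (shift_box x (cube n)) `<=` box_vertices (cube (m + n)).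
Proof.
move=> /cubeP xm y /box_vertices_shift/cubeP h; apply/cubeP => i.
have := xm i; have := h i.
by rewrite (_ : (y - x) i = y i - x i) ?ffunE //; move: (x i) (y i) => u v; lia.
Qed.

Lemma box_sub_cube L : exists n, box_vertices L `<=` box_vertices (cube n).
Proof.
have [m hm] := in_cube (box_lo L); have [n hn] := in_cube (box_hi L).
exists (m + n)%N => x Lx; apply/cubeP => i.
by have := Lx i; move/cubeP: hm => /(_ i); move/cubeP: hn => /(_ i); lia.
Qed.

(* A boundary edge of the cube leaves through a face, and the 2n+1 lattice
   points of the line that contains it lie in the cube. *)
Lemma cube_boundary n :
  (size (bvec (cube n)) * (n.*2.+1) <= d.*2 * size (vvec (cube n)))%N.
Proof.
pose base (ib : 'I_d * bool) x : zd d :=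
  [ffun k => if k == ib.1 then (if ib.2 then n%:Z else - n%:Z) else x k].
(* [base] projects a vertex onto the face in the direction [ib]; the second component of [g] is the
   position along that line, from 0 to 2n. Every pair of a boundary edge and a position is thus hit
   by one of 2d directions and a vertex of the cube. *)
pose g (u : ('I_d * bool) * zd d) : {fset zd d} * nat :=
  ([fset base u.1 u.2; neighbour (base u.1 u.2) u.1]%fset,
   absz (u.2 u.1.1 + n%:Z)).
pose s1 := [seq (val e, j) | e <- bvec (cube n), j <- iota 0 (n.*2.+1)].
pose s2 := [seq g u | u <- [seq (ib, x) |
  ib <- [seq (i, b) | i <- enum 'I_d, b <- [:: true; false]],
  x <- vvec (cube n)]].
have : (size s1 <= size s2)%N; last first.
  by rewrite size_map !size_allpairs size_iota size_enum_ord /= muln2.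
apply: uniq_leq_size.
  apply: allpairs_uniq; rewrite ?iota_uniq ?filter_uniq ?uniq_evec //.
  by move=> [e j] [e' j'] _ _ /= [/val_inj -> ->].
move=> [E j] /allpairsP[[e j'] /= [eb jn [-> ->]]] {E j}.
move: eb; rewrite mem_filter mem_evec => /andP[/asboolP[y ye Ly] /asboolP[x xe Lx]].
have [[i b] veE] := edge_neighbour xe.
have yE : y = neighbour x (i, b).
  move: ye; rewrite veE !inE => /orP[/eqP yx|/eqP//].
  by exfalso; apply: Ly; rewrite yx.
have yi : ~ (- n%:Z <= y i <= n%:Z).
  move=> h; apply: Ly; apply/cubeP => k; have [-> //|ki] := eqVneq k i.
  move/cubeP: Lx => /(_ k); rewrite yE /neighbour /=.
  by case: (b); rewrite !ffunE eq_sym (negbTE ki) ?subr0 ?addr0 ?oppr0 ?addr0.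
have xi : x i = if b then n%:Z else - n%:Z.
  move/cubeP: Lx => /(_ i); move: yi; rewrite yE /neighbour /=.
  by case: (b); rewrite !ffunE eqxx /=; lia.
pose x' : zd d := [ffun k => if k == i then j'%:Z - n%:Z else x k].
have bx : base (i, b) x' = x.
  apply/ffunP => k; rewrite !ffunE /=; have [->|//] := eqVneq k i.
  by rewrite xi.
apply/mapP; exists ((i, b), x').
  apply/allpairsP; exists ((i, b), x'); split => //=.
    exact: mem_neighbours.
  rewrite mem_vvec; apply/asboolP/cubeP => k; rewrite !ffunE.
  have [_|ki] := eqVneq k i; last by move/cubeP: Lx; exact.
  have {}jn : j' \in iota 0 n.*2.+1 by exact: jn.
  by move: jn; rewrite mem_iota; lia.
rewrite /g /= bx veE; congr pair.
by rewrite !ffunE eqxx subrK.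
Qed.

Lemma vvec_cube_gt0 n : (0 < size (vvec (cube n)))%N.
Proof.
rewrite -has_predT; apply/hasP; exists 0 => //.
by rewrite mem_vvec; apply/asboolP/cubeP => i; rewrite !ffunE; lia.
Qed.

End lattice_geometry.

(** * Comparing parameters through Jensen's inequality *)

Lemma sum_of_bool (R : pzSemiRingType) (T : Type) (c : T -> bool) (s : seq T) :
  \sum_(x <- s) (c x)%:R = (count c s)%:R :> R.
Proof.
elim: s => [|x s IH]; first by rewrite big_nil.
by rewrite big_cons IH /= natrD.
Qed.

Lemma le0_archimedean (R : realType) (x c : R) :
  (forall n, x * (n.*2.+1)%:R <= c) -> x <= 0.
Proof.
move=> h; rewrite leNgt; apply/negP => x0.
have c0 : 0 <= c by apply: le_trans (h 0%N); rewrite mulr_ge0 // ltW.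
have [n cn] : exists n : nat, c / x < n%:R.
  exists (Num.truncn (c / x)).+1; exact: truncnS_gt.
have := h n; rewrite leNgt mulrC -ltr_pdivrMr // => /negP; apply.
by apply: lt_le_trans cn _; rewrite ler_nat; lia.
Qed.

(** Pigeonhole on a grid of N steps with N e > 1: if every increment exceeded e, then [G] would rise
    by more than 1. *)
Lemma exists_small_increment (R : realType) (G : R -> R) (a b e : R) :
  a < b -> 0 < e -> (forall x, a <= x <= b -> 0 <= G x <= 1) ->
  exists x y, [/\ a <= x, x < y, y <= b & G y - G x <= e].
Proof.
move=> ab e0 G01.
pose N := (Num.truncn e^-1).+1.
have N0 : 0 < N%:R :> R by rewrite ltr0n.
have eN : 1 < N%:R * e by rewrite -ltr_pdivrMr // div1r; exact: truncnS_gt.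
pose x (j : nat) := a + (b - a) / N%:R * j%:R.
have h0 : 0 < (b - a) / N%:R by rewrite divr_gt0 // subr_gt0.
have xab j : (j <= N)%N -> a <= x j <= b.
  move=> jN; rewrite /x lerDl mulr_ge0 ?ler0n ?(ltW h0) //=.
  rewrite -lerBrDl -[leRHS](divfK (lt0r_neq0 N0)).
  by rewrite ler_wpM2l ?ler_nat // ltW.
apply: contrapT => no.
have inc j : (j <= N)%N -> G (x 0%N) + j%:R * e <= G (x j).
  elim: j => [|j IH] jN; first by rewrite mul0r addr0.
  have /IH {}IH := ltnW jN.
  have : e < G (x j.+1) - G (x j).
    rewrite ltNge; apply/negP => le; apply: no; exists (x j), (x j.+1).
    have /andP[xa _] := xab j (ltnW jN); have /andP[_ xb] := xab j.+1 jN.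
    by split => //; rewrite /x ltrD2l ltr_pM2l // ltr_nat.
  by rewrite -natr1 mulrDl mul1r; lra.
have := inc N (leqnn _).
have /andP[g0 _] := G01 _ (xab 0%N (leq0n _)).
have /andP[_ g1] := G01 _ (xab N (leqnn _)).
by lra.
Qed.

Lemma mul7_regroup (R : realType) (u1 u2 u3 u4 e1 e2 e3 : R) :
  u1 * e1 * (u2 * e3 * (u3 * (u4 * e2))) =
  u1 * (u2 * (u3 * u4)) * (e1 * e2 * e3).
Proof. by lra. Qed.

Section tilting.
Context {R : realType} {d : nat} (hd : (0 < d)%N) (q : R) (hq : 1 <= q <= 2).
Implicit Types (a p : R) (L : box d) (t : config d) (f : config d -> R).

Definition num_vertices L t : R := (count (t.1 : zd d -> bool) (vvec L))%:R.
Definition num_open L t : R := (count (t.2 : edge d -> bool) (evec L))%:R.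
Definition num_available L t : R := (count (available t.1) (evec L))%:R.

(** The logarithm of the ratio of the weights at (a', p') and (a, p); the powers of q cancel. *)
Definition energy a a' p p' L t : R :=
  ln (odds a' / odds a) * num_vertices L t +
  ln (odds p' / odds p) * num_open L t +
  ln (root1 p' / root1 p) * num_available L t.

Lemma expr_tilt (x y : R) n : 0 < x -> 0 < y ->
  y ^+ n = x ^+ n * expR (ln (y / x) * n%:R).
Proof.
move=> x0 y0; rewrite expRM_natr lnK ?posrE ?divr_gt0 //.
by rewrite expr_div_n mulrC divfK // expf_neq0 // gt_eqF.
Qed.

Lemma drc_weight_tilt a a' p p' L t : 0 < a < 1 -> 0 < a' < 1 ->
  0 < p < 1 -> 0 < p' < 1 -> compatible t ->
  drc_weight a' p' q L t =
  drc_weight a p q L t * expR (energy a a' p p' L t).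
Proof.
move=> ha ha' hp hp' ct; rewrite !drc_weight_unfold // /energy !expRD.
rewrite (expr_tilt _ (odds_gt0 ha) (odds_gt0 ha')).
rewrite (expr_tilt _ (odds_gt0 hp) (odds_gt0 hp')).
rewrite (expr_tilt _ (root1_gt0 hp) (root1_gt0 hp')).
rewrite /num_vertices /num_open /num_available.
exact: mul7_regroup.
Qed.

(** The exponential is bounded below by its tangent at the mean m: e^f >= e^m (1 + f - m). *)
Lemma jensen a p L lam f : 0 < a < 1 -> 0 < p < 1 -> compatible lam ->
  drc_partition a p q L lam * expR (drc_mean q a p L lam f) <=
  \sum_(t <- cfgs L lam) drc_weight a p q L t * expR (f t).
Proof.
move=> ha hp cl; set m := drc_mean _ _ _ _ _ _.
have Z0 := sum_cfgs_gt0 hq L ha hp cl.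
rewrite /drc_partition sum_cfgs.
have : drc_mean q a p L lam (fun t => expR m + expR m * (f t - m)) <=
    drc_mean q a p L lam (fun t => expR (f t)).
  apply: le_drc_mean => // t _.
  have -> : expR (f t) = expR m * expR (f t - m) by rewrite -expRD addrC subrK.
  rewrite -[X in X + _]mulr1 -mulrDr.
  by rewrite ler_wpM2l ?expR_ge0 // expR_ge1Dx.
rewrite drc_meanD drc_mean_cst // drc_meanZ drc_meanD drc_mean_cst // subrr.
by rewrite mulr0 addr0 drc_meanE ler_pdivlMl.
Qed.

Lemma energy_opp a a' p p' L t : 0 < a < 1 -> 0 < a' < 1 -> 0 < p < 1 ->
  0 < p' < 1 -> energy a' a p' p L t = - energy a a' p p' L t.
Proof.
move=> ha ha' hp hp'; rewrite /energy !opprD -!mulNr.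
have E (x y : R) : 0 < x -> 0 < y -> ln (x / y) = - ln (y / x).
  by move=> x0 y0; rewrite -lnV ?posrE ?divr_gt0 // invf_div.
by rewrite (E _ _ (odds_gt0 ha) (odds_gt0 ha')) (E _ _ (odds_gt0 hp) (odds_gt0 hp'))
  (E _ _ (root1_gt0 hp) (root1_gt0 hp')).
Qed.

Lemma partition_tilt a a' p p' L lam : 0 < a < 1 -> 0 < a' < 1 ->
  0 < p < 1 -> 0 < p' < 1 -> compatible lam ->
  drc_partition a p q L lam *
    expR (drc_mean q a p L lam (energy a a' p p' L)) <=
  drc_partition a' p' q L lam.
Proof.
move=> ha ha' hp hp' cl; apply: le_trans (jensen _ _ ha hp cl) _.
rewrite /drc_partition [leRHS]sum_cfgs big_seq [leRHS]big_seq.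
apply: ler_sum => t; rewrite mem_cfgs => /asboolP[ct _ _].
by rewrite -drc_weight_tilt.
Qed.

(** The logarithm of the product of the constants in [partition_ones_le] at p' and
    [partition_zeros_le] at p. *)
Definition surface_cost p p' : R :=
  ln (2 * q * (1 + odds p') * (q / root1 p)).

(* The two partition functions with boundary conditions 0 and 1 differ by a
   factor exponential in the boundary, and each grows at least as fast as
   Jensen's inequality says, forwards for 1 and backwards for 0. *)
Lemma energy_gap a a' p p' L : 0 < a < 1 -> 0 < a' < 1 ->
  0 < p < 1 -> 0 < p' < 1 ->
  drc_mean q a p L ones (energy a a' p p' L) -
  drc_mean q a' p' L zeros (energy a a' p p' L) <=
  surface_cost p p' * (size (bvec L))%:R.
Proof.
move=> ha ha' hp hp'; set m1 := drc_mean _ _ _ _ _ _.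
set m0 := drc_mean _ _ _ _ _ _; set n := size _.
have q0 : 0 < q by case/andP: hq => h _; exact: lt_le_trans h.
set A := 2 * q * (1 + odds p'); set B := q / root1 p.
have A0 : 0 < A by rewrite !mulr_gt0 // addr_gt0 ?odds_gt0.
have B0 : 0 < B by rewrite divr_gt0 ?root1_gt0.
have h1 : drc_partition a p q L ones * expR m1 <= drc_partition a' p' q L ones.
  exact: partition_tilt.
have h2 : drc_partition a' p' q L zeros * expR (- m0) <=
    drc_partition a p q L zeros.
  have -> : - m0 = drc_mean q a' p' L zeros (energy a' a p' p L).
    rewrite /m0 -mulN1r -drc_meanZ; apply: eq_drc_mean => t _.
    by rewrite mulN1r [RHS]energy_opp.
  exact: partition_tilt.
have h3 : drc_partition a' p' q L ones <=
    drc_partition a' p' q L zeros * A ^+ n by exact: partition_ones_le.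
have h4 : drc_partition a p q L zeros <=
    drc_partition a p q L ones * B ^+ n by exact: partition_zeros_le.
have Z0 : 0 < drc_partition a p q L ones by exact: drc_partition_gt0.
have An : 0 < A ^+ n by exact: exprn_gt0.
have AB0 : 0 < A * B by exact: mulr_gt0.
rewrite /surface_cost -/A -/B -ler_expR expRM_natr lnK ?posrE //.
rewrite exprMn expRD -(ler_pM2l Z0).
have e0 := expR_gt0 (- m0).
rewrite mulrA; apply: (@le_trans _ _ (drc_partition a' p' q L zeros * A ^+ n *
    expR (- m0))).
  by rewrite ler_pM2r // (le_trans h1 h3).
rewrite mulrAC [leRHS]mulrCA [leRHS]mulrC ler_pM2r //.
exact: le_trans h2 h4.
Qed.

Lemma ln_ratio_gt0 (x y : R) : 0 < x -> x < y -> 0 < ln (y / x).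
Proof. by move=> x0 xy; rewrite ln_gt0 // ltr_pdivlMr // mul1r. Qed.

Lemma vertex_gap a a' p L : 0 < a < 1 -> 0 < a' < 1 -> 0 < p < 1 -> a < a' ->
  drc_mean q a p L ones (num_vertices L) -
  drc_mean q a' p L zeros (num_vertices L) <=
  surface_cost p p / ln (odds a' / odds a) * (size (bvec L))%:R.
Proof.
move=> ha ha' hp aa'; have := energy_gap L ha ha' hp hp.
have t0 := ln_ratio_gt0 (odds_gt0 ha) (lt_odds ha ha' aa').
rewrite (@eq_drc_mean _ _ _ a p L ones _
  (fun t => ln (odds a' / odds a) * num_vertices L t)); last first.
  move=> t _; rewrite /energy !divff ?gt_eqF ?odds_gt0 ?root1_gt0 //.
  by rewrite ln1 !mul0r !addr0.
rewrite (@eq_drc_mean _ _ _ a' p L zeros _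
  (fun t => ln (odds a' / odds a) * num_vertices L t)); last first.
  move=> t _; rewrite /energy !divff ?gt_eqF ?odds_gt0 ?root1_gt0 //.
  by rewrite ln1 !mul0r !addr0.
by rewrite !drc_meanZ -mulrBr -ler_pdivlMl // mulrA [_^-1 * _]mulrC.
Qed.

Lemma lt_root1 p p' : 0 < p < 1 -> 0 < p' < 1 -> p < p' ->
  root1 p' < root1 p.
Proof.
move=> hp hp' pp'; rewrite ltr_sqrt ?subr_gt0; first by rewrite ltrD2l ltrN2.
by case/andP: hp.
Qed.

(** As r decreases with p, the number of available edges enters the energy negatively. Moved to the
    right, it must be bounded from above. *)
Lemma edge_gap a p p' L : 0 < a < 1 -> 0 < p < 1 -> 0 < p' < 1 -> p < p' ->
  ln (odds p' / odds p) * (drc_mean q a p L ones (num_open L) -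
    drc_mean q a p' L zeros (num_open L)) <=
  ln (root1 p / root1 p') * (drc_mean q a p L ones (num_available L) -
    drc_mean q a p' L zeros (num_available L)) +
  surface_cost p p' * (size (bvec L))%:R.
Proof.
move=> ha hp hp' pp'; have := energy_gap L ha ha hp hp'.
have E lam p1 : drc_mean q a p1 L lam (energy a a p p' L) =
    ln (odds p' / odds p) * drc_mean q a p1 L lam (num_open L) -
    ln (root1 p / root1 p') * drc_mean q a p1 L lam (num_available L).
  rewrite -mulNr -!drc_meanZ -drc_meanD; apply: eq_drc_mean => t _.
  rewrite /energy divff ?gt_eqF ?odds_gt0 // ln1 mul0r add0r.
  congr (_ + _ * _); rewrite -lnV ?posrE ?divr_gt0 ?root1_gt0 //.
  by rewrite invf_div.
rewrite !E !mulrBr; lra.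
Qed.

End tilting.

(** * Densities of the extremal limits *)

Lemma sum_const_seq (R : pzSemiRingType) (T : Type) (s : seq T) (c : R) :
  \sum_(x <- s) c = c * (size s)%:R.
Proof. by rewrite big_const_seq count_predT iter_addr_0 mulr_natr. Qed.

(** Isolates the arithmetic of [open_upper_le_lower]. [N], [K] and [O] are mean numbers of occupied
    vertices, available edges and open edges; the digit is the boundary condition, a final letter
    the vertex parameter among c < m < b. Alone, [s] is the volume and [b] the boundary size. The
    key is N1m - N0m <= e s + (C1 + C2) b, by comparing N1m with N0b and N0m with N1c. *)
Lemma combine_gaps (R : realType) (u v D s b cc C1 C2 e lob lc uc la lm ua um
    N0b N1c N0m N1m K0 K0' K1 O0 O1 : R) :
  0 < u -> 0 < v -> 0 <= D -> 0 < s -> 0 <= b ->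
  u * (O1 - O0) <= v * (K1 - K0') + cc * b ->
  N1m - N0b <= C1 * b -> N1c - N0m <= C2 * b ->
  K1 - K0 <= D * (N1m - N0m) + 2 * b -> K0 <= K0' ->
  N0b <= lob * s -> uc * s <= N1c -> um * s <= O1 -> O0 <= lm * s ->
  lc <= uc -> ua <= um -> lm <= la -> lob - lc <= e ->
  (u * (ua - la) - v * (D * e)) * s <=
  (v * (D * (C1 + C2) + 2) + cc) * b.
Proof.
move=> u0 v0 D0 s0 b0 E V1 V2 K K' N1 N2 O1' O2' N3 O3 O4 G.
have s1 : (ua - la) * s <= O1 - O0.
  have : ua * s <= um * s by rewrite ler_pM2r.
  have : lm * s <= la * s by rewrite ler_pM2r.
  by rewrite mulrBl; lra.
have s2 : N1m - N0m <= e * s + (C1 + C2) * b.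
  have : lc * s <= uc * s by rewrite ler_pM2r.
  have : (lob - lc) * s <= e * s by rewrite ler_pM2r.
  by rewrite mulrBl mulrDl; lra.
have s3 : D * (N1m - N0m) <= D * (e * s + (C1 + C2) * b) by rewrite ler_wpM2l.
have s4 : v * (K1 - K0') <= v * (D * (e * s + (C1 + C2) * b) + 2 * b).
  by rewrite ler_pM2l //; lra.
have s5 : u * ((ua - la) * s) <= u * (O1 - O0) by rewrite ler_pM2l.
by clear - E s4 s5; lra.
Qed.

Section sum_minus_all.
Context {R : realType} {d : nat} (T : eqType) (s : seq T) (c : T -> config d -> bool).

(** That this function is increasing bounds the effect of the boundary condition on a joint event by
    the sum of its effects on the single events. *)
Definition sum_minus_all (t : config d) : R :=
  \sum_(x <- s) (c x t)%:R - (all (c^~ t) s)%:R.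

Context (s0 : s != [::]).

Lemma sum_minus_all_ge0 t : 0 <= sum_minus_all t.
Proof.
rewrite /sum_minus_all subr_ge0 sum_of_bool ler_nat.
have [|//] := boolP (all _ _); rewrite all_count => /eqP ->.
by rewrite lt0n size_eq0.
Qed.

(** When the last condition becomes true the value stays in order: it is the length of [s] minus 1
    if all hold, and at most that if one fails. *)
Lemma increasing_sum_minus_all :
  (forall x t t', cfg_le t t' -> c x t -> c x t') -> increasing sum_minus_all.
Proof.
move=> cm t t' tt'; rewrite /sum_minus_all.
have [al|al] := boolP (all (c^~ t') s); last first.
  have -> : all (c^~ t) s = false.
    apply: contraNF al => /allP h; apply/allP => x /h; exact: cm.
  rewrite !subr0; apply: ler_sum => x _.
  by rewrite ler_nat; case E : (c x t) => //; rewrite (cm _ _ _ tt' E).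
rewrite !sum_of_bool; move: (al); rewrite all_count => /eqP ->.
have [|al'] := boolP (all (c^~ t) s); first by rewrite all_count => /eqP ->.
rewrite subr0 lerBrDr -natrD ler_nat addn1 ltn_neqAle count_size andbT.
by rewrite -all_count.
Qed.

End sum_minus_all.

Section density_limits.
Context {R : realType} {d : nat} (hd : (0 < d)%N) (q : R) (hq : 1 <= q <= 2).
Implicit Types (a p : R) (L : box d) (t : config d) (f : config d -> R).

(** For a nonnegative increasing [f] the means under ones decrease along the cubes and those under
    zeros increase, so the infimum and the supremum are limits. *)
Definition upper_limit f a p : R :=
  inf [set drc_mean q a p (cube n) ones f | n in setT].
Definition lower_limit f a p : R :=
  sup [set drc_mean q a p (cube n) zeros f | n in setT].

Lemma shift_increasing f z : increasing f -> increasing (fun t => f (shift z t)).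
Proof. by move=> fi t t' [h k]; apply: fi; split=> [x|e]; [exact: h|exact: k]. Qed.

Lemma drc_mean_zeros_le_ones a p L L' f : 0 < a < 1 -> 0 < p < 1 ->
  increasing f -> (forall t, 0 <= f t) ->
  drc_mean q a p L zeros f <= drc_mean q a p L' ones f.
Proof.
move=> ha hp fi f0.
have [m hm] := box_sub_cube L; have [n hn] := box_sub_cube L'.
apply: (@le_trans _ _ (drc_mean q a p (cube (m + n)) zeros f)).
  apply: drc_mean_zeros_sub => //; apply: subset_trans hm _.
  by apply: cube_mono; lia.
apply: (@le_trans _ _ (drc_mean q a p (cube (m + n)) ones f)).
  exact: drc_mean_mono.
apply: drc_mean_ones_sub => //; apply: subset_trans hn _.
by apply: cube_mono; lia.
Qed.

(** Shifting there and back is handled by inclusion of vertex sets, which the monotonicity in the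
    box accepts in place of an equality of boxes. *)
Lemma shift_box_sub L z :
  box_vertices L `<=` box_vertices (shift_box z (shift_box (- z) L)).
Proof.
by move=> x Lx; apply/box_vertices_shift/box_vertices_shift; rewrite opprK subrK.
Qed.

(** One-sided translation invariance: the limit bounds the mean at every site of every box, so
    summing over the sites compares a total count with volume times density. *)
Lemma upper_limit_le a p L z f : 0 < a < 1 -> 0 < p < 1 ->
  increasing f -> (forall t, 0 <= f t) ->
  upper_limit f a p <= drc_mean q a p L ones (fun t => f (shift z t)).
Proof.
move=> ha hp fi f0; have [n hn] := box_sub_cube (shift_box (- z) L).
apply: (@le_trans _ _ (drc_mean q a p (cube n) ones f)).
  apply: ge_inf; last by exists n.
  exists 0 => _ [m _ <-]; rewrite -(drc_mean_cst hq (cube m) 0 ha hp (@compatible_ones d)).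
  exact: le_drc_mean.
apply: (le_trans (drc_mean_ones_sub hd hq ha hp hn fi f0)).
rewrite -[ones]/(shift z ones) -drc_mean_shift //.
apply: drc_mean_ones_sub => //; first exact: shift_box_sub.
exact: shift_increasing.
Qed.

Lemma lower_limit_ge a p L z f : 0 < a < 1 -> 0 < p < 1 ->
  increasing f -> (forall t, 0 <= f t) ->
  drc_mean q a p L zeros (fun t => f (shift z t)) <= lower_limit f a p.
Proof.
move=> ha hp fi f0; have [n hn] := box_sub_cube (shift_box (- z) L).
apply: (@le_trans _ _ (drc_mean q a p (cube n) zeros f)); last first.
  apply: ub_le_sup; last by exists n.
  exists (drc_mean q a p (cube 0) ones f) => _ [m _ <-].
  exact: drc_mean_zeros_le_ones.
apply: le_trans (drc_mean_zeros_sub hd hq ha hp hn fi f0).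
rewrite -[zeros in leRHS]/(shift z zeros) -drc_mean_shift //.
apply: drc_mean_zeros_sub => //; first exact: shift_box_sub.
exact: shift_increasing.
Qed.

Lemma lower_limit_le_upper_limit a p f : 0 < a < 1 -> 0 < p < 1 ->
  increasing f -> (forall t, 0 <= f t) -> lower_limit f a p <= upper_limit f a p.
Proof.
move=> ha hp fi f0; apply: lb_le_inf.
  by exists (drc_mean q a p (cube 0) ones f); exists 0%N.
move=> _ [m _ <-]; apply: ge_sup.
  by exists (drc_mean q a p (cube 0) zeros f); exists 0%N.
by move=> _ [n _ <-]; exact: drc_mean_zeros_le_ones.
Qed.

Lemma upper_limit_mono a a' p p' f : 0 < a < 1 -> 0 < a' < 1 ->
  0 < p < 1 -> 0 < p' < 1 -> a <= a' -> p <= p' ->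
  increasing f -> (forall t, 0 <= f t) ->
  upper_limit f a p <= upper_limit f a' p'.
Proof.
move=> ha ha' hp hp' aa' pp' fi f0; apply: lb_le_inf.
  by exists (drc_mean q a' p' (cube 0) ones f); exists 0%N.
move=> _ [n _ <-].
apply: (@le_trans _ _ (drc_mean q a p (cube n) ones f)).
  have := @upper_limit_le a p (cube n) 0 f ha hp fi f0.
  rewrite (@eq_drc_mean _ _ _ _ _ _ _ (fun t => f (shift 0 t)) f) // => t _.
  congr f; rewrite /shift [RHS]surjective_pairing; congr pair.
    by apply/funext => x; rewrite addr0.
  by apply/funext => e; rewrite shift_edge0.
exact: drc_mean_mono.
Qed.

Lemma lower_limit_mono a a' p p' f : 0 < a < 1 -> 0 < a' < 1 ->
  0 < p < 1 -> 0 < p' < 1 -> a <= a' -> p <= p' ->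
  increasing f -> (forall t, 0 <= f t) ->
  lower_limit f a p <= lower_limit f a' p'.
Proof.
move=> ha ha' hp hp' aa' pp' fi f0; apply: ge_sup.
  by exists (drc_mean q a p (cube 0) zeros f); exists 0%N.
move=> _ [n _ <-].
apply: (@le_trans _ _ (drc_mean q a' p' (cube n) zeros f)).
  exact: drc_mean_mono.
apply: ub_le_sup; last by exists n.
exists (drc_mean q a' p' (cube 0) ones f) => _ [m _ <-].
exact: drc_mean_zeros_le_ones.
Qed.

Lemma lower_limit_bounds a p f : 0 < a < 1 -> 0 < p < 1 ->
  (forall t, 0 <= f t <= 1) -> 0 <= lower_limit f a p <= 1.
Proof.
move=> ha hp f01.
have mean1 n : drc_mean q a p (cube n) zeros f <= 1.
  rewrite -(drc_mean_cst hq (cube n) 1 ha hp (@compatible_zeros d)).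
  by apply: le_drc_mean => // t _; case/andP: (f01 t).
apply/andP; split; last first.
  apply: ge_sup; last by move=> _ [n _ <-].
  by exists (drc_mean q a p (cube 0) zeros f); exists 0%N.
apply: (@le_trans _ _ (drc_mean q a p (cube 0) zeros f)).
  rewrite -(drc_mean_cst hq (cube 0) 0 ha hp (@compatible_zeros d)).
  by apply: le_drc_mean => // t _; case/andP: (f01 t).
by apply: ub_le_sup; [exists 1 => _ [n _ <-]|exists 0%N].
Qed.

Definition occupied t : R := (t.1 0)%:R.
Definition open_at_origin t : R := \sum_(i <- enum 'I_d) (t.2 (edge_at 0 i))%:R.

Lemma increasing_occupied : increasing occupied.
Proof.
move=> t t' [h _]; rewrite /occupied ler_nat.
by case E : (t.1 0) => //; rewrite h.
Qed.

Lemma occupied_ge0 t : 0 <= occupied t. Proof. exact: ler0n. Qed.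

Lemma occupied_bounds t : 0 <= occupied t <= 1.
Proof. by rewrite occupied_ge0 /occupied lern1 leq_b1. Qed.

Lemma increasing_open_at_origin : increasing open_at_origin.
Proof.
move=> t t' [_ h]; apply: ler_sum => i _; rewrite ler_nat.
by case E : (t.2 _) => //; rewrite h.
Qed.

Lemma open_at_origin_ge0 t : 0 <= open_at_origin t.
Proof. by apply: sumr_ge0 => i _; exact: ler0n. Qed.

Let fi := increasing_occupied.
Let f0 := occupied_ge0.
Let gi := increasing_open_at_origin.
Let g0 := open_at_origin_ge0.

Lemma mean_num_verticesE a p L lam :
  drc_mean q a p L lam (num_vertices L) =
  \sum_(x <- vvec L) drc_mean q a p L lam (fun t => occupied (shift x t)).
Proof.
rewrite -drc_mean_sum; apply: eq_drc_mean => t _.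
rewrite /num_vertices -sum_of_bool; apply: eq_bigr => x _.
by rewrite /occupied /= add0r.
Qed.

Lemma mean_num_vertices_ge a p L : 0 < a < 1 -> 0 < p < 1 ->
  upper_limit occupied a p * (size (vvec L))%:R <=
  drc_mean q a p L ones (num_vertices L).
Proof.
move=> ha hp; rewrite mean_num_verticesE -sum_const_seq.
by apply: ler_sum => x _; exact: upper_limit_le.
Qed.

Lemma mean_num_vertices_le a p L : 0 < a < 1 -> 0 < p < 1 ->
  drc_mean q a p L zeros (num_vertices L) <=
  lower_limit occupied a p * (size (vvec L))%:R.
Proof.
move=> ha hp; rewrite mean_num_verticesE -sum_const_seq.
by apply: ler_sum => x _; exact: lower_limit_ge.
Qed.

Lemma num_positive_edges L t :
  \sum_(x <- vvec L) open_at_origin (shift x t) =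
  (count (t.2 : edge d -> bool) (positive_edges L))%:R.
Proof.
rewrite -sum_of_bool /positive_edges big_allpairs_dep; apply: eq_bigr => x _.
by apply: eq_bigr => i _; rewrite /= shift_edge_at add0r.
Qed.

Lemma mean_num_open_ge a p L : 0 < a < 1 -> 0 < p < 1 ->
  upper_limit open_at_origin a p * (size (vvec L))%:R <=
  drc_mean q a p L ones (num_open L).
Proof.
move=> ha hp; rewrite -sum_const_seq.
apply: (@le_trans _ _ (\sum_(x <- vvec L)
    drc_mean q a p L ones (fun t => open_at_origin (shift x t)))).
  by apply: ler_sum => x _; exact: upper_limit_le.
rewrite -drc_mean_sum; apply: le_drc_mean => // t _.
rewrite num_positive_edges /num_open ler_nat.
apply: count_sub_seq; first exact: uniq_positive_edges.
by move=> e /positive_edges_sub.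
Qed.

(** Under the zero boundary condition no boundary edge is open, so every open edge is among the
    positive ones. *)
Lemma mean_num_open_le a p L : 0 < a < 1 -> 0 < p < 1 ->
  drc_mean q a p L zeros (num_open L) <=
  lower_limit open_at_origin a p * (size (vvec L))%:R.
Proof.
move=> ha hp; rewrite -sum_const_seq.
apply: (@le_trans _ _ (\sum_(x <- vvec L)
    drc_mean q a p L zeros (fun t => open_at_origin (shift x t)))); last first.
  by apply: ler_sum => x _; exact: lower_limit_ge.
rewrite -drc_mean_sum; apply: le_drc_mean => // t [ct t1 t2].
rewrite num_positive_edges /num_open ler_nat.
apply: count_sub_seq; first exact: uniq_evec.
move=> e eL te; apply: interior_positive_edge => //.
by apply/asboolPn => -[x xe Lx]; have := ct e x te xe; rewrite t1.
Qed.

Lemma boundary_bound n :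
  (size (bvec (cube n : box d)))%:R * (n.*2.+1)%:R <=
  (d.*2)%:R * (size (vvec (cube n : box d)))%:R :> R.
Proof. by rewrite -!natrM ler_nat; exact: cube_boundary. Qed.

Lemma vvec_cube_pos n : 0 < (size (vvec (cube n : box d)))%:R :> R.
Proof. by rewrite ltr0n vvec_cube_gt0. Qed.

(** The boundary of the n-th cube is at most 2d/(2n+1) times its volume, hence negligible. *)
Lemma density_le0 (x c : R) :
  (forall n, x * (size (vvec (cube n : box d)))%:R <=
    c * (size (bvec (cube n : box d)))%:R) -> x <= 0.
Proof.
move=> h; apply: (@le0_archimedean _ _ (`|c| * (d.*2)%:R)) => n.
rewrite -(ler_pM2r (vvec_cube_pos n)) mulrAC.
apply: (@le_trans _ _ (`|c| * (size (bvec (cube n : box d)))%:R *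
    (n.*2.+1)%:R)).
  by rewrite ler_wpM2r // (le_trans (h n)) // ler_wpM2r // ler_norm.
by rewrite -!mulrA ler_wpM2l // boundary_bound.
Qed.

Theorem occupied_upper_le_lower a a' p : 0 < a < 1 -> 0 < a' < 1 ->
  0 < p < 1 -> a < a' ->
  upper_limit occupied a p <= lower_limit occupied a' p.
Proof.
move=> ha ha' hp aa'; rewrite -subr_le0.
apply: (@density_le0 _ (surface_cost q p p / ln (odds a' / odds a))) => n.
apply: le_trans (vertex_gap hd hq (cube n) ha ha' hp aa').
by rewrite mulrBl lerB ?mean_num_vertices_ge ?mean_num_vertices_le.
Qed.

Definition excess a p L x : R :=
  drc_mean q a p L ones (fun t => (t.1 x)%:R) -
  drc_mean q a p L zeros (fun t => (t.1 x)%:R).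

Lemma increasing_vertex x : increasing (fun t => (t.1 x)%:R : R).
Proof.
move=> t t' [h _]; rewrite ler_nat.
by case E : (t.1 x) => //; rewrite h.
Qed.

Lemma excess_bounds a p L x : 0 < a < 1 -> 0 < p < 1 ->
  0 <= excess a p L x <= 1.
Proof.
move=> ha hp; rewrite /excess subr_ge0 drc_mean_zeros_le_ones //=; last first.
  exact: increasing_vertex.
rewrite lerBlDr; apply: (@le_trans _ _ 1).
  rewrite -[leRHS](drc_mean_cst hq L 1 ha hp (@compatible_ones d)).
  by apply: le_drc_mean => // t _; rewrite lern1 leq_b1.
rewrite lerDl -[leLHS](drc_mean_cst hq L 0 ha hp (@compatible_zeros d)).
by apply: le_drc_mean => // t _; exact: ler0n.
Qed.

Lemma drc_meanB a p L lam f g :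
  drc_mean q a p L lam (fun t => f t - g t) =
  drc_mean q a p L lam f - drc_mean q a p L lam g.
Proof.
rewrite drc_meanD; congr (_ + _); rewrite -mulN1r -drc_meanZ.
by apply: eq_drc_mean => t _; rewrite mulN1r.
Qed.

Lemma all_difference_le (T : eqType) (s : seq T) (c : T -> config d -> bool)
    a p L : 0 < a < 1 -> 0 < p < 1 -> s != [::] ->
  (forall x t t', cfg_le t t' -> c x t -> c x t') ->
  drc_mean q a p L ones (fun t => (all (c^~ t) s)%:R) -
  drc_mean q a p L zeros (fun t => (all (c^~ t) s)%:R) <=
  \sum_(x <- s) (drc_mean q a p L ones (fun t => (c x t)%:R) -
    drc_mean q a p L zeros (fun t => (c x t)%:R)).
Proof.
move=> ha hp s0 cm.
have := @drc_mean_zeros_le_ones a p L L (sum_minus_all s c) ha hp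
  (increasing_sum_minus_all s cm) (sum_minus_all_ge0 c s0).
rewrite /sum_minus_all !drc_meanB !drc_mean_sum sumrB; lra.
Qed.

Lemma available_all psi (e : edge d) :
  available psi e = all psi (enum_fset (val e)).
Proof. by apply/asboolP/allP => h x xe; exact: h. Qed.

(** An edge is available when both ends are occupied, so its gap is at most the sum of the gaps at
    its ends. A vertex of the box lies on at most 2d edges; ends outside occur on boundary edges
    only and cost at most 2 per such edge. *)
Lemma num_available_difference a p L : 0 < a < 1 -> 0 < p < 1 ->
  drc_mean q a p L ones (num_available L) -
  drc_mean q a p L zeros (num_available L) <=
  (d.*2)%:R * (drc_mean q a p L ones (num_vertices L) -
    drc_mean q a p L zeros (num_vertices L)) + 2 * (size (bvec L))%:R.
Proof.
move=> ha hp.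
have KE lam : drc_mean q a p L lam (num_available L) = \sum_(e <- evec L)
    drc_mean q a p L lam (fun t => (all (t.1 : zd d -> bool) (enum_fset (val e)))%:R).
  rewrite -drc_mean_sum; apply: eq_drc_mean => t _.
  rewrite /num_available -sum_of_bool; apply: eq_bigr => e _.
  by rewrite available_all.
have NE : drc_mean q a p L ones (num_vertices L) -
    drc_mean q a p L zeros (num_vertices L) = \sum_(x <- vvec L) excess a p L x.
  rewrite /excess sumrB -!drc_mean_sum; congr (_ - _);
  by apply: eq_drc_mean => t _; rewrite sum_of_bool.
rewrite !KE NE -sumrB.
apply: (@le_trans _ _ (\sum_(e <- evec L) \sum_(x <- enum_fset (val e))
    excess a p L x)).
  apply: ler_sum => e _.
  apply: (@all_difference_le _ _ (fun x t => t.1 x)) => //.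
    have [u [v [_ ve]]] := asboolP _ (valP e).
    apply/eqP => e0; have : u \in val e by rewrite ve !inE eqxx.
    by rewrite -[u \in val e]/(u \in enum_fset (val e)) e0.
  by move=> x t t' [h _]; exact: h.
have ex0 x : 0 <= excess a p L x by case/andP: (excess_bounds L x ha hp).
have ex1 x : excess a p L x <= 1 by case/andP: (excess_bounds L x ha hp).
have split e : \sum_(x <- enum_fset (val e)) excess a p L x <=
    \sum_(x <- vvec L) (x \in val e)%:R * excess a p L x +
    2 * (is_boundary L e)%:R.
  rewrite (bigID (mem (vvec L))) /=; apply: lerD.
    rewrite -big_filter.
    apply: (@le_trans _ _ (\sum_(x <- [seq x <- vvec L | x \in val e])
        excess a p L x)).
      apply: ler_sum_sub => //; rewrite ?filter_uniq ?uniq_vvec ?fset_uniq //.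
      by move=> x; rewrite !mem_filter andbC.
    rewrite big_filter big_mkcond; apply: ler_sum => x _.
    by case: (x \in val e); rewrite ?mul1r ?mul0r.
  have [be|nb] := boolP (is_boundary L e).
    rewrite mulr1; apply: (@le_trans _ _ (\sum_(x <- enum_fset (val e)) 1)).
      rewrite big_mkcond; apply: ler_sum => x _; by case: ifP => _.
    by rewrite sum_const_seq mul1r ler_nat size_edge.
  rewrite mulr0 big_seq_cond big1 // => x /andP[xe]; rewrite mem_vvec asboolT //.
  exact: (inner_vertices nb).
apply: (le_trans (ler_sum _ (fun e _ => split e))).
rewrite big_split /= -mulr_sumr sum_of_bool size_bvec lerD2r.
rewrite exchange_big mulr_sumr; apply: ler_sum => x _.
rewrite -mulr_suml sum_of_bool ler_wpM2r // ler_nat.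
exact: degree_le.
Qed.

Theorem open_upper_le_lower a a' p p' : 0 < a < 1 -> 0 < a' < 1 ->
  0 < p < 1 -> 0 < p' < 1 -> a < a' -> p < p' ->
  upper_limit open_at_origin a p <= lower_limit open_at_origin a' p'.
Proof.
move=> ha ha' hp hp' aa' pp'; rewrite -subr_le0.
set de := _ - _.
set u := ln (odds p' / odds p); set v := ln (root1 p / root1 p').
have u0 : 0 < u by apply: ln_ratio_gt0; rewrite ?odds_gt0 ?lt_odds.
have v0 : 0 < v by apply: ln_ratio_gt0; rewrite ?root1_gt0 ?lt_root1.
suff H e : 0 < e -> u * de <= v * ((d.*2)%:R * e).
  rewrite -(pmulr_rle0 _ u0) leNgt; apply/negP => ude.
  have D0 : 0 < v * (d.*2)%:R by rewrite mulr_gt0 // ltr0n double_gt0.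
  (* With this e the right-hand side of [H] is half of the positive number u de. *)
  have := H (u * de / (v * (d.*2)%:R) / 2).
  rewrite divr_gt0 ?divr_gt0 // => /(_ isT).
  by rewrite mulrA mulrA [v * _ * _]mulrC divfK ?gt_eqF //; lra.
move=> e0.
have inr x : a <= x <= a' -> 0 < x < 1.
  move=> /andP[ax xa']; case/andP: ha => a0 _; case/andP: ha' => _ a1.
  by rewrite (lt_le_trans a0 ax) (le_lt_trans xa' a1).
(* The densities under 0 and 1 may differ at a given parameter; a small rise of [G] from c to b
   forces them to be close in between. *)
pose G x := lower_limit occupied x p.
have [c [b [ac cb ba' Gcb]]] := @exists_small_increment _ G a a' e aa' e0
  (fun x hx => lower_limit_bounds (inr x hx) hp occupied_bounds).
(* Strictly between c and b, so [vertex_gap] applies on both sides: it bounds the density under 1 at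
   m by that under 0 at b, and the one under 1 at c by that under 0 at m. *)
pose m := (c + b) / 2.
have cm : c < m by rewrite /m midf_lt.
have mb : m < b by rewrite /m midf_lt.
have hc : 0 < c < 1 by apply: inr; rewrite ac ltW // (lt_le_trans cb).
have hb : 0 < b < 1 by apply: inr; rewrite ba' (le_trans ac) // ltW.
have hm : 0 < m < 1.
  by case/andP: hc => c0 _; case/andP: hb => _ b1; rewrite (lt_trans c0) ?(lt_trans mb).
have am : a <= m by rewrite (le_trans ac) // ltW.
have ma' : m <= a' by rewrite (le_trans _ ba') // ltW.
pose C1 := surface_cost q p p / ln (odds b / odds m).
pose C2 := surface_cost q p p / ln (odds m / odds c).
rewrite -subr_le0; apply: (@density_le0 _
  (v * ((d.*2)%:R * (C1 + C2) + 2) + surface_cost q p p')) => n.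
have E := edge_gap hd hq (cube n) hm hp hp' pp'.
have V1 := vertex_gap hd hq (cube n) hm hb hp mb.
have V2 := vertex_gap hd hq (cube n) hc hm hp cm.
have K := num_available_difference (cube n) hm hp.
pose L : box d := cube n.
have K' : drc_mean q m p L zeros (num_available L) <=
    drc_mean q m p' L zeros (num_available L).
  apply: (drc_mean_mono hd hq (cube n) hm hm hp hp' (lexx m) (ltW pp')
    (@compatible_zeros d) (@compatible_zeros d) (cfg_le_zeros _)).
    move=> t t' [h _]; rewrite ler_nat; apply: sub_count => x.
    exact: available_mono.
  by move=> t; exact: ler0n.
have s0 := vvec_cube_pos n.
have b0 : 0 <= (size (bvec (cube n : box d)))%:R :> R by exact: ler0n.
have N1 := mean_num_vertices_le (cube n) hb hp.
have N2 := mean_num_vertices_ge (cube n) hc hp.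
have O1 := mean_num_open_ge (cube n) hm hp.
have O2 := mean_num_open_le (cube n) hm hp'.
have N3 : lower_limit occupied c p <= upper_limit occupied c p.
  exact: lower_limit_le_upper_limit.
have O3 : upper_limit open_at_origin a p <= upper_limit open_at_origin m p.
  by apply: upper_limit_mono.
have O4 : lower_limit open_at_origin m p' <= lower_limit open_at_origin a' p'.
  by apply: lower_limit_mono.
exact: (combine_gaps u0 v0 (ler0n R d.*2) s0 b0 E V1 V2 K K' N1 N2 O1 O2
  N3 O3 O4 Gcb).
Qed.

End density_limits.

(** * Cylinders and weak accumulation points *)

Lemma preimage_sigma_algebra (T U : Type) (f : T -> U) (S : set (set T)) :
  sigma_algebra setT S -> sigma_algebra setT [set B | S (f @^-1` B)].
Proof.
move=> [S0 SC Sb]; split => [|A SA|A SA] /=.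
- by rewrite preimage_set0.
- exact: (SC _ SA).
- by rewrite preimage_bigcup; exact: Sb.
Qed.

Section product_sigma_algebra.
Context {K : countType} {T : Type} (S : set (set T)) (X : T -> K -> bool).
Context (sigmaS : sigma_algebra setT S).
Context (coordS : forall x, S [set t | X t x]).

Let S0 : S set0. Proof. by case: sigmaS. Qed.
Let SC A : S A -> S (~` A). Proof. by case: sigmaS => _ h _ /h; rewrite setTD. Qed.
Let Sbigcup (A : (set T)^nat) : (forall n, S (A n)) -> S (\bigcup_k A k).
Proof. by case: sigmaS => _ _ h; exact: h. Qed.
Let ST : S setT. Proof. by rewrite -setC0; exact: SC. Qed.
Let SU A B : S A -> S B -> S (A `|` B).
Proof.
move=> SA SB; rewrite -bigcup2E; apply: Sbigcup => -[//|[//|n]]; exact: S0.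
Qed.
Let SI A B : S A -> S B -> S (A `&` B).
Proof. by move=> SA SB; rewrite -[_ `&` _]setCK setCI; apply/SC/SU; exact: SC. Qed.

Lemma finite_coordinates_sigma (s : seq K) (B : set (K -> bool)) :
  (forall c c', {in s, c =1 c'} -> B c -> B c') -> S (X @^-1` B).
Proof.
elim: s B => [|x s IH] B hB.
  have [[c Bc]|nB] := pselect (exists c, B c).
    by rewrite (_ : _ @^-1` _ = setT) //; apply/seteqP; split => // t _; exact: hB Bc.
  rewrite (_ : _ @^-1` _ = set0) //; apply/seteqP; split => // t Bt.
  by apply: nB; exists (X t).
have SB b : S (X @^-1` [set c | B (upd c x b)]).
  apply: IH => c c' cc'; apply: hB => y; rewrite /upd inE.
  by case: eqP => //= _; exact: cc'.
rewrite (_ : _ @^-1` _ =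
  ([set t | X t x] `&` (X @^-1` [set c | B (upd c x true)])) `|`
  (~` [set t | X t x] `&` (X @^-1` [set c | B (upd c x false)]))).
  by apply: SU; apply: SI => //; exact: SC.
apply/seteqP; split => t /=.
  move=> Bt; have := upd_same (X t) x; case: (X t x) => E; rewrite E; [left|right];
  by split.
by have := upd_same (X t) x; case: (X t x) => E [[]|[]] //; rewrite E.
Qed.

(** The configurations equal to [c] at all indices coded below n generate a filter that converges to
    [c], since convergence in the product is tested coordinate by coordinate. *)
Lemma ptws_nbhs_finite (c : {ptws K -> bool}) (U : set {ptws K -> bool}) :
  nbhs c U -> exists n, forall c' : K -> bool,
    (forall x, (choice.pickle x < n)%N -> c' x = c x) -> U c'.
Proof.
pose W n : set {ptws K -> bool} :=
  [set c' | forall x, (choice.pickle x < n)%N -> c' x = c x].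
pose F := filter_from [set: nat] W.
have FF : Filter F.
  apply: filter_from_filter; first by exists 0%N.
  move=> m n _ _; exists (maxn m n) => // c' h; split => x xn; apply: h.
    by rewrite (leq_trans xn) // leq_maxl.
  by rewrite (leq_trans xn) // leq_maxr.
have : F --> c.
  apply/cvg_sup => x A; rewrite nbhsE => -[B [[V oV VB] Bc] BA].
  exists (choice.pickle x).+1 => // c' h; apply: BA; rewrite -VB /= /proj.
  by rewrite h //; rewrite -VB in Bc.
by move=> Fc /Fc[n _ Wn]; exists n => c' h; exact: Wn.
Qed.

(** An open set is the union over n of the sets [V n], each determined by the finitely many
    coordinates coded below n. *)
Lemma open_preimage_sigma (U : set {ptws K -> bool}) : open U ->
  S (X @^-1` U).
Proof.
move=> oU.
pose V n : set (K -> bool) := [set c | forall c' : K -> bool,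
  (forall x, (choice.pickle x < n)%N -> c' x = c x) -> U c'].
rewrite (_ : X @^-1` U = \bigcup_n (X @^-1` V n)); last first.
  apply/seteqP; split => [t Ut|t [n _ /= Vt]]; last exact: Vt.
  have [n hn] := ptws_nbhs_finite (open_nbhs_nbhs (conj oU Ut)).
  by exists n.
apply: Sbigcup => n.
apply: (@finite_coordinates_sigma (pmap choice.unpickle (iota 0 n))) => c c' cc' Vc c'' h.
apply: Vc => x xn; rewrite h // cc' // mem_pmap; apply/mapP.
by exists (choice.pickle x); rewrite ?choice.pickleK // mem_iota.
Qed.

End product_sigma_algebra.

Section cylinders.
Context {d : nat}.

(** Only the value true is prescribed: such sets are closed under intersection and generate the
    sigma-algebra, and their indicators are increasing. *)
Definition cylinders (T : Type) (I : Type) (X : T -> I -> bool) : set (set T) :=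
  [set A | exists s, A = [set t | all (X t) s]].

Lemma setI_closed_cylinders (T I : Type) (X : T -> I -> bool) :
  setI_closed (cylinders X).
Proof.
move=> _ _ [s ->] [s' ->]; exists (s ++ s'); apply/seteqP; split => t /=.
  by rewrite all_cat => -[-> ->].
by rewrite all_cat => /andP.
Qed.

Definition site (psi : vertex_config d) (x : zd d) : bool := psi x.

Definition coordinate (t : config d) (i : zd d + edge d) : bool :=
  match i with inl x => t.1 x | inr e => t.2 e end.

Lemma site_near (psi : vertex_config d) x :
  \forall psi' \near psi, site psi' x = site psi x.
Proof.
have := @proj_continuous _ (fun=> bool) x (psi : {ptws zd d -> bool}).
by move=> /(_ [set psi x]); apply; exact: discrete_set1.
Qed.

Lemma edge_near (om : edge_config d) e :
  \forall om' \near om, (om' : edge d -> bool) e = om e.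
Proof.
have := @proj_continuous _ (fun=> bool) e (om : {ptws edge d -> bool}).
by move=> /(_ [set om e]); apply; exact: discrete_set1.
Qed.

Lemma coordinate_near (t : config d) i :
  \forall t' \near t, coordinate t' i = coordinate t i.
Proof.
case: i => [x|e] /=.
  have : fst @ t --> t.1 by exact: cvg_fst.
  by move=> /(_ _ (site_near t.1 x)).
have : snd @ t --> t.2 by exact: cvg_snd.
by move=> /(_ _ (edge_near t.2 e)).
Qed.

Lemma all_near (T : topologicalType) (I : Type) (X : T -> I -> bool) (s : seq I) :
  (forall t i, \forall t' \near t, X t' i = X t i) ->
  forall t, \forall t' \near t, all (X t') s = all (X t) s.
Proof.
move=> h t; elim: s => [|i s IH] /=; first exact: nearW.
by apply: filterS2 (h t i) IH => t' -> ->.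
Qed.

Lemma cylinder_open (T : topologicalType) (I : Type) (X : T -> I -> bool)
    (s : seq I) : (forall t i, \forall t' \near t, X t' i = X t i) ->
  open [set t | all (X t) s].
Proof.
move=> h; rewrite openE => t /= ts; rewrite /interior.
by apply: filterS (all_near s h t) => t' /= ->.
Qed.

Lemma vertex_measurableE :
  @measurable _ (vertex_config d) = <<s cylinders site >>.
Proof.
apply/seteqP; split.
  apply: smallest_sub; first exact: smallest_sigma_algebra.
  move=> U oU; have := @open_preimage_sigma _ _ <<s cylinders site >> site
    (smallest_sigma_algebra _ _).
  apply=> // x; apply: sub_sigma_algebra; exists [:: x].
  by apply/seteqP; split => t /=; rewrite ?andbT.
apply: smallest_sub; first exact: sigma_algebra_measurable.
move=> A [s ->]; apply: sub_sigma_algebra.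
exact/cylinder_open/site_near.
Qed.

Lemma config_measurableE :
  @measurable _ (config d) = <<s cylinders coordinate >>.
Proof.
have sS := @smallest_sigma_algebra _ setT (cylinders coordinate).
have coordS i : <<s cylinders coordinate >> [set t | coordinate t i].
  apply: sub_sigma_algebra; exists [:: i].
  by apply/seteqP; split => t /=; rewrite ?andbT.
apply/seteqP; split.
  apply: smallest_sub; first exact: smallest_sigma_algebra.
  rewrite subUset; split => A [B mB <-]; rewrite setTI.
  - have sub : <<s @open (vertex_config d) >> `<=`
        [set C | <<s cylinders coordinate >> (fst @^-1` C)].
      apply: smallest_sub; first exact: preimage_sigma_algebra.
      move=> U oU; apply: (@open_preimage_sigma _ _ _ (fun t : config d => t.1)) => //.
      by move=> x; exact: (coordS (inl x)).
    exact: sub.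
  - have sub : <<s @open (edge_config d) >> `<=`
        [set C | <<s cylinders coordinate >> (snd @^-1` C)].
      apply: smallest_sub; first exact: preimage_sigma_algebra.
      move=> U oU; apply: (@open_preimage_sigma _ _ _ (fun t : config d => t.2)) => //.
      by move=> e; exact: (coordS (inr e)).
    exact: sub.
apply: smallest_sub; first exact: sigma_algebra_measurable.
move=> A [s ->]; elim: s => [|i s IH].
  by rewrite [X in measurable X](_ : _ = setT) //; apply/seteqP.
rewrite [X in measurable X](_ : _ = [set t | coordinate t i] `&`
    [set t | all (coordinate t) s]); last first.
  by apply/seteqP; split => t /= /andP.
apply: measurableI => //; case: i => [x|e] /=.
- have mx : measurable [set psi : vertex_config d | psi x].
    apply: sub_sigma_algebra.
    have := @cylinder_open _ _ site [:: x] site_near.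
    by rewrite [X in open X](_ : _ = [set psi : vertex_config d | psi x]) //;
      apply/seteqP; split => psi /=; rewrite andbT.
  rewrite -[X in measurable X]setTI.
  exact: (@measurable_fst _ _ (vertex_config d) (edge_config d) measurableT _ mx).
- have me : measurable [set om : edge_config d | (om : edge d -> bool) e].
    apply: sub_sigma_algebra.
    have := @cylinder_open _ _ (fun (om : edge_config d) e => (om : edge d -> bool) e)
      [:: e] edge_near.
    by rewrite [X in open X](_ : _ = [set om : edge_config d | (om : edge d -> bool) e]) //;
      apply/seteqP; split => om /=; rewrite andbT.
  rewrite -[X in measurable X]setTI.
  exact: (@measurable_snd _ _ (vertex_config d) (edge_config d) measurableT _ me).
Qed.

End cylinders.

(* The library's [proj_continuous] asks for an [eqType] of indices. *)
Lemma ptws_eval_continuous (I : Type) (V : topologicalType) (i : I) :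
  continuous (fun h : {ptws I -> V} => h i).
Proof.
move=> h A hA.
have : nbhs (h : initial_topology (@proj _ (fun=> V) i)) (@proj _ (fun=> V) i @^-1` A).
  exact: (@initial_continuous _ _ (@proj _ (fun=> V) i) h A hA).
exact: ((@cvg_sup _ _ _ (nbhs h) h _).1 cvg_id i).
Qed.

Section weak_accumulation.
Context {R : realType} {disp} {T : TopologicalMeasurable.type disp}.
Context (I : Type) (X : T -> I -> bool).
Context (X_near : forall t i, \forall t' \near t, X t' i = X t i).

Lemma cylinder_indic_continuous (s : seq I) :
  continuous (fun t => (all (X t) s)%:R : R) /\
  bounded_fun (fun t => (all (X t) s)%:R : R).
Proof.
split; last first.
  exists 1; split; first exact: num_real.
  move=> M M1 t _ /=; apply: le_trans (ltW M1).
  by case: (all _ _); rewrite ?normr1 ?normr0.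
move=> t; apply: cvg_near_cst.
by apply: filterS (all_near s X_near t) => t' ->.
Qed.

Definition cylinder_indic (s : seq I) : @bounded_continuous R _ T :=
  exist _ _ (cylinder_indic_continuous s).

Context (X_measurable : forall s, measurable [set t | all (X t) s]).

Lemma integral_cylinder (P : probability T R) s :
  \int[P]_x sval (cylinder_indic s) x = fine (P [set t | all (X t) s]).
Proof.
rewrite /Rintegral; congr fine.
rewrite -[X in P X]setIT -integral_indic //.
by apply: eq_integral => t _ /=; rewrite indicE mem_setE.
Qed.

(** Coordinates are locally constant, so cylinder indicators are continuous and their integral is
    weakly continuous. A violated bound would define a neighbourhood of [mu] that some late term of
    the sequence enters. *)
Lemma accumulation_bounds (P : nat -> probability T R) (mu : probability T R)
    (s : seq I) (lo hi : R) (n0 : nat) :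
  weak_accumulation_point P mu ->
  (forall n, (n0 <= n)%N -> lo <= fine (P n [set t | all (X t) s]) <= hi) ->
  lo <= fine (mu [set t | all (X t) s]) <= hi.
Proof.
move=> acc bd.
pose ev (nu : @weak_space R _ T) : R :=
  \int[(nu : probability T R)]_x sval (cylinder_indic s) x.
have cev : continuous ev.
  move=> nu; apply: (@continuous_comp (@weak_space R _ T)
    {ptws (@bounded_continuous R _ T) -> R} R
    (fun (P : probability T R) (f : bounded_continuous) => \int[P]_x sval f x)
    (fun h => h (cylinder_indic s))).
    exact: initial_continuous.
  exact: ptws_eval_continuous.
have tail (A : set R) : nbhs (ev mu) A -> exists2 n, (n0 <= n)%N & A (ev (P n)).
  move=> /(cev mu) A'.
  have [nu [[n n0n <-] /= An]] := acc ((P : nat -> @weak_space R _ T) @` [set n | (n0 <= n)%N]) _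
    (ex_intro2 _ _ n0 Logic.I (fun n n0n => ex_intro2 _ _ n n0n erefl)) A'.
  by exists n.
rewrite -integral_cylinder -/(ev mu).
apply/andP; split; rewrite leNgt; apply/negP => h.
- have [|n n0n /=] := tail [set r | r < lo]; first exact: lt_nbhsl.
  by rewrite /ev integral_cylinder ltNge; case/andP: (bd n n0n) => ->.
- have [|n n0n /=] := tail [set r | hi < r]; first exact: lt_nbhsr.
  by rewrite /ev integral_cylinder ltNge; case/andP: (bd n n0n) => _ ->.
Qed.

End weak_accumulation.

(** * Uniqueness of limit measures *)

Section uniqueness.
Context {R : realType} {d : nat} (hd : (0 < d)%N) (q : R) (hq : 1 <= q <= 2).
Context (a p : R) (ha : 0 < a < 1) (hp : 0 < p < 1).
Implicit Types (L : box d) (t : config d) (f : config d -> R).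

Definition bc_gap n f : R :=
  drc_mean q a p (cube n) ones f - drc_mean q a p (cube n) zeros f.

Definition gap_vanishes f :=
  forall e : R, 0 < e -> exists N, forall n, (N <= n)%N -> bc_gap n f <= e.

(** Choose cubes where each limit is attained up to e/2; a cube that is large compared with [z]
    contains their translates by [z]. *)
Lemma gap_vanishes_shift f z : increasing f -> (forall t, 0 <= f t) ->
  upper_limit q f a p <= lower_limit q f a p ->
  gap_vanishes (fun t => f (shift z t)).
Proof.
move=> fi f0 ul e e0; have e20 : 0 < e / 2 by rewrite divr_gt0.
have [_ [m _ <-] hm] : exists2 y, [set drc_mean q a p (cube n : box d) ones f |
    n in setT] y & y < upper_limit q f a p + e / 2.
  apply: inf_adherent => //; split; first by eexists; exists 0%N.
  exists 0 => _ [n _ <-].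
  rewrite -[leLHS](drc_mean_cst hq (cube n) 0 ha hp (@compatible_ones d)).
  exact: le_drc_mean.
have [_ [m' _ <-] hm'] : exists2 y, [set drc_mean q a p (cube n : box d) zeros f |
    n in setT] y & lower_limit q f a p - e / 2 < y.
  apply: sup_adherent => //; split; first by eexists; exists 0%N.
  exists (drc_mean q a p (cube 0 : box d) ones f) => _ [n _ <-].
  exact: drc_mean_zeros_le_ones.
have [k zk] := in_cube z.
exists (k + maxn m m')%N => n hn; rewrite /bc_gap.
have fz : increasing (fun t => f (shift z t)) by exact: shift_increasing.
have up : drc_mean q a p (cube n) ones (fun t => f (shift z t)) <=
    drc_mean q a p (cube m) ones f.
  rewrite -[X in _ <= drc_mean _ _ _ _ X _]/(shift z ones) -drc_mean_shift //.
  apply: drc_mean_ones_sub => //; apply: subset_trans (cube_shift zk) _.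
  by apply: cube_mono; apply: leq_trans hn; rewrite leq_add2l leq_maxl.
have low : drc_mean q a p (cube m') zeros f <=
    drc_mean q a p (cube n) zeros (fun t => f (shift z t)).
  rewrite -[X in drc_mean _ _ _ _ X _ <= _]/(shift z zeros) -drc_mean_shift //.
  apply: drc_mean_zeros_sub => //; apply: subset_trans (cube_shift zk) _.
  by apply: cube_mono; apply: leq_trans hn; rewrite leq_add2l leq_maxr.
by lra.
Qed.

Lemma gap_vanishes_sum (I : Type) (s : seq I) (F : I -> config d -> R) :
  (forall i, gap_vanishes (F i)) ->
  forall e : R, 0 < e -> exists N, forall n, (N <= n)%N ->
  \sum_(i <- s) bc_gap n (F i) <= e.
Proof.
move=> h; elim: s => [|i s IH] e e0.
  by exists 0%N => n _; rewrite big_nil ltW.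
have e20 : 0 < e / 2 by rewrite divr_gt0.
have [N1 h1] := h i _ e20; have [N2 h2] := IH _ e20.
exists (maxn N1 N2) => n; rewrite geq_max => /andP[/h1 k1 /h2 k2].
by rewrite big_cons; lra.
Qed.

Lemma gap_vanishes_all (I : eqType) (s : seq I) (c : I -> config d -> bool) :
  (forall i t t', cfg_le t t' -> c i t -> c i t') ->
  (forall i, gap_vanishes (fun t => (c i t)%:R)) ->
  gap_vanishes (fun t => (all (c^~ t) s)%:R).
Proof.
move=> cm h e e0; have [s0|s0] := eqVneq s [::].
  by exists 0%N => n _; rewrite /bc_gap s0 /= !drc_mean_cst // subrr ltW.
have [N hN] := gap_vanishes_sum s h e0.
by exists N => n /hN; apply: le_trans; exact: all_difference_le.
Qed.

Lemma drc_measure_mean (L : box d) (lam : config d) (P : probability (config d) R)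
    (b : config d -> bool) :
  is_drc_measure a p q L lam P -> measurable [set t | b t] ->
  fine (P [set t | b t]) = drc_mean q a p L lam (fun t => (b t)%:R).
Proof.
move=> hP mb; rewrite hP //= /drc_mean /drc_sum; congr (_ * _).
rewrite setIC fsbig_mkcondr; apply: eq_fsbigr => t _.
have [bt|/negP bt] := boolP (b t).
  by rewrite mem_set // mulr1.
by rewrite memNset // mulr0.
Qed.

Lemma eventually_contains (L : nat -> box d) (s : seq (zd d)) :
  increases_to_lattice L ->
  exists K, forall k, (K <= k)%N -> forall x, x \in s -> box_vertices (L k) x.
Proof.
move=> [inc cov]; elim: s => [|y s [K hK]]; first by exists 0%N.
have [k _ Ly] : (\bigcup_n box_vertices (L n)) y by rewrite cov.
have mono m n : (m <= n)%N -> box_vertices (L m) `<=` box_vertices (L n).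
  move=> mn; rewrite -(subnKC mn); elim: (n - m)%N => [|j IH]; first by rewrite addn0.
  by rewrite addnS; exact: subset_trans IH (inc _).
exists (maxn k K) => n; rewrite geq_max => /andP[kn Kn] x.
by rewrite inE => /orP[/eqP ->|/(hK _ Kn)//]; exact: mono Ly.
Qed.

(** Whatever the boundary condition, it lies between zeros and ones, and shrinking the box to the
    fixed cube widens the interval between the two extremal means. *)
Lemma sequence_bounds (L : nat -> box d) (lam : config d)
    (P : nat -> probability (config d) R) (b : config d -> bool) n :
  drc_sequence a p q L lam P -> measurable [set t | b t] ->
  (forall t t', cfg_le t t' -> b t -> b t') ->
  exists K, forall k, (K <= k)%N ->
    drc_mean q a p (cube n) zeros (fun t => (b t)%:R) <=
    fine (P k [set t | b t]) <=
    drc_mean q a p (cube n) ones (fun t => (b t)%:R).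
Proof.
move=> [cl incL hP] mb bm.
have [K hK] := eventually_contains (vvec (cube n)) incL.
exists K => k Kk; rewrite (drc_measure_mean (hP k) mb).
have sub : box_vertices (cube n) `<=` box_vertices (L k).
  by move=> x cx; apply: hK => //; rewrite mem_vvec; apply/asboolP.
have bi : increasing (fun t => (b t)%:R : R).
  by move=> t t' tt'; rewrite ler_nat; case E : (b t) => //; rewrite (bm _ _ tt').
apply/andP; split.
- apply: (le_trans (drc_mean_zeros_sub hd hq ha hp sub bi _)) => //.
  exact: drc_mean_mono.
- apply: (le_trans _ (drc_mean_ones_sub hd hq ha hp sub bi _)) => //.
  exact: drc_mean_mono.
Qed.

Lemma coordinate_increasing i t t' : cfg_le t t' -> coordinate t i ->
  coordinate t' i.
Proof. by move=> [h k]; case: i => x; [exact: h|exact: k]. Qed.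

Lemma measurable_coordinates s : measurable [set t | all (@coordinate d t) s].
Proof. by rewrite config_measurableE; apply: sub_sigma_algebra; exists s. Qed.

Lemma measurable_sites s : measurable [set psi | all (@site d psi) s].
Proof. by rewrite vertex_measurableE; apply: sub_sigma_algebra; exists s. Qed.

(** Both measures lie between the same two means on each cylinder, so they agree on a generating
    pi-system. The space is abstract because the vertex measures and the joint measures are both
    treated. *)
Lemma squeezed_measures_eq disp (T : measurableType disp) (I : eqType)
    (X : T -> I -> bool) (c : I -> config d -> bool)
    (mu nu : probability T R) :
  @measurable _ T = <<s cylinders X >> ->
  (forall i t t', cfg_le t t' -> c i t -> c i t') ->
  (forall i, gap_vanishes (fun t => (c i t)%:R)) ->
  (forall n s, drc_mean q a p (cube n) zeros (fun t => (all (c^~ t) s)%:R) <=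
    fine (mu [set t | all (X t) s]) <=
    drc_mean q a p (cube n) ones (fun t => (all (c^~ t) s)%:R)) ->
  (forall n s, drc_mean q a p (cube n) zeros (fun t => (all (c^~ t) s)%:R) <=
    fine (nu [set t | all (X t) s]) <=
    drc_mean q a p (cube n) ones (fun t => (all (c^~ t) s)%:R)) ->
  forall A, measurable A -> mu A = nu A.
Proof.
move=> mE cm cg hmu hnu A mA.
have fin (P : probability T R) s : P [set t | all (X t) s] \is a fin_num.
  apply: fin_num_measure; rewrite mE; apply: sub_sigma_algebra; by exists s.
apply: (@measure_unique _ _ _ (cylinders X) (fun=> setT) mE) => //.
- exact: setI_closed_cylinders.
- by move=> _; exists [::]; apply/seteqP.
- exact: bigcup_const.
- move=> _ [s ->].
  suff E : fine (mu [set t | all (X t) s]) = fine (nu [set t | all (X t) s]).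
    exact: etrans (esym (fineK (fin mu s)))
      (etrans (congr1 EFin E) (fineK (fin nu s))).
  apply/eqP; rewrite eq_le; apply/andP; split; apply/ler_addgt0Pr => e e0.
    have [N hN] := gap_vanishes_all s cm cg e0.
    have /andP[m1 m2] := hmu N s; have /andP[n1 n2] := hnu N s.
    by have := hN N (leqnn _); rewrite /bc_gap; lra.
  have [N hN] := gap_vanishes_all s cm cg e0.
  have /andP[m1 m2] := hmu N s; have /andP[n1 n2] := hnu N s.
  by have := hN N (leqnn _); rewrite /bc_gap; lra.
- move=> _.
  exact: (eq_ind_r (fun z => (z < +oo)%E) (ltry 1) (probability_setT mu)).
Qed.

Lemma gap_vanishes_vertex x :
  upper_limit q (@occupied R d) a p <= lower_limit q (@occupied R d) a p ->
  gap_vanishes (fun t => (t.1 x)%:R).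
Proof.
move=> h; have := gap_vanishes_shift x (@increasing_occupied R d)
  (@occupied_ge0 R d) h.
by rewrite /occupied /= add0r.
Qed.

(** The edge density controls only the sum over the d directions at a vertex; the other summands
    have nonnegative gaps, so the gap of each single edge vanishes as well. *)
Lemma gap_vanishes_edge (e : edge d) :
  upper_limit q (@open_at_origin R d) a p <= lower_limit q (@open_at_origin R d) a p ->
  gap_vanishes (fun t => (t.2 e)%:R).
Proof.
move=> h.
have [x [i eE]] : exists x i, e = edge_at x i.
  have [u [v [uv ve]]] := asboolP _ (valP e).
  have [[i b] vE] := l1_dist1 uv; case: b vE; rewrite /neighbour /= => vE.
    by exists u, i; apply/val_inj; rewrite /= ve vE.
  by exists v, i; apply/val_inj; rewrite /= ve vE subrK fsetUC.
have := gap_vanishes_shift x (@increasing_open_at_origin R d)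
  (@open_at_origin_ge0 R d) h.
move=> hg eps eps0; have [N hN] := hg eps eps0; exists N => n /hN.
apply: le_trans; rewrite /bc_gap.
pose rest (t : config d) : R := \sum_(j <- enum 'I_d | j != i) (t.2 (edge_at x j))%:R.
have E : (fun t => open_at_origin (shift x t)) =
    (fun t => (t.2 e)%:R + rest t) :> (config d -> R).
  apply/funext => t; rewrite /open_at_origin /rest.
  rewrite (bigD1_seq i) ?mem_enum ?enum_uniq //= shift_edge_at add0r -eE.
  by congr (_ + _); apply: eq_bigr => j _; rewrite shift_edge_at add0r.
rewrite E !drc_meanD.
have := @drc_mean_zeros_le_ones _ _ hd q hq a p (cube n) (cube n) rest ha hp.
have ri : increasing rest.
  move=> t t' [_ k]; apply: ler_sum => j _; rewrite ler_nat.
  by case F : (t.2 _) => //; rewrite k.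
have r0 t : 0 <= rest t by apply: sumr_ge0 => j _; exact: ler0n.
by move=> /(_ ri r0); lra.
Qed.

Theorem limit_vertex_measure_unique :
  upper_limit q (@occupied R d) a p <= lower_limit q (@occupied R d) a p ->
  ~ at_least_two (limit_vertex_measures d a p q).
Proof.
move=> h [mu [nu [Wmu Wnu [A mA]]]]; apply.
pose c (x : zd d) (t : config d) : bool := t.1 x.
have bounds (m : probability (vertex_config d) R) :
    limit_vertex_measures d a p q m -> forall n s,
    drc_mean q a p (cube n) zeros (fun t => (all (c^~ t) s)%:R) <=
    fine (m [set psi | all (site psi) s]) <=
    drc_mean q a p (cube n) ones (fun t => (all (c^~ t) s)%:R).
  move=> [lam [L [P [hP acc]]]] n s.
  have mb : measurable [set t | all (c^~ t) s].
    have := measurable_coordinates (map inl s); congr measurable.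
    by apply/seteqP; split => t /=; rewrite all_map.
  have [|K hK] := @sequence_bounds L lam P (fun t => all (c^~ t) s) n hP mb.
    move=> t t' [k _] /allP ts; apply/allP => x /ts; exact: k.
  by apply: (accumulation_bounds (@site_near d) measurable_sites acc hK).
apply: (@squeezed_measures_eq _ _ _ (@site d) c) => //.
- exact: vertex_measurableE.
- by move=> x t t' [k _]; exact: k.
- by move=> x; exact: gap_vanishes_vertex.
- exact: bounds.
- exact: bounds.
Qed.

Theorem weak_limit_drc_measure_unique :
  upper_limit q (@occupied R d) a p <= lower_limit q (@occupied R d) a p ->
  upper_limit q (@open_at_origin R d) a p <= lower_limit q (@open_at_origin R d) a p ->
  ~ at_least_two (weak_limit_drc_measures d a p q).
Proof.
move=> h h' [mu [nu [Vmu Vnu [A mA]]]]; apply.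
pose c i (t : config d) : bool := coordinate t i.
have bounds (m : probability (config d) R) :
    weak_limit_drc_measures d a p q m -> forall n s,
    drc_mean q a p (cube n) zeros (fun t => (all (c^~ t) s)%:R) <=
    fine (m [set t | all (coordinate t) s]) <=
    drc_mean q a p (cube n) ones (fun t => (all (c^~ t) s)%:R).
  move=> [lam [L [P [hP acc]]]] n s.
  have [|K hK] := @sequence_bounds L lam P (fun t => all (c^~ t) s) n hP
      (measurable_coordinates s).
    move=> t t' tt' /allP ts; apply/allP => i /ts; exact: coordinate_increasing.
  by apply: (accumulation_bounds (@coordinate_near d) measurable_coordinates acc hK).
apply: (@squeezed_measures_eq _ _ _ (@coordinate d) c) => //.
- exact: config_measurableE.
- by move=> i t t'; exact: coordinate_increasing.
- by move=> [x|e]; [exact: gap_vanishes_vertex|exact: gap_vanishes_edge].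
- exact: bounds.
- exact: bounds.
Qed.

End uniqueness.

(** * Rectifiable covers *)

Section lipschitz_curves.
Context {R : realType}.
Implicit Types (u v : R * R) (g : R -> R * R).

Lemma polygonal_length_le g (a b : R) (s : seq R) (k : R) : 0 <= k ->
  (forall x y, euclidean_dist (g x) (g y) <= k * `|x - y|) ->
  itv_partition a b s -> polygonal_length g a s <= k * (b - a).
Proof.
move=> k0 lip [pas /eqP lb]; rewrite /polygonal_length.
have -> : b - a = \sum_(i < size s)
    (nth a (a :: s) i.+1 - nth a (a :: s) i).
  rewrite -(big_mkord xpredT (fun i => nth a (a :: s) i.+1 - nth a (a :: s) i)).
  rewrite telescope_sumr // -lb /= (last_nth a); congr (_ - _).
rewrite mulr_sumr; apply: ler_sum => i _; apply: le_trans (lip _ _) _.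
rewrite ler_wpM2l // distrC ger0_norm // subr_ge0.
by move/(pathP a): pas => /(_ i (ltn_ord i)) /ltW.
Qed.

Lemma lipschitz_rectifiable g (a b : R) (k : R) : 0 <= k -> a < b ->
  continuous g -> (forall x y, euclidean_dist (g x) (g y) <= k * `|x - y|) ->
  rectifiable_curve (g @` `[a, b]).
Proof.
move=> k0 ab cg lip; exists g, a, b; split => //.
  exact: continuous_subspaceT.
apply: (@le_lt_trans _ _ (k * (b - a))%:E); last exact: ltry.
apply: ge_ereal_sup => _ [s ps <-]; rewrite lee_fin.
exact: polygonal_length_le.
Qed.

(* In the coordinates x = u.1 - u.2, y = u.1 + u.2 such a set is the graph of a
   1-Lipschitz function, which McShane's formula extends to the whole line. *)
Lemma antichain_in_curve (S : set (R * R)) : S !=set0 ->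
  (forall u, S u -> 0 < u.1 < 1 /\ 0 < u.2 < 1) ->
  (forall u v, S u -> S v -> u.1 < v.1 -> u.2 < v.2 -> False) ->
  exists2 C, rectifiable_curve C & S `<=` C.
Proof.
move=> [u0 Su0] S01 anti.
pose h u x := u.1 + u.2 + `|x - (u.1 - u.2)|.
pose F x := inf [set h u x | u in S].
have h_ge0 u x : S u -> 0 <= h u x.
  move=> /S01[/andP[? _] /andP[? _]].
  by rewrite /h addr_ge0 // ltW // addr_gt0.
have lbF x : has_lbound [set h u x | u in S].
  by exists 0 => _ [u Su <-]; exact: h_ge0.
have F_le u x : S u -> F x <= h u x by move=> Su; apply: ge_inf => //; exists u.
have F_ge x m : (forall u, S u -> m <= h u x) -> m <= F x.
  move=> mh; apply: lb_le_inf; first by exists (h u0 x); exists u0.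
  by move=> _ [u Su <-]; exact: mh.
have FS u : S u -> F (u.1 - u.2) = u.1 + u.2.
  move=> Su; apply/eqP; rewrite eq_le; apply/andP; split.
    by apply: le_trans (F_le u _ Su) _; rewrite /h subrr normr0 addr0.
  apply: F_ge => v Sv; rewrite /h.
  have n1 := ler_norm (u.1 - u.2 - (v.1 - v.2)).
  have n2 := ler_norm (- (u.1 - u.2 - (v.1 - v.2))); rewrite normrN in n2.
  (* Since [v] is not strictly below [u] in both coordinates, the sum of coordinates rises from [v]
     to [u] by at most the absolute change of their difference. *)
  have [d1|d1] := leP u.1 v.1; first by lra.
  have [d2|d2] := leP u.2 v.2; first by lra.
  by case: (anti v u Sv Su d1 d2).
have Flip1 x y : F x <= F y + `|x - y|.
  rewrite -lerBlDr; apply: F_ge => u Su; rewrite lerBlDr.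
  apply: le_trans (F_le u x Su) _; rewrite /h.
  by have := ler_distD y x (u.1 - u.2); lra.
have Flip x y : `|F x - F y| <= `|x - y|.
  rewrite ler_norml lerBlDl lerNl opprB lerBlDl Flip1 andbT.
  by rewrite distrC Flip1.
pose g x : R * R := ((x + F x) / 2, (F x - x) / 2).
have cF : continuous F.
  move=> x; apply/cvgrPdist_le => e e0.
  have /cvgrPdist_le/(_ e e0) : id y @[y --> x] --> x by exact: cvg_id.
  by apply: filterS => y; exact: le_trans (Flip _ _).
have cg : continuous g.
  move=> x; have cid : id y @[y --> x] --> x by exact: cvg_id.
  have c1 : (y + F y) / 2 @[y --> x] --> (x + F x) / 2.
    by apply: cvgMl; apply: cvgD => //; exact: cF.
  have c2 : (F y - y) / 2 @[y --> x] --> (F x - x) / 2.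
    by apply: cvgMl; apply: cvgB => //; exact: cF.
  exact: (cvg_pair c1 c2).
(* In the unit square the difference of the coordinates lies in (-1, 1). Both coordinates of [g] are
   1-Lipschitz, so 2 is a Lipschitz constant for the Euclidean distance. *)
exists (g @` `[- 1, 1]).
  have ab : - 1 < 1 :> R by lra.
  apply: (@lipschitz_rectifiable g (- 1) 1 2 (ler0n _ 2) ab cg).
  move=> x y; rewrite /euclidean_dist /=.
  have n0 := normr_ge0 (x - y).
  rewrite -[leRHS]ger0_norm; last by rewrite mulr_ge0.
  rewrite -sqrtr_sqr ler_wsqrtr //.
  set A := (x + F x) / 2 - (y + F y) / 2.
  set B := (F x - x) / 2 - (F y - y) / 2.
  have := Flip x y; rewrite ler_norml => /andP[f1 f2].
  have m1 := ler_norm (x - y); have m2 := ler_norm (- (x - y)).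
  rewrite normrN in m2.
  have bound (z : R) : - `|x - y| <= z <= `|x - y| -> z ^+ 2 <= `|x - y| ^+ 2.
    rewrite -ler_norml => hz; rewrite -(@real_normK _ z) ?num_real //.
    by rewrite lerXn2r ?nnegrE.
  have hA : A ^+ 2 <= `|x - y| ^+ 2 by apply: bound; rewrite /A; apply/andP; split; lra.
  have hB : B ^+ 2 <= `|x - y| ^+ 2 by apply: bound; rewrite /B; apply/andP; split; lra.
  rewrite (exprMn _ 2); move: (`|x - y| ^+ 2) hA hB (sqr_ge0 `|x - y|) => N hA hB _.
  have : 0 <= N by apply: le_trans hA; exact: sqr_ge0.
  by move: (A ^+ 2) (B ^+ 2) hA hB => A2 B2; lra.
move=> u Su; exists (u.1 - u.2).
  by have [/andP[? ?] /andP[? ?]] := S01 u Su; rewrite /= in_itv /=; apply/andP; split; lra.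
by rewrite /g FS //; case: (u) => x y /=; congr pair; lra.
Qed.

End lipschitz_curves.

Section countable_covers.
Context {R : realType}.

Lemma countable_between (T : Type) (S : T -> Prop) (lo hi : T -> R) :
  (forall x, S x -> lo x < hi x) ->
  (forall x y, S x -> S y -> x <> y -> hi x <= lo y \/ hi y <= lo x) ->
  countable [set x | S x].
Proof.
move=> lh sep.
pose D (c : rat) := [set x | S x /\ lo x < ratr c < hi x].
apply: (@sub_countable _ _ _ (\bigcup_(c in [set: rat]) D c)).
  apply: subset_card_le => x Sx; have [c] := rat_in_itvoo (lh x Sx).
  by rewrite in_itv /= => hc; exists c.
apply: bigcup_countable => // c _; apply: finite_set_countable.
have [[x Dx]|nD] := pselect (exists x, D c x); last first.
  by rewrite (_ : D c = set0) //; apply/seteqP; split => // x Dx; case: nD; exists x.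
apply: (@sub_finite_set _ _ [set x]); last exact: finite_set1.
move=> y Dy; apply: contrapT => yx.
have [Sx /andP[x1 x2]] := Dx; have [Sy /andP[y1 y2]] := Dy.
have [h|h] := sep _ _ Sx Sy (fun e => yx (esym e)).
  by have := lt_le_trans x2 h; rewrite ltNge (ltW y1).
by have := lt_le_trans y2 h; rewrite ltNge (ltW x1).
Qed.

Lemma antichains_countably_covered (A : set (R * R)) (lo hi : bool -> R * R -> R) :
  (forall u, A u -> 0 < u.1 < 1 /\ 0 < u.2 < 1) ->
  (forall u, A u -> exists b, lo b u < hi b u) ->
  (forall b u v, 0 < u.1 < 1 /\ 0 < u.2 < 1 -> 0 < v.1 < 1 /\ 0 < v.2 < 1 ->
    u.1 < v.1 -> u.2 < v.2 -> hi b u <= lo b v) ->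
  countably_rectifiable_cover A.
Proof.
move=> A01 Alh mono.
pose S (i : bool * rat) : set (R * R) := [set u | (0 < u.1 < 1 /\ 0 < u.2 < 1) /\
  lo i.1 u < ratr i.2 < hi i.1 u].
(* [antichain_in_curve] speaks of nonempty sets, so the empty ones receive a dummy value and are
   left out of the family. *)
have curve i : exists C, S i !=set0 -> rectifiable_curve C /\ S i `<=` C.
  have [S0|S0] := pselect (S i !=set0); last by exists set0.
  have [|u v [u01 /andP[_ u2]] [v01 /andP[v1 _]] uv1 uv2|C rC SC] :=
    @antichain_in_curve _ (S i) S0; first by move=> u [].
    have := mono i.1 u v u01 v01 uv1 uv2.
    by move=> h; have := lt_le_trans u2 h; rewrite ltNge (ltW v1).
  by exists C.
pose C i := projT1 (cid (curve i)).
have CP i : S i !=set0 -> rectifiable_curve (C i) /\ S i `<=` C i.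
  exact: (projT2 (cid (curve i))).
exists (C @` [set i | S i !=set0]); split.
- apply: sub_countable (card_image_le _ _) _; exact: countableP.
- by move=> _ [i /CP[rC _] <-].
- move=> u Au; have [b lh] := Alh u Au; have [c] := rat_in_itvoo lh.
  rewrite in_itv /= => hc.
  have Su : S (b, c) u by split => //; exact: A01.
  have S0 : S (b, c) !=set0 by exists u.
  by exists (C (b, c)); [exists (b, c)|exact: (CP _ S0).2].
Qed.

End countable_covers.

Theorem theorem7p5 (R : realType) (d : nat) (q : R)
    (hd : (2 <= d)%N) (hq : 1 <= q <= 2) :
  (forall p : R, 0 < p < 1 ->
     countable [set a : R |
       0 < a < 1 /\ at_least_two (limit_vertex_measures d a p q)]) /\
  (q = 1 \/ q = 2 ->
     countably_rectifiable_cover [set ap : R * R |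
       [/\ 0 < ap.1 < 1, 0 < ap.2 < 1 &
           at_least_two (weak_limit_drc_measures d ap.1 ap.2 q)]]).
Proof.
have d0 : (0 < d)%N by exact: ltnW.
have occ := @increasing_occupied R d; have occ0 := @occupied_ge0 R d.
have opn := @increasing_open_at_origin R d; have opn0 := @open_at_origin_ge0 R d.
split=> [p hp|_].
  apply: (@countable_between R _ _
    (fun a => lower_limit q (@occupied R d) a p)
    (fun a => upper_limit q (@occupied R d) a p)).
    move=> a [ha two]; rewrite ltNge; apply/negP => h.
    exact: (limit_vertex_measure_unique d0 hq ha hp h two).
  move=> a a' [ha _] [ha' _] /eqP; rewrite neq_lt => /orP[aa'|aa']; [left|right];
    exact: (occupied_upper_le_lower d0 hq).
pose f (b : bool) : config d -> R := if b then occupied else open_at_origin.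
apply: (@antichains_countably_covered R _
  (fun b u => lower_limit q (f b) u.1 u.2)
  (fun b u => upper_limit q (f b) u.1 u.2)).
- by move=> u [].
- move=> u [ha hp two]; apply: contrapT => /forallNP no.
  apply: (weak_limit_drc_measure_unique d0 hq ha hp _ _ two).
    by have := no true; move/negP; rewrite -leNgt.
  by have := no false; move/negP; rewrite -leNgt.
- move=> [] u v [hu1 hu2] [hv1 hv2] uv1 uv2.
    (* The vertex comparison is made at the smaller p; the lower limit then increases with p. *)
    apply: (le_trans (occupied_upper_le_lower d0 hq hu1 hv1 hu2 uv1)).
    by apply: (lower_limit_mono d0 hq) => //; exact: ltW.
  exact: (open_upper_le_lower d0 hq).
Qed.
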